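(* Let $d\ge2$ and $T>0$. (i) Let $(R_0,u_0,b_0)\in L^1_{\rm loc}(\mathbb{R}^d)\times L^1_{\rm loc}(\mathbb{R}^d;\mathbb{R}^d)\times L^1_{\rm loc}(\mathbb{R}^d;\mathbb{R}^d)$ with $\mathrm{div}(u_0)=\mathrm{div}(b_0)=0$, and let $(R,u,b)$ be a weak solution (Definition A of the context) to the quasi-homogeneous ideal MHD system (MHD) related to that initial datum and to some hydrodynamic pressure function $\Pi$. Then, after defining $(\alpha_0,\beta_0)=(u_0+b_0,u_0-b_0)$ and $(\alpha,\beta)=(u+b,u-b)$, the triplet $(R,\alpha,\beta)$ is a weak solution (Definition B of the context) to the Elsässer system (E), with the initial datum $(R_0,\alpha_0,\beta_0)$ and for suitable ''pressure'' functions $\pi_1$ and $\pi_2$ such that $\nabla\pi=\nabla\pi_1=\nabla\pi_2$, where $\pi=\Pi+\tfrac12|b|^2$ is the MHD pressure. (ii) Conversely, let $(R_0,\alpha_0,\beta_0)\in L^1_{\rm loc}(\mathbb{R}^d)\times L^1_{\rm loc}(\mathbb{R}^d;\mathbb{R}^d)\times L^1_{\rm loc}(\mathbb{R}^d;\mathbb{R}^d)$ with $\mathrm{div}(\alpha_0)=\mathrm{div}(\beta_0)=0$, and let $(R,\alpha,\beta)$ be a corresponding weak solution (Definition B) to system (E), for suitable ''pressures'' $\pi_1$ and $\pi_2$. Assume that there exist $1\le p,q<+\infty$ such that $\alpha_0-\beta_0\in L^p$, $\alpha-\beta\in L^1_{\rm loc}([0,T[\,;L^p(\mathbb{R}^d;\mathbb{R}^d))$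 and $\alpha^j\beta^k\in L^1_{\rm loc}([0,T[\,;L^q(\mathbb{R}^d))$ for all $1\le j,k\le d$. Then one has $\nabla\pi_1=\nabla\pi_2$. Moreover, after defining $(u_0,b_0)=\big(\frac{\alpha_0+\beta_0}2,\frac{\alpha_0-\beta_0}2\big)$ and $(u,b)=\big(\frac{\alpha+\beta}2,\frac{\alpha-\beta}2\big)$, the triplet $(R,u,b)$ is a weak solution (Definition A) to system (MHD) related to the initial datum $(R_0,u_0,b_0)$, for a suitable hydrodynamic pressure function $\Pi$ such that $\nabla\Pi=\nabla\big(\pi_1-|b|^2/2\big)$.
   Context: $\mathfrak{C}\in\mathcal{M}_d(\mathbb{R})$ is a fixed real $d\times d$ matrix with constant coefficients. Conventions: $[\nabla\psi]_{ij}=\partial_i\psi_j$, $(v\otimes w):\nabla\psi=\sum_{i,j}v_iw_j\partial_i\psi_j$, $\mathrm{div}(v\otimes w)=\big(\sum_i\partial_i(v_iw_j)\big)_j$. System (MHD), for scalar $R,\Pi$ and vector fields $u,b$: $$\partial_tR+\mathrm{div}(Ru)=0,\quad \partial_tu+\mathrm{div}(u\otimes u-b\otimes b)+R\mathfrak{C}u+\nabla\big(\Pi+\tfrac12|b|^2\big)=0,\quad \partial_tb+\mathrm{div}(u\otimes b-b\otimes u)=0,\quad \mathrm{div}(u)=\mathrm{div}(b)=0.$$ System (E), for scalar $R,\pi_1,\pi_2$ and vector fields $\alpha,\beta$: $$\partial_tR+\mathrm{div}\big(\tfrac12R(\alpha+\beta)\big)=0,\quad \partial_t\alpha+(\beta\cdot\nabla)\alpha+\tfrac12R\mathfrak{C}(\alpha+\beta)+\nabla\pi_1=0,\quad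 \partial_t\beta+(\alpha\cdot\nabla)\beta+\tfrac12R\mathfrak{C}(\alpha+\beta)+\nabla\pi_2=0,\quad \mathrm{div}(\alpha)=\mathrm{div}(\beta)=0.$$ Definition A (weak solution of (MHD)). A triplet $(R,u,b)$ of tempered distributions on $[0,T[\,\times\mathbb{R}^d$ is a weak solution related to $(R_0,u_0,b_0)$ if: (1) $R,u,b$ are in $L^1_{\rm loc}([0,T[\,\times\mathbb{R}^d)$; (2) $u\otimes u-b\otimes b$, $u\otimes b-b\otimes u$ and $Ru$ are in $L^1_{\rm loc}([0,T[\,\times\mathbb{R}^d)$; (3) for all scalar $\phi\in\mathcal{D}([0,T[\,\times\mathbb{R}^d)$, $$\int_0^T\!\!\int\{R\partial_t\phi+Ru\cdot\nabla\phi\}\,dx\,dt+\int R_0\phi(0)\,dx=0;$$ for all $\psi\in\mathcal{D}([0,T[\,\times\mathbb{R}^d;\mathbb{R}^d)$ with $\mathrm{div}\,\psi=0$, $$\int_0^T\!\!\int\{u\cdot\partial_t\psi+(u\otimes u-b\otimes b):\nabla\psi-R\mathfrak{C}u\cdot\psi\}\,dx\,dt+\int u_0\cdot\psi(0)\,dx=0;$$ for all $\zeta\in\mathcal{D}([0,T[\,\times\mathbb{R}^d;\mathbb{R}^d)$, $$\int_0^T\!\!\int\{b\cdot\partial_t\zeta+(u\otimes b-b\otimes u):\nabla\zeta\}\,dx\,dt+\int b_0\cdot\zeta(0)\,dx=0;$$ (4) $\mathrm{div}(u)=0$ in $\mathcal{D}'(]0,T[\,\times\mathbb{R}^d)$.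 Definition B (weak solution of (E)). A triplet $(R,\alpha,\beta)$ of tempered distributions on $[0,T[\,\times\mathbb{R}^d$ is a weak solution related to $(R_0,\alpha_0,\beta_0)$ if: (1) $R,\alpha,\beta$ are in $L^1_{\rm loc}([0,T[\,\times\mathbb{R}^d)$; (2) $\alpha\otimes\beta$ and $R(\alpha+\beta)$ are in $L^1_{\rm loc}([0,T[\,\times\mathbb{R}^d)$; (3) the weak equation for $R$ in Definition A holds with $u$ replaced by $(\alpha+\beta)/2$; (4) for all $\psi\in\mathcal{D}([0,T[\,\times\mathbb{R}^d;\mathbb{R}^d)$ with $\mathrm{div}\,\psi=0$, $$\int_0^T\!\!\int\{\alpha\cdot\partial_t\psi+(\beta\otimes\alpha):\nabla\psi-\tfrac12R\mathfrak{C}(\alpha+\beta)\cdot\psi\}\,dx\,dt+\int\alpha_0\cdot\psi(0)\,dx=0,$$ and likewise for $\beta$ (exchanging the roles of $\alpha,\alpha_0$ and $\beta,\beta_0$); (5) $\mathrm{div}(\alpha)=\mathrm{div}(\beta)=0$ in $\mathcal{D}'(]0,T[\,\times\mathbb{R}^d)$. The pressures associated to a weak solution are tempered distributions $\Pi$ (resp. $\pi_1,\pi_2$) for which the momentum equation in (MHD) (resp. the equations on $\alpha$ and $\beta$ in (E)) holds in the sense of distributions; they exist because the equations hold against divergence-free test functions.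
   Formalization: As |b|^2 need not be locally integrable or tempered for a weak solution, the hydrodynamic pressure Π is taken as a formal sum of a distribution and a function; only the MHD pressure Π+|b|^2/2 is required to be a tempered distribution, and gradients are compared through differences. *)

(* Defs.v *)
From HB Require Import structures.
From mathcomp Require Import all_boot all_order all_algebra.
From mathcomp Require Import all_classical all_reals all_analysis.

Set Implicit Arguments.
Unset Strict Implicit.
Unset Printing Implicit Defensive.
Import Order.TTheory GRing.Theory Num.Theory.
Import numFieldNormedType.Exports.
Local Open Scope classical_set_scope.
Local Open Scope ring_scope.

Definition measure_rV_display : measure_display. Proof. exact. Qed.

(* The sigma-algebra generated by the coordinates, i.e., the Borel one. *)
Section measurable_rV.
Context {R : realType} {n : nat}.

Let coors : 'I_n -> 'rV[R]_n -> R := fun i x => x 0 i.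

Let rV_set0 : g_sigma_preimage coors set0.
Proof. exact: sigma_algebra0. Qed.

Let rV_setC A : g_sigma_preimage coors A -> g_sigma_preimage coors (~` A).
Proof. exact: sigma_algebraC. Qed.

Let rV_bigcup (F : (set 'rV[R]_n)^nat) :
  (forall i, g_sigma_preimage coors (F i)) ->
  g_sigma_preimage coors (\bigcup_i F i).
Proof. exact: sigma_algebra_bigcup. Qed.

HB.instance Definition _ := @isMeasurable.Build measure_rV_display
  'rV[R]_n (g_sigma_preimage coors) rV_set0 rV_setC rV_bigcup.

Lemma measurable_rV_coor (i : 'I_n) :
  measurable_fun [set: 'rV[R]_n] (fun x => x 0 i).
Proof.
move=> _ Y mY; rewrite setTI; apply: sub_sigma_algebra => /=.
rewrite -bigcup_seq/=; exists i => /=; first by rewrite mem_index_enum.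
by exists Y => //; rewrite setTI.
Qed.

Lemma measurable_fun_rV d (X : measurableType d) (f : X -> 'rV[R]_n) :
  (forall i, measurable_fun [set: X] (fun x => f x 0 i)) ->
  measurable_fun [set: X] f.
Proof.
move=> mf; suff : g_sigma_preimage (fun i => coors i \o f) `<=` measurable.
  rewrite g_sigma_preimage_comp => h _ A mA; apply: h; by exists A.
apply: smallest_sub; first exact: sigma_algebra_measurable.
move=> A; rewrite -bigcup_seq => -[i _ [B mB <-]].
exact: mf.
Qed.

End measurable_rV.

Section lebesgue_measure_rV.
Context {R : realType}.

(* [cons_rV] and [uncons_rV] identify R^(n+1) with R x R^n. *)
Definition cons_rV n (z : R * 'rV[R]_n) : 'rV[R]_n.+1 :=
  \row_i (if unlift ord0 i is Some j then z.2 0 j else z.1).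

Definition uncons_rV n (x : 'rV[R]_n.+1) : R * 'rV[R]_n :=
  (x 0 ord0, \row_i x 0 (lift ord0 i)).

Lemma cons_rV0 n (z : R * 'rV[R]_n) : cons_rV z 0 ord0 = z.1.
Proof. by rewrite mxE unlift_none. Qed.

Lemma cons_rVS n (z : R * 'rV[R]_n) (i : 'I_n) :
  cons_rV z 0 (lift ord0 i) = z.2 0 i.
Proof. by rewrite mxE liftK. Qed.

Lemma cons_rVK n : cancel (@cons_rV n) (@uncons_rV n).
Proof.
move=> [t x]; rewrite /uncons_rV cons_rV0; congr (_, _).
by apply/rowP => i; rewrite mxE cons_rVS.
Qed.

Lemma uncons_rVK n : cancel (@uncons_rV n) (@cons_rV n).
Proof.
move=> x; apply/rowP => i; have [j ->|->] := unliftP ord0 i.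
  by rewrite cons_rVS mxE.
by rewrite cons_rV0.
Qed.

Lemma measurable_cons_rV n : measurable_fun setT (@cons_rV n).
Proof.
apply: measurable_fun_rV => i; have [j ->|->] := unliftP ord0 i.
  under eq_fun do rewrite cons_rVS.
  by apply: (measurableT_comp (measurable_rV_coor j)); exact: measurable_snd.
under eq_fun do rewrite cons_rV0.
exact: measurable_fst.
Qed.

Lemma measurable_uncons_rV n : measurable_fun setT (@uncons_rV n).
Proof.
apply/measurable_fun_pairP; split; first exact: measurable_rV_coor.
apply: measurable_fun_rV => i /=; under eq_fun do rewrite mxE.
exact: measurable_rV_coor.
Qed.

Section step.
Variables (n : nat) (mu : {sigma_finite_measure set 'rV[R]_n -> \bar R}).

Definition lebesgue_rV_step : set 'rV[R]_n.+1 -> \bar R :=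
  pushforward (lebesgue_measure \x mu)%E (@cons_rV n).

Let step0 : lebesgue_rV_step set0 = 0%E.
Proof. by rewrite /lebesgue_rV_step /pushforward preimage_set0 measure0. Qed.

Let step_ge0 A : (0 <= lebesgue_rV_step A)%E.
Proof. exact: (measure_ge0 (lebesgue_measure \x mu)%E). Qed.

Let step_sigma_additive : semi_sigma_additive lebesgue_rV_step.
Proof. by apply: measure_semi_sigma_additive; exact: measurable_cons_rV. Qed.

HB.instance Definition _ := isMeasure.Build _ _ _ lebesgue_rV_step
  step0 step_ge0 step_sigma_additive.

Let step_sigma_finite : sigma_finite setT lebesgue_rV_step.
Proof.
have /sigma_finiteP[F [TF ndF Foo]] := sigma_finiteT (@lebesgue_measure R).
have /sigma_finiteP[G [TG ndG Goo]] := sigma_finiteT mu.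
exists (fun k => @uncons_rV n @^-1` (F k `*` G k)).
  rewrite -preimage_bigcup -[LHS](preimage_setT (@uncons_rV n)); congr preimage.
  apply/seteqP; split => // -[t x] _.
  have [i _ Fit] : (\bigcup_i F i) t by rewrite -TF.
  have [j _ Gjx] : (\bigcup_i G i) x by rewrite -TG.
  exists (maxn i j) => //; split => /=.
    by move: t Fit; exact/subsetPset/ndF/leq_maxl.
  by move: x Gjx; exact/subsetPset/ndG/leq_maxr.
move=> k; have [mF Fk] := Foo k; have [mG Gk] := Goo k; split.
  rewrite -[X in measurable X]setTI; apply: measurable_uncons_rV => //.
  exact: measurableX.
rewrite /lebesgue_rV_step /pushforward -comp_preimage.
rewrite (_ : _ \o _ = id); last by apply/funext => z /=; rewrite cons_rVK.
by rewrite preimage_id product_measure1E// lte_mul_pinfty// ge0_fin_numE.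
Qed.

HB.instance Definition _ := Measure_isSigmaFinite.Build _ _ _
  lebesgue_rV_step step_sigma_finite.

End step.

Fixpoint lebesgue_measure_rV n : {sigma_finite_measure set 'rV[R]_n -> \bar R} :=
  match n with
  | 0 => \d_(0 : 'rV[R]_0)
  | n'.+1 => lebesgue_rV_step (lebesgue_measure_rV n')
  end.

Lemma lebesgue_measure_rV_box n (A : 'I_n -> set R) :
  (forall i, measurable (A i)) ->
  lebesgue_measure_rV n [set x | forall i, A i (x 0 i)] =
    (\prod_(i < n) lebesgue_measure (A i))%E.
Proof.
elim: n A => [|n IHn] A mA.
  by rewrite big_ord0 /= diracE mem_set// => -[].
have mbox : measurable [set x : 'rV[R]_n | forall i, A (lift ord0 i) (x 0 i)].
  rewrite (_ : mkset _ = \big[setI/setT]_(i < n)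
      ((fun x : 'rV[R]_n => x 0 i) @^-1` A (lift ord0 i))).
    apply: bigsetI_measurable => i _; rewrite -[X in measurable X]setTI.
    exact: measurable_rV_coor.
  rewrite -bigcap_seq; apply/seteqP; split => x /= h.
    by move=> i _; exact: h.
  by move=> i; apply: (h i); rewrite /= mem_index_enum.
rewrite big_ord_recl -IHn// -product_measure1E//; last exact: mA.
rewrite /= /lebesgue_rV_step /pushforward; congr product_measure1.
apply/seteqP; split => z /=.
  by move=> h; split => [|i]; [have := h ord0; rewrite cons_rV0
                              |have := h (lift ord0 i); rewrite cons_rVS].
move=> [h0 h] i; have [j ->|->] := unliftP ord0 i; first by rewrite cons_rVS.
by rewrite cons_rV0.
Qed.

End lebesgue_measure_rV.

Section test_functions.
Context {R : realType} {V W : normedModType R}.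

Definition iter_derive (s : seq V) (f : V -> W) : V -> W :=
  foldr (fun v g => 'D_v g) f s.

(* For finite-dimensional V this is C^oo: all iterated directional derivatives
   exist and are continuous. *)
Definition smooth (f : V -> W) : Prop :=
  forall s : seq V, continuous (iter_derive s f) /\
    forall x v, derivable (iter_derive s f) x v.

Definition supp (f : V -> W) : set V := closure [set x | f x != 0].

Definition test_fun (Omega : set V) (f : V -> W) : Prop :=
  [/\ smooth f, compact (supp f) & supp f `<=` Omega].

End test_functions.

Section vectors.
Context {R : realType} {d : nat}.
Implicit Types (u v : 'rV[R]_d) (A B : 'M[R]_d).

Definition dot u v : R := \sum_i u 0 i * v 0 i.

Definition tens u v : 'M[R]_d := u^T *m v.

Definition ddot A B : R := \sum_i \sum_j A i j * B i j.

(* The product A u, for u seen as a column vector. *)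
Definition mulmxv A u : 'rV[R]_d := u *m A^T.

End vectors.

Section space.
Context {R : realType} {d : nat}.

Definition grad (phi : 'rV[R]_d -> R) (x : 'rV[R]_d) : 'rV[R]_d :=
  \row_i 'D_(delta_mx 0 i) phi x.

Definition L1loc_space (f : 'rV[R]_d -> R) : Prop :=
  measurable_fun setT f /\
  forall K : set 'rV[R]_d, compact K ->
    (lebesgue_measure_rV d).-integrable K (EFin \o f).

Definition L1loc_space_vec (u : 'rV[R]_d -> 'rV[R]_d) : Prop :=
  forall i, L1loc_space (fun x => u x 0 i).

(* div u = 0 in D'(R^d) *)
Definition div_free_space (u : 'rV[R]_d -> 'rV[R]_d) : Prop :=
  forall phi : 'rV[R]_d -> R, test_fun setT phi ->
    \int[lebesgue_measure_rV d]_x dot (u x) (grad phi x) = 0.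

End space.

Section spacetime.
Context {R : realType} {d : nat}.
Local Notation spacetime := (R * 'rV[R]_d)%type.
Implicit Types (phi f : spacetime -> R) (psi u v : spacetime -> 'rV[R]_d).

Definition lebesgue_spacetime :=
  (@lebesgue_measure R \x lebesgue_measure_rV d)%E.

Definition dir_t : spacetime := (1, 0).
Definition dir_x (i : 'I_d) : spacetime := (0, delta_mx 0 i).
Definition dir (o : option 'I_d) : spacetime :=
  if o is Some i then dir_x i else dir_t.

Definition grad_x phi (z : spacetime) : 'rV[R]_d :=
  \row_i 'D_(dir_x i) phi z.

Definition jac_x psi (z : spacetime) : 'M[R]_d :=
  \matrix_(i, j) ('D_(dir_x i) psi z) 0 j.

Definition div_x psi (z : spacetime) : R := \tr (jac_x psi z).

(* [0, T[ x R^d, ]0, T[ x R^d and ]-oo, T[ x R^d. Elements of D([0,T[ x R^d) are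
   restrictions to t >= 0 of elements of D(]-oo,T[ x R^d); they only occur in
   integrals over [0,T[ x R^d and through their values at t = 0. *)
Definition slab (T : R) : set spacetime := `[0, T[%classic `*` setT.
Definition open_slab (T : R) : set spacetime := `]0, T[%classic `*` setT.
Definition past_slab (T : R) : set spacetime := `]-oo, T[%classic `*` setT.

Definition L1loc (D : set spacetime) f : Prop :=
  measurable_fun D f /\
  forall K : set spacetime, K `<=` D -> compact K ->
    lebesgue_spacetime.-integrable K (EFin \o f).

Definition L1loc_vec (D : set spacetime) u : Prop :=
  forall i, L1loc D (fun z => u z 0 i).

Definition L1loc_mx (D : set spacetime) (A : spacetime -> 'M[R]_d) : Prop :=
  forall i j, L1loc D (fun z => A z i j).

(* L^1_loc([0,T[; L^p(R^d)) *)
Definition L1loc_Lp (T p : R) f : Prop :=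
  measurable_fun (slab T) f /\
  forall T', T' < T ->
    (\int[lebesgue_measure]_(t in `[0%R, T'])
      'N[lebesgue_measure_rV d]_p%:E[EFin \o (fun x => f (t, x))] < +oo)%E.

(* A distribution is a functional on test functions; its values outside
   of D(Omega) are irrelevant. *)
Definition functional := (spacetime -> R) -> R.

Definition schwartz_bound (N : nat) phi (M : R) : Prop :=
  forall s : seq (option 'I_d), (size s <= N)%N -> forall z,
    (1 + `|z|) ^+ N * `|iter_derive (map dir s) phi z| <= M.

(* Restrictions to Omega of tempered distributions on R x R^d, characterized by
   continuity on D(Omega) for the seminorms of the Schwartz space. *)
Definition tempered (Omega : set spacetime) (P : functional) : Prop :=
  (forall a phi1 phi2, test_fun Omega phi1 -> test_fun Omega phi2 ->
     P (fun z => a * phi1 z + phi2 z) = a * P phi1 + P phi2) /\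
  exists N K, forall phi M, test_fun Omega phi -> schwartz_bound N phi M ->
    `|P phi| <= K * M.

Definition reg_dist (D : set spacetime) f : functional :=
  fun phi => \int[lebesgue_spacetime]_(z in D) (f z * phi z).

(* f, extended by 0 to t < 0, is a tempered distribution. *)
Definition tempered_fun (T : R) f : Prop :=
  tempered (past_slab T) (reg_dist (slab T) f).

Definition tempered_vec (T : R) u : Prop :=
  forall i, tempered_fun T (fun z => u z 0 i).

(* div u = 0 in D'(]0,T[ x R^d) *)
Definition div_free (T : R) u : Prop :=
  forall phi, test_fun (open_slab T) phi ->
    \int[lebesgue_spacetime]_(z in open_slab T) dot (u z) (grad_x phi z) = 0.

End spacetime.

Arguments functional R d : clear implicits.

Section weak_solutions.
Context {R : realType} {d : nat} (C : 'M[R]_d) (T : R).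
Local Notation spacetime := (R * 'rV[R]_d)%type.
Local Notation mu := (lebesgue_measure_rV d).
Local Notation nu := lebesgue_spacetime.

Definition transport_weak (rho0 : 'rV[R]_d -> R)
    (rho : spacetime -> R) (u : spacetime -> 'rV[R]_d) : Prop :=
  forall phi : spacetime -> R, test_fun (past_slab T) phi ->
    \int[nu]_(z in slab T)
       (rho z * 'D_dir_t phi z + dot (rho z *: u z) (grad_x phi z))
    + \int[mu]_x (rho0 x * phi (0, x)) = 0.

Definition mhd_flux (u b : spacetime -> 'rV[R]_d) (z : spacetime) : 'M[R]_d :=
  tens (u z) (u z) - tens (b z) (b z).

Definition induction_flux (u b : spacetime -> 'rV[R]_d) (z : spacetime) :
    'M[R]_d :=
  tens (u z) (b z) - tens (b z) (u z).

Definition mhd_momentum (rho : spacetime -> R)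
    (u b psi : spacetime -> 'rV[R]_d) : R :=
  \int[nu]_(z in slab T)
     (dot (u z) ('D_dir_t psi z) + ddot (mhd_flux u b z) (jac_x psi z)
      - dot (rho z *: mulmxv C (u z)) (psi z)).

Definition elsasser_momentum (rho : spacetime -> R)
    (alpha beta psi : spacetime -> 'rV[R]_d) : R :=
  \int[nu]_(z in slab T)
     (dot (alpha z) ('D_dir_t psi z)
      + ddot (tens (beta z) (alpha z)) (jac_x psi z)
      - dot ((2^-1 * rho z) *: mulmxv C (alpha z + beta z)) (psi z)).

Record mhd_weak_solution (rho0 : 'rV[R]_d -> R) (u0 b0 : 'rV[R]_d -> 'rV[R]_d)
    (rho : spacetime -> R) (u b : spacetime -> 'rV[R]_d) : Prop := {
  mhd_tempered :
    [/\ tempered_fun T rho, tempered_vec T u & tempered_vec T b] ;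
  mhd_L1loc :
    [/\ L1loc (slab T) rho, L1loc_vec (slab T) u & L1loc_vec (slab T) b] ;
  mhd_L1loc_products :
    [/\ L1loc_mx (slab T) (mhd_flux u b),
        L1loc_mx (slab T) (induction_flux u b)
      & L1loc_vec (slab T) (fun z => rho z *: u z)] ;
  mhd_transport : transport_weak rho0 rho u ;
  mhd_velocity : forall psi : spacetime -> 'rV[R]_d,
    test_fun (past_slab T) psi -> (forall z, 0 <= z.1 -> div_x psi z = 0) ->
    mhd_momentum rho u b psi + \int[mu]_x dot (u0 x) (psi (0, x)) = 0 ;
  mhd_magnetic : forall zeta : spacetime -> 'rV[R]_d,
    test_fun (past_slab T) zeta ->
    \int[nu]_(z in slab T)
       (dot (b z) ('D_dir_t zeta z)
        + ddot (induction_flux u b z) (jac_x zeta z))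
    + \int[mu]_x dot (b0 x) (zeta (0, x)) = 0 ;
  mhd_div_free : div_free T u
}.

Record elsasser_weak_solution
    (rho0 : 'rV[R]_d -> R) (alpha0 beta0 : 'rV[R]_d -> 'rV[R]_d)
    (rho : spacetime -> R) (alpha beta : spacetime -> 'rV[R]_d) : Prop := {
  elsasser_tempered :
    [/\ tempered_fun T rho, tempered_vec T alpha & tempered_vec T beta] ;
  elsasser_L1loc :
    [/\ L1loc (slab T) rho, L1loc_vec (slab T) alpha
      & L1loc_vec (slab T) beta] ;
  elsasser_L1loc_products :
    L1loc_mx (slab T) (fun z => tens (alpha z) (beta z)) /\
    L1loc_vec (slab T) (fun z => rho z *: (alpha z + beta z)) ;
  elsasser_transport :
    transport_weak rho0 rho (fun z => 2^-1 *: (alpha z + beta z)) ;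
  elsasser_alpha : forall psi : spacetime -> 'rV[R]_d,
    test_fun (past_slab T) psi -> (forall z, 0 <= z.1 -> div_x psi z = 0) ->
    elsasser_momentum rho alpha beta psi
    + \int[mu]_x dot (alpha0 x) (psi (0, x)) = 0 ;
  elsasser_beta : forall psi : spacetime -> 'rV[R]_d,
    test_fun (past_slab T) psi -> (forall z, 0 <= z.1 -> div_x psi z = 0) ->
    elsasser_momentum rho beta alpha psi
    + \int[mu]_x dot (beta0 x) (psi (0, x)) = 0 ;
  elsasser_div_free : div_free T alpha /\ div_free T beta
}.

(* |b|^2 need not be locally integrable for a weak solution, so that Pi and
   |b|^2 / 2 need not be distributions separately. A pressure is therefore a
   formal sum [p_dist + p_fun] of a distribution on ]0,T[ x R^d and of
   a function; it denotes a distribution when [p_fun] is locally integrable. *)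
Record pressure := Pressure {
  p_dist : functional R d ;
  p_fun : spacetime -> R
}.

Definition dist_pressure (P : functional R d) := Pressure P (fun=> 0).

Definition add_pressure (p : pressure) (f : spacetime -> R) :=
  Pressure (p_dist p) (fun z => p_fun p z + f z).

Definition sub_pressure (p q : pressure) :=
  Pressure (fun phi => p_dist p phi - p_dist q phi)
           (fun z => p_fun p z - p_fun q z).

Definition pairing (p : pressure) : functional R d :=
  fun phi => p_dist p phi + reg_dist (open_slab T) (p_fun p) phi.

Definition tempered_pressure (p : pressure) : Prop :=
  L1loc (open_slab T) (p_fun p) /\ tempered (open_slab T) (pairing p).

(* grad p = grad q: p - q is a distribution, with zero spatial gradient. *)
Definition same_grad (p q : pressure) : Prop :=
  L1loc (open_slab T) (p_fun (sub_pressure p q)) /\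
  forall (i : 'I_d) (phi : spacetime -> R), test_fun (open_slab T) phi ->
    pairing (sub_pressure p q) ('D_(dir_x i) phi) = 0.

Definition magnetic_pressure (b : spacetime -> 'rV[R]_d) (z : spacetime) : R :=
  2^-1 * dot (b z) (b z).

(* The momentum equations hold in D'(]0,T[ x R^d), where <grad p, psi> is
   - <p, div psi>. *)
Definition mhd_pressure (rho : spacetime -> R) (u b : spacetime -> 'rV[R]_d)
    (Pi : pressure) : Prop :=
  let pi := add_pressure Pi (magnetic_pressure b) in
  tempered_pressure pi /\
  forall psi : spacetime -> 'rV[R]_d, test_fun (open_slab T) psi ->
    mhd_momentum rho u b psi + pairing pi (div_x psi) = 0.

Definition elsasser_pressures (rho : spacetime -> R)
    (alpha beta : spacetime -> 'rV[R]_d) (pi1 pi2 : functional R d) : Prop :=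
  [/\ tempered (open_slab T) pi1, tempered (open_slab T) pi2,
      forall psi : spacetime -> 'rV[R]_d, test_fun (open_slab T) psi ->
        elsasser_momentum rho alpha beta psi + pi1 (div_x psi) = 0
    & forall psi : spacetime -> 'rV[R]_d, test_fun (open_slab T) psi ->
        elsasser_momentum rho beta alpha psi + pi2 (div_x psi) = 0].

End weak_solutions.

(* Main.v *)
From HB Require Import structures.
Require Import Defs.
From mathcomp Require Import all_boot all_order all_algebra.
From mathcomp Require Import all_classical all_reals all_analysis.
From mathcomp Require Import measurable_realfun lra ring.
Import Order.TTheory GRing.Theory Num.Theory.
Import numFieldNormedType.Exports.
Local Open Scope classical_set_scope.
Local Open Scope ring_scope.

(** Put [alpha = u + b] and [beta = u - b].  The flux of [alpha] is then the sum
    of the momentum flux [u (x) u - b (x) b] and of the induction flux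
    [u (x) b - b (x) u], and the flux of [beta] is their difference
    ([elsasser_momentumE]).  Hence the two Elsasser equations are the sum and the
    difference of the momentum equation and of the induction equation.  The only
    obstruction to a purely algebraic equivalence is that both Elsasser equations
    are tested on divergence-free fields, whereas the induction equation is
    tested on all fields: it has no pressure.

    From (MHD) to (E), the algebra is enough, except that [b] must be shown to be
    divergence free.  Testing the induction equation on a gradient [grad chi],
    the flux disappears because it is antisymmetric and the Hessian of [chi] is
    symmetric, and the initial datum disappears because it is divergence free
    ([magnetic_form_grad]).  So [div b] is constant in time, and it vanishes
    ([div_free_of_induction]).  Both Elsasser pressures are the MHD pressure.

    From (E) to (MHD), the difference of the two equations is the induction
    equation, tested on divergence-free fields.  It has to be proved that it
    holds for all test fields [zeta], which also says that the gradients of the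
    two pressures agree ([induction_rigidity]).  Let [F zeta] be the left-hand
    side of the induction equation.  It vanishes on divergence-free fields, and
    also on gradients, since [b] is divergence free up to the initial time
    ([div_free_past]).  Now [Delta phi e_j] is the sum of the gradient of
    [d_j phi] and of a divergence-free field ([curl_field]), so that
    [F (Delta phi e_j) = 0].  Therefore the function that maps [y] to the value
    of [F] at the translate by [y] of [phi e_j] is harmonic on R^d.  By the
    integrability assumptions on [alpha - beta] and on the products
    [alpha^j beta^k], this function tends to [0] at infinity ([slab_decay],
    [space_decay]): the finiteness of [p] and [q] is what excludes constants.
    By the maximum principle it vanishes identically ([harmonic_le0]).

    All terms of the weak formulations are integrals of a locally integrable
    function against a translated test function.  They are handled uniformly as
    [pair_integral], over space-time or over the initial slice, and their
    regularity in the translation comes from differentiation under the integral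
    sign ([pair_integral_derive]). *)

Set Implicit Arguments.
Unset Strict Implicit.
Unset Printing Implicit Defensive.

(** * Borel sets of space-time *)

Section borel.
Context {R : realType} {d : nat}.
Local Notation spacetime := (R * 'rV[R]_d)%type.

Lemma measurable_box (A : 'I_d -> set R) : (forall i, measurable (A i)) ->
  measurable [set x : 'rV[R]_d | forall i, A i (x 0 i)].
Proof.
move=> mA; rewrite (_ : mkset _ = \big[setI/setT]_(i < d)
    ((fun x : 'rV[R]_d => x 0 i) @^-1` A i)).
  apply: bigsetI_measurable => i _; rewrite -[X in measurable X]setTI.
  exact: measurable_rV_coor.
rewrite -bigcap_seq; apply/seteqP; split => x /= h.
  by move=> i _; exact: h.
by move=> i; apply: (h i); rewrite /= mem_index_enum.
Qed.

Lemma ball_rVE (x : 'rV[R]_d) (e : R) : 0 < e ->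
  ball x e = [set y | forall i, ball (x 0 i) e (y 0 i)].
Proof.
move=> e0; apply/seteqP; split=> [y [_ h] i|y h]; first exact: h.
by split => // i j; rewrite (ord1 i); exact: h.
Qed.

Lemma measurable_ball_spacetime (z : spacetime) (e : R) : 0 < e ->
  measurable (ball z e).
Proof.
move=> e0; rewrite (_ : ball z e = ball z.1 e `*` ball z.2 e)//.
have m1 := measurable_realfun.measurable_ball z.1 e.
have m2 : measurable (ball z.2 e).
  rewrite ball_rVE//; apply: (@measurable_box (fun i => ball (z.2 0 i) e)) => i.
  exact (measurable_realfun.measurable_ball _ _).
exact: measurableX.
Qed.

Lemma ratr_approx (x e : R) : 0 < e -> exists q : rat, ball (ratr q : R) e x.
Proof.
move=> e0; have [q] := @rat_in_itvoo R (x - e) (x + e) ltac:(lra).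
rewrite in_itv/= => /andP[q1 q2]; exists q; rewrite /ball/= ltr_norml; lra.
Qed.

(** A countable dense family of points. *)
Definition rat_point (q : rat * {ffun 'I_d -> rat}) : spacetime :=
  (ratr q.1, \row_i ratr (q.2 i)).

Lemma rat_point_approx (z : spacetime) (e : R) : 0 < e ->
  exists q, ball (rat_point q) e z.
Proof.
move=> e0; have [q0 hq0] := ratr_approx z.1 e0.
have /choice[q hq] : forall i, exists q : rat, ball (ratr q : R) e (z.2 0 i).
  by move=> i; exact: ratr_approx.
exists (q0, [ffun i => q i]); split => //=; split => // i j.
by rewrite (ord1 i) mxE/= ffunE.
Qed.

(** Space-time is second countable, hence the product sigma-algebra contains
    every open set. *)
Lemma open_measurable_spacetime (U : set spacetime) : open U -> measurable U.
Proof.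
move=> oU.
pose B (p : rat * {ffun 'I_d -> rat} * nat) := ball (rat_point p.1) (p.2.+1%:R^-1 : R).
have -> : U = \bigcup_(p in [set p | B p `<=` U]) B p.
  apply/seteqP; split=> [z Uz|z [p /= pU Bz]]; last exact: pU.
  have /nbhs_ballP[e /= e0 eU] : nbhs z U by exact: open_nbhs_nbhs.
  have [n n_e] : exists n, n.+1%:R^-1 < e / 2.
    have [N _ /(_ N (leqnn N))] := near_infty_natSinv_lt (PosNum (divr_gt0 e0 (ltr0n R 2))).
    by exists N.
  have n0 : 0 < (n.+1%:R^-1 : R) by rewrite invr_gt0 ltr0n.
  have [q zq] := rat_point_approx z n0.
  exists (q, n) => //= y By; apply: eU; rewrite (splitr e).
  apply: (@ball_triangle _ _ (rat_point q)).
    by apply: ball_sym; apply: le_ball zq; exact: ltW.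
  by apply: le_ball By; exact: ltW.
rewrite bigcup_mkcond; apply: countable_bigcupT_measurable => [|p].
  exact: countableP.
case: ifPn => _ //; apply: measurable_ball_spacetime.
by rewrite invr_gt0 ltr0n.
Qed.

Lemma closed_measurable_spacetime (A : set spacetime) :
  closed A -> measurable A.
Proof.
move=> cA; rewrite -(setCK A); apply: measurableC.
by apply: open_measurable_spacetime; exact: closed_openC.
Qed.

Lemma compact_closed_spacetime (K : set spacetime) : compact K -> closed K.
Proof. by apply: compact_closed; exact: norm_hausdorff. Qed.

Lemma compact_measurable_spacetime (K : set spacetime) :
  compact K -> measurable K.
Proof.
by move=> cK; apply: closed_measurable_spacetime; exact: compact_closed_spacetime.
Qed.

Lemma continuous_measurable_spacetime (f : spacetime -> R) :
  continuous f -> measurable_fun setT f.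
Proof.
move=> cf; apply: (@measurability _ _ _ _ _ _ _
  (measurable_realfun.RGenOInfty.measurableE R)).
move=> _ [_ [a ->] <-]; rewrite setTI; apply: open_measurable_spacetime.
by apply: open_comp => //; exact: interval_open.
Qed.

Lemma measurable_slab (T : R) : measurable (slab T : set spacetime).
Proof. by apply: measurableX => //; exact: measurable_itv. Qed.

End borel.

(** * Smooth functions *)

Section smooth.
Context {R : realType}.
Implicit Types V W : normedModType R.

(** Smoothness is coinductive: it holds for the members of any class of
    continuous and derivable functions that is stable under directional
    derivatives.  All the stability properties below exhibit such a class. *)
Lemma smooth_coind V W (P : set (V -> W)) :
  (forall f, P f -> continuous f) ->
  (forall f, P f -> forall x v, derivable f x v) ->
  (forall f, P f -> forall v, P ('D_v f)) ->
  forall f, P f -> smooth f.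
Proof.
move=> Pc Pd PD f Pf s; have Ps : P (iter_derive s f).
  by elim: s => //= v s IHs; exact: PD.
by split; [exact: Pc|exact: Pd].
Qed.

Lemma smooth_continuous V W (f : V -> W) : smooth f -> continuous f.
Proof. by move=> /(_ [::])[]. Qed.

Lemma smooth_derivable V W (f : V -> W) : smooth f ->
  forall x v, derivable f x v.
Proof. by move=> /(_ [::])[]. Qed.

Lemma smooth_derive V W (f : V -> W) v : smooth f -> smooth ('D_v f).
Proof.
by move=> sf s; have := sf (rcons s v); rewrite /iter_derive foldr_rcons.
Qed.

Lemma smoothD V W (f g : V -> W) : smooth f -> smooth g ->
  smooth (fun x => f x + g x).
Proof.
move=> sf sg; apply: (@smooth_coind _ _ [set h | exists f g,
  [/\ smooth f, smooth g & h = fun x => f x + g x]]); last by exists f, g.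
- move=> _ [{sf sg}f [{}g [sf sg ->]]] x.
  by apply: cvgD; exact: smooth_continuous.
- move=> _ [{sf sg}f [{}g [sf sg ->]]] x v.
  by apply: derivableD; exact: smooth_derivable.
- move=> _ [{sf sg}f [{}g [sf sg ->]]] v; exists ('D_v f), ('D_v g).
  split; [exact: smooth_derive|exact: smooth_derive|].
  by apply/funext => x; rewrite deriveD//; exact: smooth_derivable.
Qed.

Lemma smoothZ V W (k : R) (f : V -> W) : smooth f -> smooth (fun x => k *: f x).
Proof.
move=> sf; apply: (@smooth_coind _ _ [set h | exists2 f,
  smooth f & h = fun x => k *: f x]); last by exists f.
- move=> _ [{sf}f sf ->] x.
  by apply: cvgZr; exact: smooth_continuous.
- move=> _ [{sf}f sf ->] x v.
  by apply: derivableZ; exact: smooth_derivable.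
- move=> _ [{sf}f sf ->] v; exists ('D_v f); first exact: smooth_derive.
  by apply/funext => x; rewrite deriveZ//; exact: smooth_derivable.
Qed.

Lemma derive_translate V W (f : V -> W) (a x v : V) :
  'D_v (fun z => f (z + a)) x = 'D_v f (x + a).
Proof. by rewrite /derive /=; under eq_fun do rewrite -addrA. Qed.

Lemma derive_translateE V W (f : V -> W) (a v : V) :
  'D_v (fun z => f (z + a)) = fun z => 'D_v f (z + a).
Proof. by apply/funext => z; exact: derive_translate. Qed.

Lemma derivable_translate V W (f : V -> W) (a x v : V) :
  derivable f (x + a) v -> derivable (fun z => f (z + a)) x v.
Proof. by rewrite /derivable /=; under [in X in _ -> X]eq_fun do rewrite -addrA. Qed.

Lemma continuous_translate V W (f : V -> W) (a : V) : continuous f ->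
  continuous (fun z => f (z + a)).
Proof.
move=> cf x; apply: (@continuous_comp _ _ _ (fun z => z + a) f _ _ (cf _)).
by apply: cvgD; [exact: cvg_id|exact: cvg_cst].
Qed.

Lemma smooth_translate V W (f : V -> W) (a : V) : smooth f ->
  smooth (fun z => f (z + a)).
Proof.
move=> sf; apply: (@smooth_coind _ _ [set h | exists2 f,
  smooth f & h = fun z => f (z + a)]); last by exists f.
- move=> _ [{sf}f sf ->]; apply: continuous_translate.
  exact: smooth_continuous.
- move=> _ [{sf}f sf ->] x v; apply: derivable_translate.
  exact: smooth_derivable.
- move=> _ [{sf}f sf ->] v; exists ('D_v f); first exact: smooth_derive.
  by apply/funext => x; rewrite derive_translate.
Qed.

Lemma continuous_rowP V n (f : V -> 'rV[R]_n) :
  (forall i, continuous (fun x => f x 0 i)) -> continuous f.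
Proof.
move=> cf x; apply/cvgrPdist_le => e e0; near=> y.
rewrite [leLHS]/Num.Def.normr/= mx_normrE (bigmax_le _ (ltW e0))//= => -[i j] _.
rewrite !mxE/= (ord1 i); move: j {i}; near: y; apply: filter_forall => j.
by have /cvgrPdist_le := cf j x; exact.
Unshelve. all: by end_near. Qed.

Lemma continuous_coord n (i : 'I_n) : continuous (fun x : 'rV[R]_n => x 0 i).
Proof. exact: coord_continuous. Qed.

Lemma derivable_coord V n (f : V -> 'rV[R]_n) x v i :
  derivable f x v -> derivable (fun z => f z 0 i) x v.
Proof. by move=> /derivable_mxP; exact. Qed.

Lemma derive_coord V n (f : V -> 'rV[R]_n) x v i :
  derivable f x v -> ('D_v f x) 0 i = 'D_v (fun z => f z 0 i) x.
Proof. by move=> df; rewrite derive_mx// mxE. Qed.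

Lemma smooth_rowP V n (f : V -> 'rV[R]_n) :
  smooth f <-> forall i, smooth (fun x => f x 0 i).
Proof.
split=> [sf i|sf].
  apply: (@smooth_coind _ _ [set h | exists2 f : V -> 'rV[R]_n,
    smooth f & h = fun z => f z 0 i]); last by exists f.
  - move=> _ [{sf}f sf ->] x.
    apply: (@continuous_comp _ _ _ f (fun y => y 0 i)) (@continuous_coord _ i _).
    exact: smooth_continuous.
  - move=> _ [{sf}f sf ->] x v; apply: derivable_coord.
    exact: smooth_derivable.
  - move=> _ [{sf}f sf ->] v; exists ('D_v f); first exact: smooth_derive.
    by apply/funext => x; rewrite derive_coord//; exact: smooth_derivable.
have dP (h : V -> 'rV[R]_n) : (forall i, smooth (fun x => h x 0 i)) ->
    forall x v, derivable h x v.
  move=> sh x v; apply/derivable_mxP => i j; rewrite (ord1 i).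
  exact: smooth_derivable.
apply: (@smooth_coind _ _ [set h : V -> 'rV[R]_n |
  forall i, smooth (fun x => h x 0 i)]); last exact: sf.
- by move=> h sh; apply: continuous_rowP => i; exact: smooth_continuous.
- by move=> h sh x v; exact: dP.
- move=> h sh v i /=; rewrite (_ : (fun _ => _) = 'D_v (fun x => h x 0 i)).
    exact: smooth_derive.
  by apply/funext => x; rewrite derive_coord//; exact: dP.
Qed.

Lemma is_derive_line V W (f : V -> W) (x v : V) (s : R) :
  derivable f (s *: v + x) v ->
  is_derive s 1 (fun r : R => f (r *: v + x)) ('D_v f (s *: v + x)).
Proof.
move=> df; have E : (fun h : R => h^-1 *: (((fun r : R => f (r *: v + x)) \o shift s) (h *: 1)
     - f (s *: v + x))) = (fun h => h^-1 *: ((f \o shift (s *: v + x)) (h *: v) - f (s *: v + x))).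
  by apply/funext => h /=; rewrite [h *: 1]mulr1 scalerDl addrA.
by apply: DeriveDef; [rewrite /derivable E|rewrite /derive E].
Qed.

Lemma mean_value V (f : V -> R) (x v : V) (h : R) : 0 < h ->
  (forall z, derivable f z v) -> exists2 c, 0 <= c <= h &
    f (h *: v + x) - f x = h * 'D_v f (c *: v + x).
Proof.
move=> h0 df.
have dl (s : R) : is_derive s (1 : R) (fun r : R => f (r *: v + x)) ('D_v f (s *: v + x)).
  exact: is_derive_line.
have cl : {within `[0, h], continuous (fun r : R => f (r *: v + x))}.
  by apply: derivable_within_continuous => s _; case: (dl s).
have [c] := MVT h0 (fun s _ => dl s) cl.
rewrite in_itv/= scale0r add0r subr0 => /andP[c0 ch] ->.
by exists c; [rewrite !ltW|rewrite mulrC].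
Qed.

(** The points have the form that two applications of [mean_value] produce, one
    for each order of differentiation. *)
Lemma eq_of_nearby_values V (g1 g2 : V -> R) (x v w : V) :
  continuous g1 -> continuous g2 ->
  (forall h : R, 0 < h -> exists a1 a2 b1 b2 : R,
    [/\ [/\ 0 <= a1 <= h, 0 <= a2 <= h, 0 <= b1 <= h & 0 <= b2 <= h] &
      g1 (a2 *: v + (a1 *: w + x)) = g2 (b2 *: w + (b1 *: v + x))]) ->
  g1 x = g2 x.
Proof.
move=> cg1 cg2 g12; apply/eqP; rewrite -subr_eq0 -normr_le0.
apply/ler_addgt0Pl => e e0; rewrite addr0.
have e2 : 0 < e / 2 by exact: divr_gt0.
have near_val (g : V -> R) (a b : V) : continuous g -> exists2 r, 0 < r &
    forall c1 c2, 0 <= c1 < r -> 0 <= c2 < r ->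
    `|g x - g (c2 *: b + (c1 *: a + x))| < e / 2.
  move=> cg; have /cvgrPdist_lt/(_ _ e2)/nbhs_ballP[r /= r0 gr] := cg x.
  pose N := 1 + `|a| + `|b|; have N0 : 0 < N by rewrite /N; have := normr_ge0 a; have := normr_ge0 b; lra.
  exists (r / N / 2); first by rewrite !divr_gt0.
  move=> c1 c2 /andP[c10 c1r] /andP[c20 c2r]; apply: gr.
  rewrite -ball_normE/= distrC addrA addrK.
  have cN c (u : V) : 0 <= c -> `|c *: u| = c * `|u|.
    by move=> c0; rewrite normrZ ger0_norm.
  apply: le_lt_trans (ler_normD _ _) _; rewrite !cN//.
  have M0 : 0 < r / N / 2 by rewrite !divr_gt0.
  have ab : `|a| + `|b| <= N by rewrite /N; lra.
  apply: (@le_lt_trans _ _ (r / N / 2 * N)).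
    apply: le_trans (ler_wpM2l (ltW M0) ab); rewrite mulrDr addrC.
    by apply: lerD; apply: ler_wpM2r => //; exact: ltW.
  rewrite mulrAC divfK ?gt_eqF//; lra.
have [r1 r10 R1] := near_val _ w v cg1.
have [r2 r20 R2] := near_val _ v w cg2.
pose h := Num.min r1 r2 / 2.
have h0 : 0 < h by rewrite divr_gt0// lt_min r10.
have m1 : Num.min r1 r2 <= r1 by rewrite ge_min lexx.
have m2 : Num.min r1 r2 <= r2 by rewrite ge_min lexx orbT.
have hr1 : h < r1 by rewrite /h in h0 *; lra.
have hr2 : h < r2 by rewrite /h in h0 *; lra.
have [a1 [a2 [b1 [b2 [[/andP[a10 a1h] /andP[a20 a2h] /andP[b10 b1h]
  /andP[b20 b2h]] E]]]]] := g12 h h0.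
have := R1 a1 a2; rewrite a10 a20 !(le_lt_trans _ hr1)// => /(_ erefl erefl).
have := R2 b1 b2; rewrite b10 b20 !(le_lt_trans _ hr2)// => /(_ erefl erefl).
rewrite E; move: (g2 _) (g1 x) (g2 x) => D A B HB HA.
have -> : A - B = (A - D) - (B - D) by ring.
by apply: le_trans (ler_normB _ _) _; lra.
Qed.

(** Mixed directional derivatives commute: by two applications of the mean
    value theorem, both are limits of the same double difference quotient. *)
Lemma derive_comm V (f : V -> R) (v w : V) : smooth f ->
  'D_v ('D_w f) = 'D_w ('D_v f).
Proof.
have key (g : V -> R) (a b x : V) (h : R) : smooth g -> 0 < h ->
    exists c1 c2, [/\ 0 <= c1 <= h, 0 <= c2 <= h &
    (g (h *: a + (h *: b + x)) - g (h *: b + x)) - (g (h *: a + x) - g x) =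
    h * (h * 'D_b ('D_a g) (c2 *: b + (c1 *: a + x)))].
  move=> sg h0; pose k := fun z => g (z + h *: b) + (-1) *: g z.
  have sk : smooth k.
    by apply: smoothD; [exact: smooth_translate|exact: smoothZ].
  have [c1 c1h E1] := @mean_value _ k x a h h0 (fun z => @smooth_derivable _ _ _ sk z a).
  have [c2 c2h E2] := @mean_value _ ('D_a g) (c1 *: a + x) b h h0
    (fun z => @smooth_derivable _ _ _ (smooth_derive a sg) z b).
  exists c1, c2; split=> //; rewrite -E2.
  transitivity (k (h *: a + x) - k x).
    rewrite /k !scaleN1r.
    rewrite -(addrA (h *: a)) (addrC x (h *: b)); lra.
  rewrite E1; congr (h * _); rewrite /k deriveD; last 2 first.
  - by apply: derivable_translate; exact: smooth_derivable.
  - by apply: derivableZ; exact: smooth_derivable.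
  rewrite deriveZ; last exact: smooth_derivable.
  by rewrite derive_translate scaleN1r (addrC _ (h *: b)).
move=> sf; apply/funext => x; apply: (@eq_of_nearby_values _ ('D_v ('D_w f)) ('D_w ('D_v f)) x v w).
- exact: smooth_continuous (smooth_derive v (smooth_derive w sf)).
- exact: smooth_continuous (smooth_derive w (smooth_derive v sf)).
move=> h h0.
have [a1 [a2 [a1h a2h EA]]] := key f w v x h sf h0.
have [b1 [b2 [b1h b2h EB]]] := key f v w x h sf h0.
exists a1, a2, b1, b2; split; first by [].
apply: (mulfI (lt0r_neq0 h0)); apply: (mulfI (lt0r_neq0 h0)).
refine (etrans (esym EA) (etrans _ EB)); rewrite (addrCA (h *: w)).
move: (f (h *: v + _)) (f (h *: w + x)) (f (h *: v + x)) (f x) => p q r s.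
by rewrite !opprB; ring.
Qed.

End smooth.

Arguments smooth_continuous {R V W f} _ x : rename.
Arguments smooth_derivable {R V W f} _ x v : rename.

(** * Test functions *)

Section test_functions.
Context {R : realType}.
Implicit Types V W : normedModType R.

Lemma supp_nonzero V W (f : V -> W) x : f x != 0 -> supp f x.
Proof. by move=> fx; apply: subset_closure. Qed.

Lemma supp_zero V W (f : V -> W) x : ~ supp f x -> f x = 0.
Proof. by move=> nx; apply: contrapT => /eqP/supp_nonzero. Qed.

Lemma supp_sub V W (f : V -> W) (A : set V) : closed A ->
  (forall x, ~ A x -> f x = 0) -> supp f `<=` A.
Proof.
move=> /closure_id cA fA; rewrite cA; apply: closure_subset => x /= fx0; apply: contrapT => /fA fx.
by rewrite fx eqxx in fx0.
Qed.

Lemma derive_supp V W (f : V -> W) x v : ~ supp f x -> 'D_v f x = 0.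
Proof.
move=> nx; rewrite -(derive_cst (0 : W) x v); apply: near_eq_derive.
have : nbhs x (~` supp f).
  by apply: open_nbhs_nbhs; split => //; apply: closed_openC; exact: closed_closure.
by apply: filterS => y; exact: supp_zero.
Qed.

Lemma test_fun_smooth V W Omega (f : V -> W) : test_fun Omega f -> smooth f.
Proof. by case. Qed.

(** Vanishing is only required off the closed support, so that derivatives and
    coordinates of [f] qualify. *)
Lemma test_fun_sub V (W W' : normedModType R) Omega (f : V -> W) (g : V -> W') :
  test_fun Omega f -> smooth g -> (forall x, ~ supp f x -> g x = 0) ->
  test_fun Omega g.
Proof.
move=> [sf cf fO] sg fg; have gf : supp g `<=` supp f.
  by apply: supp_sub => //; exact: closed_closure.
split => //; last exact: subset_trans fO.
by apply: subclosed_compact cf gf; exact: closed_closure.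
Qed.

Lemma test_funS V W (A B : set V) (f : V -> W) : A `<=` B ->
  test_fun A f -> test_fun B f.
Proof. by move=> AB [? ? fA]; split => //; exact: subset_trans AB. Qed.

Lemma test_fun_derive V W Omega (f : V -> W) v :
  test_fun Omega f -> test_fun Omega ('D_v f).
Proof.
move=> tf; apply: (test_fun_sub tf); first exact: smooth_derive (test_fun_smooth tf).
by move=> x; exact: derive_supp.
Qed.

Lemma test_fun_coord V n Omega (f : V -> 'rV[R]_n) i :
  test_fun Omega f -> test_fun Omega (fun x => f x 0 i).
Proof.
move=> tf; apply: (test_fun_sub tf).
  by have /smooth_rowP := test_fun_smooth tf; exact.
by move=> x /supp_zero ->; rewrite mxE.
Qed.

Lemma test_fun_bounded V Omega (f : V -> R) : test_fun Omega f ->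
  exists2 M : R, 0 <= M & forall x, `|f x| <= M.
Proof.
move=> [sf cf _].
have /ex_strict_bound_gt0[M M0 fM] : bounded_set (f @` supp f).
  apply: compact_bounded; apply: continuous_compact => //.
  by apply: continuous_subspaceT; exact: smooth_continuous.
exists M; first exact: ltW.
move=> x; have [fx|nfx] := pselect (supp f x); last by rewrite (@supp_zero _ _ f)// normr0 ltW.
by apply/ltW/fM; exists x.
Qed.

(** Where the functions [f (. + w)], for [w] in [B], may be nonzero. *)
Definition translates V W (B : set V) (f : V -> W) : set V :=
  [set z | exists2 w, B w & supp f (z + w)].

Lemma compact_translates V W (B : set V) (f : V -> W) :
  compact B -> compact (supp f) -> compact (translates B f).
Proof.
move=> cB cf; rewrite (_ : translates B f =
    (fun p : V * V => p.2 - p.1) @` (B `*` supp f)).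
  apply: continuous_compact; last exact: compact_setX.
  apply: continuous_subspaceT => p; apply: cvgB; first exact: cvg_snd.
  exact: cvg_fst.
apply/seteqP; split => [z [w Bw fzw]|_ [[w z] /= [Bw fz] <-]].
  by exists (w, z + w) => //=; rewrite addrK.
by exists w => //; rewrite subrK.
Qed.

Lemma test_fun_translate V W (Omega Omega' : set V) (f : V -> W) (w : V) :
  test_fun Omega f -> translates [set w] f `<=` Omega' ->
  test_fun Omega' (fun z => f (z + w)).
Proof.
move=> [sf cf _] wO.
have cw : compact (translates [set w] f).
  by apply: compact_translates => //; exact: compact_set1.
have sub : supp (fun z => f (z + w)) `<=` translates [set w] f.
  apply: supp_sub => [|z nz]; last first.
    by apply: supp_zero => fzw; apply: nz; exists w.
  by apply: compact_closed; [exact: norm_hausdorff|].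
split; [exact: smooth_translate| |exact: subset_trans wO].
apply: subclosed_compact sub; first exact: closed_closure.
exact: cw.
Qed.

End test_functions.

(** * Pairings of locally integrable functions with test functions *)

(** [f] is a function on [D], and [iota] maps [D] to space-time.  With [iota]
    the identity or [x |-> (0, x)], the integrals of [f] against
    [phi \o iota] cover both kinds of terms of the weak formulations. *)
Section pairing.
Context {R : realType} {d : nat}.
Local Notation spacetime := (R * 'rV[R]_d)%type.
Context {disp : measure_display} {Y : measurableType disp}.
Context (mu : {measure set Y -> \bar R}) (T : R).
Variables (D : set Y) (iota : Y -> spacetime) (f : Y -> R).

Definition pair_integral (w : spacetime) (phi : spacetime -> R) : R :=
  \int[mu]_(y in D) (f y * phi (iota y + w)).

Record loc_integrable : Prop := LocIntegrable {
  loc_measurable_dom : measurable D ;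
  loc_measurable_iota : measurable_fun setT iota ;
  loc_integrableP : forall K : set spacetime, compact K ->
    K `<=` past_slab T -> mu.-integrable (D `&` iota @^-1` K) (EFin \o f) ;
  loc_measurable : measurable_fun D f
}.

Hypothesis Lf : loc_integrable.
Let mD := loc_measurable_dom Lf.

Lemma measurable_preimage_compact (K : set spacetime) : compact K ->
  measurable (iota @^-1` K).
Proof.
move=> cK; rewrite -[X in measurable X]setTI.
apply: loc_measurable_iota => //; exact: compact_measurable_spacetime.
Qed.

Lemma measurable_comp_iota (phi : spacetime -> R) w : continuous phi ->
  measurable_fun D (fun y => phi (iota y + w)).
Proof.
move=> cphi; apply: measurable_funTS.
have mphi : measurable_fun setT (fun z : spacetime => phi (z + w)).
  by apply: continuous_measurable_spacetime; exact: continuous_translate.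
exact: (measurableT_comp mphi (loc_measurable_iota Lf)).
Qed.

(** Domination by [|f|] on a compact set makes everything integrable. *)
Lemma pair_dominating (K : set spacetime) (M : R) : compact K ->
  K `<=` past_slab T ->
  mu.-integrable D (EFin \o (fun y => `|f y| * (M * \1_K (iota y)))).
Proof.
move=> cK KT; have mK := measurable_preimage_compact cK.
have mDK : measurable (D `&` iota @^-1` K) by exact: measurableI.
have := loc_integrableP Lf cK KT.
move=> /integrable_norm /(integrableZl mDK M).
rewrite integrable_mkcond// (integrable_mkcond _ mD).
congr (_.-integrable _ _); apply/funext => y; rewrite /patch /= indicE.
rewrite in_setI; have [_|//] := boolP (y \in D).
rewrite (_ : (y \in iota @^-1` K) = (iota y \in K)); last first.
  by apply/idP/idP; rewrite !inE.
by case: (_ \in K) => /=; rewrite ?mulr1 ?mulr0// -EFinM mulrC.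
Qed.

Lemma pair_integrable (B : set spacetime) (phi : spacetime -> R) w :
  test_fun setT phi -> compact B -> B w ->
  translates B phi `<=` past_slab T ->
  mu.-integrable D (EFin \o (fun y => f y * phi (iota y + w))).
Proof.
move=> tphi cB Bw KT; have [M M0 phiM] := test_fun_bounded tphi.
have cK : compact (translates B phi).
  by apply: compact_translates => //; case: tphi.
apply: le_integrable (pair_dominating M cK KT) => //.
  apply/measurable_EFinP/measurable_funM; first exact: loc_measurable.
  apply: measurable_comp_iota; exact: smooth_continuous (test_fun_smooth tphi).
move=> y _; rewrite /= lee_fin !normrM normr_id ler_wpM2l//.
rewrite (ger0_norm M0) indicE.
case: (boolP (iota y \in _)) => [_|]; first by rewrite /= normr1 mulr1.
rewrite notin_setE => nK; rewrite (@supp_zero _ _ _ phi) ?normr0 ?mulr0//.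
by move=> h; apply: nK; exists w.
Qed.

(** Pairings are differentiable along translations, as long as the supports
    stay in a compact subset of the half-space where [f] is defined. *)
Lemma pair_integral_derive (v w : spacetime) (phi : spacetime -> R) (a b s : R) :
  test_fun setT phi ->
  (forall r z, a <= r <= b -> supp phi (z + (w + r *: v)) -> past_slab T z) ->
  a < s < b ->
  is_derive s (1 : R) (fun r : R => pair_integral (w + r *: v) phi)
    (pair_integral (w + s *: v) ('D_v phi)).
Proof.
move=> tphi KT sab.
pose B : set spacetime := (fun r : R => w + r *: v) @` `[a, b]%classic.
have cB : compact B.
  apply: continuous_compact; last exact: segment_compact.
  apply: continuous_subspaceT => r; apply: cvgD; first exact: cvg_cst.
  by apply: cvgZl; exact: cvg_id.
have BT : translates B phi `<=` past_slab T.
  by move=> z [_ [r /= rab <-]]; exact: KT.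
have cK : compact (translates B phi).
  by apply: compact_translates => //; case: tphi.
have tD := test_fun_derive v tphi.
have [M M0 DM] := test_fun_bounded tD.
have dphi (r : R) (y : Y) : is_derive r (1 : R)
    (fun r : R => f y * phi (iota y + (w + r *: v)))
    (f y * 'D_v phi (iota y + (w + r *: v))).
  have := @is_derive_line _ _ _ phi (iota y + w) v r
    (smooth_derivable (test_fun_smooth tphi) _ _).
  under eq_fun do rewrite addrC -addrA.
  rewrite addrC -addrA => h; apply: is_deriveZ.
have Is : `]a, b[%classic s by rewrite /= in_itv/=.
have intf r : `]a, b[%classic r ->
    mu.-integrable D (EFin \o (fun y => f y * phi (iota y + (w + r *: v)))).
  move=> /subset_itv_oo_cc rab; apply: (pair_integrable tphi cB) => //.
  by exists r.
have derf r y : `]a, b[%classic r -> D y ->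
    derivable (fun r : R => f y * phi (iota y + (w + r *: v))) r 1.
  by move=> _ _; case: (dphi r y).
pose G y := `|f y| * (M * \1_(translates B phi) (iota y)).
have G0 y : 0 <= G y by rewrite !mulr_ge0.
have GD r y : `]a, b[%classic r -> D y ->
    `|partial1of2 (fun r y => f y * phi (iota y + (w + r *: v))) r y| <= G y.
  move=> /subset_itv_oo_cc rab _; rewrite partial1of2E; have [_ ->] := dphi r y.
  rewrite normrM ler_wpM2l// indicE.
  case: (boolP (iota y \in _)) => [_|]; first by rewrite mulr1.
  rewrite notin_setE => nK; rewrite derive_supp ?normr0 ?mulr0//.
  by move=> h; apply: nK; exists (w + r *: v) => //; exists r.
have dint := derivable_under_integral mD Is intf derf G0 (pair_dominating M cK BT) GD.
have vint := differentiation_under_integral mD Is intf derf G0 (pair_dominating M cK BT) GD.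
apply: DeriveDef; first exact: dint.
rewrite -derive1E vint; apply: eq_Rintegral => y _.
by rewrite partial1of2E; have [_ ->] := dphi s y.
Qed.

End pairing.

Section pairing_continuity.
Context {R : realType} {d : nat}.
Local Notation spacetime := (R * 'rV[R]_d)%type.
Context {disp : measure_display} {Y : measurableType disp}.
Context (mu : {measure set Y -> \bar R}) (T : R).
Variables (D : set Y) (iota : Y -> spacetime) (f : Y -> R).
Hypothesis Lf : loc_integrable mu T D iota f.

(** By dominated convergence: all the supports involved lie in one compact set
    on which [f] is integrable. *)
Lemma pair_integral_cvg (B : set spacetime) (phi : spacetime -> R)
    (w : nat -> spacetime) (w0 : spacetime) :
  test_fun setT phi -> compact B -> translates B phi `<=` past_slab T ->
  (forall n, B (w n)) -> B w0 -> w n @[n --> \oo] --> w0 ->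
  pair_integral mu D iota f (w n) phi @[n --> \oo] -->
    pair_integral mu D iota f w0 phi.
Proof.
move=> tphi cB KT Bw Bw0 w_cvg; have [M M0 phiM] := test_fun_bounded tphi.
have cK : compact (translates B phi).
  by apply: compact_translates => //; case: tphi.
have cphi := smooth_continuous (test_fun_smooth tphi).
have int_w v : B v -> mu.-integrable D (EFin \o (fun y => f y * phi (iota y + v))).
  by move=> Bv; exact: (pair_integrable Lf tphi cB Bv KT).
apply: fine_cvg; rewrite fineK; last first.
  by apply: integrable_fin_num; [exact: loc_measurable_dom Lf|exact: int_w].
apply: (@dominated_cvg _ _ _ mu _ (loc_measurable_dom Lf)
    (fun n y => (f y * phi (iota y + w n))%:E) _
    (EFin \o (fun y => `|f y| * (M * \1_(translates B phi) (iota y))))).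
- by move=> n; exact: measurable_int (int_w _ (Bw n)).
- move=> y _; apply: cvg_EFin; first exact: nearW.
  apply: cvgMr; apply: (continuous_cvg _ (cphi _)).
  by apply: cvgD => //; exact: cvg_cst.
- by move=> y _.
- exact: (pair_dominating Lf M cK KT).
- move=> n y _; rewrite /= lee_fin normrM ler_wpM2l// indicE.
  case: (boolP (iota y \in _)) => [_|]; first by rewrite mulr1.
  rewrite notin_setE => nK; rewrite (@supp_zero _ _ _ phi) ?normr0 ?mulr0//.
  by move=> h; apply: nK; exists (w n).
Qed.

End pairing_continuity.

Section instances.
Context {R : realType} {d : nat} (T : R).
Local Notation spacetime := (R * 'rV[R]_d)%type.

Lemma loc_integrable_slab (f : spacetime -> R) : L1loc (slab T) f ->
  loc_integrable lebesgue_spacetime T (slab T) id f.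
Proof.
move=> [mf Lf]; split => //; first exact: measurable_slab.
move=> K cK KT; apply: Lf; first by move=> z [].
have closed_ge0 : closed [set z : spacetime | 0 <= z.1].
  rewrite (_ : mkset _ = fst @^-1` `[0, +oo[%classic); last first.
    by apply/seteqP; split => z /=; rewrite in_itv/= andbT.
  apply: preimage_closed; last exact: interval_closed.
  by move=> z _; exact: cvg_fst.
rewrite (_ : _ `&` _ = K `&` [set z | 0 <= z.1]); first exact: compact_closedI.
apply/seteqP; split => z /=.
  by move=> [[+ _] Kz]; rewrite /= in_itv/= => /andP[].
move=> [Kz z0]; split => //; split => //=; rewrite in_itv/= z0.
by have [] := KT z Kz; rewrite /= in_itv.
Qed.

Lemma measurable_initial : measurable_fun setT (fun x : 'rV[R]_d => (0 : R, x)).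
Proof. exact: pair1_measurable. Qed.

Lemma loc_integrable_space (g : 'rV[R]_d -> R) : L1loc_space g ->
  loc_integrable (lebesgue_measure_rV d) T setT (fun x => (0, x)) g.
Proof.
move=> [mg Lg]; split => //; first exact: measurable_initial.
move=> K cK _; rewrite setTI.
have mpre (A : set spacetime) : compact A ->
    measurable ((fun x : 'rV[R]_d => (0 : R, x)) @^-1` A).
  move=> cA; rewrite -[X in measurable X]setTI.
  by apply: measurable_initial => //; exact: compact_measurable_spacetime.
have cK2 : compact (snd @` K).
  by apply: continuous_compact => //; apply: continuous_subspaceT => z; exact: cvg_snd.
apply: (@integrableS _ _ _ _ (snd @` K)); last exact: Lg.
- rewrite (_ : snd @` K =
      (fun x : 'rV[R]_d => (0 : R, x)) @^-1` ([set (0 : R)] `*` (snd @` K))).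
    apply: (mpre ([set (0 : R)] `*` (snd @` K))).
    by apply: compact_setX => //; exact: compact_set1.
  by apply/seteqP; split => x /= => [|[]].
- exact: mpre.
- by move=> x /= Kx; exists (0, x).
Qed.

End instances.

(** * Decay at infinity of pairings *)

Section escaping_mass.
Context {R : realType}.

(** The bound is trivial where [a <= N], and where [a > N] it only uses that
    [a ^ (1 - p)] is nonincreasing in [a].  Having no conjugate exponent, it
    covers [p = 1]. *)
Lemma young_threshold (p N a : R) : 1 <= p -> 0 < N -> 0 <= a ->
  a <= N + N `^ (1 - p) * a `^ p.
Proof.
move=> p1 N0 a0; have [aN|Na] := leP a N.
  by apply: le_trans aN _; rewrite lerDl mulr_ge0// powR_ge0.
have a_gt0 : 0 < a by exact: lt_trans Na.
have aE : a = a `^ (1 - p) * a `^ p.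
  by rewrite -powRD ?subrK ?powRr1// (gt_eqF a_gt0) implybT.
rewrite [leLHS]aE; apply: (@le_trans _ _ (N `^ (1 - p) * a `^ p)); last first.
  by rewrite lerDr ltW.
apply: ler_wpM2r; first exact: powR_ge0.
rewrite -opprB !powRN lef_pV2 ?posrE ?powR_gt0//.
by apply: ge0_ler_powR; rewrite ?nnegrE ?subr_ge0// ltW.
Qed.

Context {disp : measure_display} {Y : measurableType disp}.
Context (mu : {measure set Y -> \bar R}).
Local Open Scope ereal_scope.

(** A substitute for the Hoelder inequality in which the measure of [C] carries
    an arbitrarily small factor [N]. *)
Lemma integral_threshold (f : Y -> R) (C : set Y) (p N : R) :
  measurable_fun C f -> measurable C -> (1 <= p)%R -> (0 < N)%R ->
  \int[mu]_(y in C) `|f y|%:E <=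
    N%:E * mu C + (N `^ (1 - p))%:E * \int[mu]_(y in C) (`|f y| `^ p)%:E.
Proof.
move=> mf mC p1 N0.
have mfp : measurable_fun C (fun y => (`|f y| `^ p)%:E).
  apply/measurable_EFinP; apply: (measurableT_comp (measurable_powR p)).
  exact: measurableT_comp.
have Np0 : (0 <= N `^ (1 - p))%R by exact: powR_ge0.
have fp0 y : C y -> 0 <= (`|f y| `^ p)%:E by move=> _; rewrite lee_fin powR_ge0.
rewrite -integral_cst// -ge0_integralZl//.
rewrite -ge0_integralD//=; last 3 first.
- by move=> y _; rewrite lee_fin ltW.
- by move=> y Cy; rewrite mule_ge0// fp0.
- exact: measurable_funeM.
apply: ge0_le_integral => //.
- by apply/measurable_EFinP; exact: measurableT_comp.
- by apply: emeasurable_funD => //; exact: measurable_funeM.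
- by move=> y _; rewrite -EFinM -EFinD lee_fin young_threshold.
Qed.

End escaping_mass.

Section cubes.
Context {R : realType} {d : nat}.

Definition cube (x : 'rV[R]_d) (m : R) : set 'rV[R]_d :=
  [set y | forall i, (`[x 0 i - m, x 0 i + m]%classic : set R) (y 0 i)].

Lemma cubeP (x y : 'rV[R]_d) m :
  cube x m y <-> forall i, `|y 0 i - x 0 i| <= m.
Proof.
by split => h i; have := h i; rewrite /= in_itv/= ler_norml; lra.
Qed.

Lemma measurable_cube x m : measurable (cube x m).
Proof.
by apply: (@measurable_box _ _ (fun i => `[x 0 i - m, x 0 i + m]%classic)) => i;
  exact: measurable_itv.
Qed.

Lemma compact_cube x m : compact (cube x m).
Proof.
by apply: (@rV_compact _ _ (fun i => `[x 0 i - m, x 0 i + m]%classic)) => i;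
  exact: segment_compact.
Qed.

Lemma volume_cube x (m : R) : 0 <= m ->
  (lebesgue_measure_rV d : {measure set 'rV[R]_d -> \bar R}) (cube x m) =
  ((2 * m) ^+ d)%:E.
Proof.
move=> m0; transitivity (lebesgue_measure_rV d (cube x m)); first by [].
rewrite (@lebesgue_measure_rV_box _ _
  (fun i => `[x 0 i - m, x 0 i + m]%classic)); last first.
  by move=> i; exact: measurable_itv.
rewrite (eq_bigr (fun=> (2 * m)%:E)) => [|i _]; last first.
  rewrite lebesgue_measure_itv/= lte_fin; case: ifPn => [_|mle].
    by rewrite -EFinB; congr EFin; ring.
  by congr EFin; lra.
by rewrite prodEFin prodr_const card_ord.
Qed.

End cubes.

Section escaping_mass_rV.
Context {R : realType} {d : nat}.
Local Notation mu := (lebesgue_measure_rV d).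
Local Open Scope ereal_scope.

(** Divergence to infinity at a prescribed rate: points [x n] picked one by one
    at distance at least [n] form such a sequence. *)
Definition escaping (x : nat -> 'rV[R]_d) := (forall n, n%:R <= `|x n|)%R.

Lemma escaping_cube (x : nat -> 'rV[R]_d) (m : R) (y : 'rV[R]_d) :
  escaping x -> \forall n \near \oo, ~ cube (x n) m y.
Proof.
move=> xoo; have [N _ NM] := nbhs_infty_ger (`|y| + `|m| + 1)%R.
exists N => // n /= Nn /cubeP ym; have := NM n Nn; apply/negP.
rewrite -ltNge; apply: le_lt_trans (xoo n) _.
have xny : (`|x n - y| <= `|m|)%R.
  rewrite [leLHS]/Num.Def.normr/= mx_normrE bigmax_le//= => -[i j] _.
  by rewrite (ord1 i) !mxE distrC; apply: le_trans (ym j) (ler_norm _).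
have : (`|x n| <= `|y| + `|x n - y|)%R by rewrite addrC -{1}(subrK y (x n)) ler_normD.
lra.
Qed.

(** [|f|^p] is integrable, so its integral over an escaping cube tends to [0];
    [integral_threshold], with a small threshold, transfers this to [|f|]. *)
Lemma integral_cube_cvg0 (f : 'rV[R]_d -> R) (p m : R) (x : nat -> 'rV[R]_d) :
  measurable_fun setT f -> (1 <= p)%R -> (0 <= m)%R ->
  'N[mu]_p%:E[EFin \o f] < +oo -> escaping x ->
  \int[mu]_(y in cube (x n) m) `|f y|%:E @[n --> \oo] --> 0.
Proof.
move=> mf p1 m0 fp xoo; have p0 : (0 < p)%R by lra.
have mfp : measurable_fun setT (fun y => (`|f y| `^ p)%:E).
  apply/measurable_EFinP; apply: (measurableT_comp (measurable_powR p)).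
  exact: measurableT_comp.
have fp0 y : 0 <= (`|f y| `^ p)%:E by rewrite lee_fin powR_ge0.
have ip : mu.-integrable setT (fun y => (`|f y| `^ p)%:E).
  apply/integrableP; split => //.
  under eq_integral do rewrite gee0_abs//.
  have -> : \int[mu]_y (`|f y| `^ p)%:E = 'N[mu]_p%:E[EFin \o f] `^ p.
    by rewrite poweR_Lnorm ?gt_eqF.
  exact: poweR_lty.
have cvgp : \int[mu]_(y in cube (x n) m) (`|f y| `^ p)%:E @[n --> \oo] --> 0.
  under eq_fun do rewrite integral_mkcond.
  rewrite -(@integral0 _ _ _ mu setT).
  apply: (@dominated_cvg _ _ _ mu _ measurableT _ _ (fun y => (`|f y| `^ p)%:E)) => //.
  - move=> n; apply/(measurable_restrictT _ (measurable_cube _ _)).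
    exact: measurable_funTS.
  - move=> y _; apply: cvg_near_cst; near=> n; rewrite patchE memNset//.
    by near: n; exact: escaping_cube.
  - move=> n y _; rewrite patchE; case: ifPn => _; first by rewrite gee0_abs.
    by rewrite abse0.
pose V := ((2 * m) ^+ d)%R; have V0 : (0 <= V)%R by rewrite exprn_ge0// mulr_ge0.
have /fine_cvgP[bfin b0] := cvgp.
have near_le (e : R) : (0 < e)%R ->
    \forall n \near \oo, \int[mu]_(y in cube (x n) m) `|f y|%:E <= e%:E.
  (* With this threshold the first term of [integral_threshold] is at most
     [e / 2], since [V] is the volume of the cubes. *)
  move=> e0; pose del := (e / 2 / (V + 1))%R.
  have V1 : (0 < V + 1)%R by lra.
  have del0 : (0 < del)%R by rewrite !divr_gt0.
  have c0 : (0 < del `^ (1 - p))%R by exact: powR_gt0.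
  have eta0 : (0 < e / 2 / del `^ (1 - p))%R by rewrite !divr_gt0.
  have /cvgrPdist_le/(_ _ eta0) b0' := b0.
  near=> n.
  have bn : \int[mu]_(y in cube (x n) m) (`|f y| `^ p)%:E
      <= (e / 2 / del `^ (1 - p))%:E.
    have /fineK <- : \int[mu]_(y in cube (x n) m) (`|f y| `^ p)%:E \is a fin_num.
      by near: n.
    have : (`|0 - fine (\int[mu]_(y in cube (x n) m) (`|f y| `^ p)%:E)| <=
      e / 2 / del `^ (1 - p))%R by near: n.
    by rewrite sub0r normrN lee_fin => /(le_trans (ler_norm _)).
  have mfn : measurable_fun (cube (x n) m) f by exact: measurable_funTS.
  have := integral_threshold mu mfn (measurable_cube _ _) p1 del0.
  move=> /le_trans; apply; rewrite (@volume_cube R d (x n) m m0) -/V.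
  apply: (@le_trans _ _ (del%:E * V%:E +
      (del `^ (1 - p))%:E * (e / 2 / del `^ (1 - p))%:E)).
    by rewrite leeD2l// lee_pmul2l.
  rewrite -!EFinM -EFinD lee_fin mulrC (mulrC (del `^ _)%R) divfK ?gt_eqF//.
  have : (V * del <= e / 2)%R.
    rewrite /del mulrA ler_pdivrMr// mulrC ler_wpM2l//.
      by rewrite divr_ge0// ltW.
    by rewrite lerDl.
  lra.
apply/fine_cvgP; split.
  have := near_le 1%R ltr01; apply: filterS => n hn.
  by rewrite ge0_fin_numE ?integral_ge0//; apply: le_lt_trans hn _; exact: ltry.
apply/cvgrPdist_le => e e0; near=> n; rewrite sub0r normrN.
have an : \int[mu]_(y in cube (x n) m) `|f y|%:E <= e%:E.
  by near: n; exact: near_le.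
have afin : \int[mu]_(y in cube (x n) m) `|f y|%:E \is a fin_num.
  by rewrite ge0_fin_numE ?integral_ge0//; apply: le_lt_trans an _; exact: ltry.
by rewrite ger0_norm ?fine_ge0 ?integral_ge0// -lee_fin fineK.
Unshelve. all: by end_near. Qed.

(** A bound that is uniform in the position of the cube and affine in the norm of
    [f], hence integrable in time when [f] is in L^1 of time with values in
    L^p. *)
Lemma integral_cube_bound (f : 'rV[R]_d -> R) (p m : R) (x : 'rV[R]_d) :
  measurable_fun setT f -> (1 <= p)%R -> (0 <= m)%R ->
  'N[mu]_p%:E[EFin \o f] < +oo ->
  \int[mu]_(y in cube x m) `|f y|%:E <=
    ((2 * m) ^+ d + 1)%:E * ('N[mu]_p%:E[EFin \o f] + 1).
Proof.
move=> mf p1 m0 fp; have p0 : (0 < p)%R by lra.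
have [N NE] : exists N, 'N[mu]_p%:E[EFin \o f] = N%:E.
  exists (fine 'N[mu]_p%:E[EFin \o f]); rewrite fineK//.
  by rewrite ge0_fin_numE// Lnorm_ge0.
have N0 : (0 <= N)%R by rewrite -lee_fin -NE Lnorm_ge0.
have N1 : (0 < N + 1)%R by lra.
have mC := measurable_cube x m.
have mfC : measurable_fun (cube x m) f by exact: measurable_funTS.
apply: le_trans (integral_threshold mu mfC mC p1 N1) _.
have bp : \int[mu]_(y in cube x m) (`|f y| `^ p)%:E <= ((N + 1) `^ p)%:E.
  apply: (@le_trans _ _ (N `^ p)%:E); last first.
    by rewrite lee_fin ge0_ler_powR ?nnegrE//; lra.
  rewrite -poweR_EFin -NE poweR_Lnorm ?gt_eqF//.
  apply: ge0_subset_integral => //.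
  apply: (measurableT_comp (f := fun t : R => (t `^ p)%:E)).
    by apply/measurable_EFinP; exact: measurable_powR.
  exact: measurableT_comp.
rewrite NE (@volume_cube R d x m m0).
apply: (@le_trans _ _ ((N + 1)%:E * ((2 * m) ^+ d)%:E +
  ((N + 1) `^ (1 - p))%:E * ((N + 1) `^ p)%:E)).
  by rewrite leeD2l// lee_pmul2l// lte_fin powR_gt0.
rewrite (_ : N%:E + 1 = (N + 1)%:E)// -!EFinM -EFinD lee_fin -powRD; last first.
  by rewrite (gt_eqF N1) implybT.
rewrite subrK powRr1; last exact: ltW.
by rewrite [leRHS]mulrDl mul1r (mulrC (N + 1)%R).
Qed.

End escaping_mass_rV.

Section escaping_mass_spacetime.
Context {R : realType} {d : nat}.
Local Notation mu := (lebesgue_measure_rV d).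
Local Notation spacetime := (R * 'rV[R]_d)%type.
Local Notation nu := (@lebesgue_spacetime R d).
Local Open Scope ereal_scope.

(** At almost every time the integral over the cube tends to [0], and
    [integral_cube_bound] dominates it. *)
Lemma integral_cylinder_cvg0 (f : spacetime -> R) (T T' p m : R)
    (x : nat -> 'rV[R]_d) :
  L1loc_Lp T p f -> (T' < T)%R -> (1 <= p)%R -> (0 <= m)%R -> escaping x ->
  \int[nu]_(z in `[0%R, T']%classic `*` cube (x n) m) `|f z|%:E
    @[n --> \oo] --> 0.
Proof.
move=> [mf Nf] T'T p1 m0 xoo; have p0 : (0 < p)%R by lra.
pose g := f \_ (slab T).
have mg : measurable_fun setT g.
  by apply/(measurable_restrictT _ (measurable_slab T)).
have gf t y : `[0%R, T']%classic t -> g (t, y) = f (t, y).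
  move=> /=; rewrite in_itv/= => /andP[t0 tT'].
  rewrite /g patchE mem_set//; split => //=; rewrite in_itv/= t0/=.
  exact: le_lt_trans tT' T'T.
have mgt t : measurable_fun setT (fun y => g (t, y)).
  by apply: (measurableT_comp mg); exact: pair1_measurable.
pose N t := 'N[mu]_p%:E[EFin \o (fun y => g (t, y))].
have mN : measurable_fun setT N.
  rewrite /N unlock; apply: (measurableT_comp (measurable_poweR _)).
  apply: (@measurable_fun_fubini_tonelli_F _ _ _ _ _ mu
    (fun z => `|(g z)%:E| `^ p)).
  - apply: (measurableT_comp (measurable_poweR _)).
    by apply: measurableT_comp => //; exact/measurable_EFinP.
  - by move=> z; exact: poweR_ge0.
pose F n t := \int[mu]_(y in cube (x n) m) `|g (t, y)|%:E.
pose G n (z : spacetime) := (`|g z| * \1_(cube (x n) m) z.2)%:E.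
have G0 n z : 0 <= G n z by rewrite lee_fin mulr_ge0.
have mG n : measurable_fun setT (G n).
  apply/measurable_EFinP/measurable_funM; first exact: measurableT_comp.
  apply: (measurableT_comp _ measurable_snd).
  by apply: measurable_indic; exact: measurable_cube.
have GF n t : F n t = \int[mu]_y G n (t, y).
  rewrite /F integral_mkcond; apply: eq_integral => y _.
  rewrite patchE /G indicE; case: (_ \in _) => /=; rewrite ?mulr1 ?mulr0//.
have mF n : measurable_fun setT (F n).
  rewrite (_ : F n = fun t => \int[mu]_y G n (t, y)); last first.
    by apply/funext => t; rewrite GF.
  exact: (@measurable_fun_fubini_tonelli_F _ _ _ _ _ mu (G n)).
pose H n (z : spacetime) := (\1_(`[0%R, T']%classic) z.1 * (`|g z| * \1_(cube (x n) m) z.2))%:E.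
have H0 n z : 0 <= H n z by rewrite lee_fin !mulr_ge0.
have mH n : measurable_fun setT (H n).
  apply/measurable_EFinP/measurable_funM; last by apply/measurable_EFinP; exact: mG.
  apply: (measurableT_comp _ measurable_fst).
  by apply: measurable_indic; exact: measurable_itv.
have -> : (fun n => \int[nu]_(z in `[0%R, T']%classic `*` cube (x n) m) `|f z|%:E) =
    (fun n => \int[lebesgue_measure]_(t in `[0%R, T']) F n t).
  apply/funext => n; rewrite integral_mkcond [RHS]integral_mkcond.
  transitivity (\int[nu]_z H n z).
    apply: eq_integral => -[t y] _; rewrite patchE /H !indicE/=.
    case: ifPn => [/set_mem[/= h1 h2]|].
      by rewrite !mem_set// mul1r mulr1 gf.
    rewrite notin_setE => nh.
    have [/set_mem h1|] := boolP (t \in _); last by rewrite mul0r.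
    have [/set_mem h2|] := boolP (y \in _); last by rewrite !mulr0.
    by exfalso; apply: nh.
  rewrite /lebesgue_spacetime fubini_tonelli1//; [|exact: mH].
  apply: eq_integral => t _; rewrite patchE /fubini_F /H /=.
  case: ifPn => [h|/negPf h].
    by rewrite GF; apply: eq_integral => y _; rewrite /= indicE h mul1r.
  by rewrite indicE h; under eq_integral do rewrite mul0r; rewrite integral0.
pose D : set (measurableTypeR R) := `[0%R, T']%classic.
have mD : measurable D by exact: measurable_itv.
have NE t : D t -> N t = 'N[mu]_p%:E[EFin \o (fun y => f (t, y))].
  by move=> Dt; apply: eq_Lnorm => y; rewrite /= gf.
have iN : (@lebesgue_measure R).-integrable D N.
  apply/integrableP; split; first exact: measurable_funTS.
  apply: le_lt_trans (Nf T' T'T); apply: ge0_le_integral => //.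
  - by apply: measurableT_comp => //; exact: measurable_funTS.
  - apply: (eq_measurable_fun N); first by move=> t /set_mem; exact: NE.
    exact: measurable_funTS.
  - by move=> t Dt; rewrite NE// gee0_abs// Lnorm_ge0.
have mFD n : measurable_fun D (F n).
  have mFT : measurable_fun (setT : set (measurableTypeR R)) (F n) by exact: mF.
  exact: measurable_funTS.
have Nfin := integrable_ae mD iN.
have Nlty t : N t \is a fin_num -> N t < +oo by move=> /fin_numPlt/andP[].
rewrite -(@integral0 _ _ _ (@lebesgue_measure R) D).
have [||||//|//] := @dominated_convergence _ _ _ (@lebesgue_measure R) D mD F (cst 0)
  (fun t => ((2 * m) ^+ d + 1)%:E * (N t + 1)).
- exact: mFD.
- exact: measurable_cst.
- apply: filterS Nfin => t Nt Dt; apply: (integral_cube_cvg0 _ p1 m0) => //.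
  by apply: Nlty; exact: Nt.
- apply: integrableZl => //; apply: integrableD => //.
  apply/integrableP; split => //.
  under eq_integral do rewrite gee0_abs//.
  rewrite integral_cst// mul1e; apply: compact_finite_measure.
  exact: segment_compact.
- apply: filterS Nfin => t Nt n Dt; rewrite gee0_abs; last by exact: integral_ge0.
  by apply: integral_cube_bound => //; apply: Nlty; exact: Nt.
Qed.

End escaping_mass_spacetime.

Section decay.
Context {R : realType} {d : nat}.
Local Notation spacetime := (R * 'rV[R]_d)%type.
Local Notation mu := (lebesgue_measure_rV d).
Local Notation nu := (@lebesgue_spacetime R d).

Lemma cvg0_dominated (a : nat -> R) (b : nat -> \bar R) (M : R) :
  (forall n, (`|a n|%:E <= M%:E * b n)%E) -> b n @[n --> \oo] --> 0%E ->
  a n @[n --> \oo] --> 0.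
Proof.
move=> ab b0; apply: norm_cvg0.
have Mb : (M%:E * b n)%E @[n --> \oo] --> 0%E.
  by rewrite -(mule0 M%:E); apply: cvgeZl.
apply: (@fine_cvg _ _ _ _ (fun n => `|a n|%:E) 0).
apply: (squeeze_cvge _ (cvg_cst 0%E) Mb).
by apply: nearW => n; rewrite lee_fin normr_ge0/= ab.
Qed.

Lemma normr_coord (x : 'rV[R]_d) i : `|x 0 i| <= `|x|.
Proof.
by rewrite [leRHS]/Num.Def.normr/= mx_normrE (le_bigmax _ (fun i => `|x i.1 i.2|) (ord0, i)).
Qed.

(** By compactness the support stays away from [t = T], where no integrability
    up to the boundary is available. *)
Lemma supp_cylinder (T : R) (phi : spacetime -> R) :
  test_fun (past_slab T) phi -> exists T' m : R, [/\ T' < T, 0 <= m &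
    forall z, supp phi z -> z.1 <= T' /\ forall i, `|z.2 0 i| <= m].
Proof.
move=> [_ cphi phiT].
have [m m0 hm] := ex_strict_bound_gt0 (compact_bounded cphi).
have hm' z : supp phi z -> forall i, `|z.2 0 i| <= m.
  move=> /hm /ltW zm i; apply: le_trans (normr_coord _ _) _.
  by apply: le_trans zm; rewrite [leRHS]prod_normE le_max lexx orbT.
have [[z0 z0s]|ne] := pselect (supp phi !=set0); last first.
  exists (T - 1), m; split; [lra|exact: ltW|].
  by move=> z zs; exfalso; apply: ne; exists z.
have c1 : {within supp phi, continuous (fun z : spacetime => z.1)}.
  by apply: continuous_subspaceT => z; exact: cvg_fst.
have [zm] := compact_EVT_max (ex_intro _ z0 z0s) cphi c1.
rewrite inE => zms zmax; exists zm.1, m; split; [|exact: ltW|].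
  by have [+ _] := phiT _ zms; rewrite /= in_itv.
by move=> z zs; split; [apply: zmax; rewrite inE|exact: hm'].
Qed.

Lemma pair_integral_le (disp : measure_display) (Y : measurableType disp)
    (la : {measure set Y -> \bar R}) (M : R) (D C : set Y)
    (iota : Y -> spacetime) (f : Y -> R) (phi : spacetime -> R) (w : spacetime) :
  measurable D -> measurable_fun D f -> measurable C -> C `<=` D ->
  la.-integrable D (EFin \o (fun y => f y * phi (iota y + w))) ->
  0 <= M -> (forall z, `|phi z| <= M) ->
  (forall y, D y -> ~ C y -> phi (iota y + w) = 0) ->
  (`|pair_integral la D iota f w phi|%:E <=
     M%:E * \int[la]_(y in C) `|f y|%:E)%E.
Proof.
move=> mD mf mC CD fi M0 phiM phiC.
rewrite EFin_normr_Rintegral//.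
apply: le_trans (le_abse_integral _ _ _) _ => //; first exact: measurable_int fi.
have mfC : measurable_fun C (fun y => `|f y|%:E).
  apply/measurable_EFinP; apply: measurableT_comp => //.
  exact: measurable_funS mf.
rewrite -ge0_integralZl//.
rewrite -[X in (_ <= integral _ X _)%E](setIidr CD) integral_mkcondr.
apply: ge0_le_integral => //.
- by apply: measurableT_comp => //; exact: measurable_int fi.
- apply/(measurable_restrict _ mC mD).
  by rewrite setIidr//; exact: measurable_funeM.
- move=> y Dy; rewrite patchE; case: ifPn => [_|].
    by rewrite /= -EFinM lee_fin normrM mulrC ler_wpM2r.
  by rewrite notin_setE => /(phiC _ Dy) ->; rewrite /= mulr0 normr0.
Qed.

(** The translated test function lives in an escaping cylinder, where the mass
    of [f] tends to [0]. *)
Lemma slab_decay (T p : R) (f phi : spacetime -> R) (x : nat -> 'rV[R]_d) :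
  L1loc (slab T) f -> L1loc_Lp T p f -> 1 <= p -> test_fun (past_slab T) phi ->
  escaping x ->
  pair_integral nu (slab T) id f (0, x n) phi @[n --> \oo] --> 0.
Proof.
move=> Lf Lpf p1 tphi xoo; have [T' [m [T'T m0 hsupp]]] := supp_cylinder tphi.
have tphiT : test_fun setT phi by apply: test_funS tphi.
have [M M0 phiM] := test_fun_bounded tphi.
have xoo' : escaping (fun n => - x n) by move=> n; rewrite normrN.
apply: (cvg0_dominated (M := M) _ (integral_cylinder_cvg0 Lpf T'T p1 m0 xoo')) => n.
apply: (@pair_integral_le _ _ nu M (slab T)
  (`[0, T']%classic `*` cube (- x n) m) id f phi (0, x n)) => //.
- exact: measurable_slab.
- by case: Lf.
- by apply: measurableX; [exact: measurable_itv|exact: measurable_cube].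
- move=> z [+ _]; rewrite /= in_itv/= => /andP[z0 zT']; split => //=.
  by rewrite in_itv/= z0 (le_lt_trans zT').
- apply: (pair_integrable (loc_integrable_slab Lf) tphiT (@compact_set1 _ (0, x n))) => //.
  move=> z [_ -> /hsupp[/=]]; rewrite addr0 => zT' _.
  by split => //=; rewrite in_itv/= (le_lt_trans zT').
- move=> z [+ _] nz; rewrite /= in_itv/= => /andP[z0 zT].
  apply: supp_zero => /hsupp[/=]; rewrite addr0 => zT' hx; apply: nz.
  split => /=; first by rewrite in_itv/= z0.
  by apply/cubeP => i; have := hx i; rewrite !mxE opprK.
Qed.

Lemma space_decay (T p : R) (g : 'rV[R]_d -> R) (phi : spacetime -> R)
    (x : nat -> 'rV[R]_d) :
  L1loc_space g -> ('N[mu]_p%:E[EFin \o g] < +oo)%E -> 1 <= p ->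
  test_fun (past_slab T) phi -> escaping x ->
  pair_integral mu setT (fun x => (0, x)) g (0, x n) phi @[n --> \oo] --> 0.
Proof.
move=> Lg Npg p1 tphi xoo; have [T' [m [T'T m0 hsupp]]] := supp_cylinder tphi.
have tphiT : test_fun setT phi by apply: test_funS tphi.
have [M M0 phiM] := test_fun_bounded tphi.
have xoo' : escaping (fun n => - x n) by move=> n; rewrite normrN.
have mg : measurable_fun setT g by case: Lg.
apply: (cvg0_dominated (M := M) _ (integral_cube_cvg0 mg p1 m0 Npg xoo')) => n.
apply: pair_integral_le => //.
- exact: measurable_cube.
- apply: (pair_integrable (loc_integrable_space T Lg) tphiT (@compact_set1 _ (0, x n))) => //.
  move=> z [_ -> /hsupp[/=]]; rewrite addr0 => zT' _.
  by split => //=; rewrite in_itv/= (le_lt_trans zT').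
- move=> y _ ny; apply: supp_zero => /hsupp[/= _ hx]; apply: ny.
  by apply/cubeP => i; have := hx i; rewrite !mxE opprK.
Qed.

End decay.

(** * A Liouville theorem *)

Section liouville.
Context {R : realType}.

(** If [c] were positive, the derivative [k] of [h] would be positive on some
    interval [0 < s < e], and [h] would exceed [h 0] there. *)
Lemma second_derivative_at_max (h k : R -> R) (c del : R) :
  (forall s, is_derive s (1 : R) h (k s)) -> is_derive (0 : R) (1 : R) k c ->
  0 < del -> (forall s, `|s| < del -> h s <= h 0) -> c <= 0.
Proof.
move=> dh [dk kc] del0 hmax.
have k0 : k 0 = 0.
  have d0 : is_derive (0 : R) (1 : R) h 0.
    apply: (@derive1_at_max _ h (- del) del).
    - lra.
    - by move=> s _; case: (dh s).
    - by rewrite in_itv/=; lra.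
    - by move=> s; rewrite in_itv/= => sd; apply: hmax; rewrite ltr_norml.
  by have [_ <-] := dh 0; case: d0.
rewrite leNgt; apply/negP => c0.
have : (fun s => s^-1 *: ((k \o shift 0) (s *: 1) - k 0)) @ 0^' --> c.
  by rewrite -kc; exact: dk.
move=> /cvgrPdist_lt/(_ _ c0); rewrite near_withinE => -[e /= e0 he].
pose s := Num.min e del / 2.
have s0 : 0 < s by rewrite divr_gt0// lt_min e0.
have m1 : Num.min e del <= e by rewrite ge_min lexx.
have m2 : Num.min e del <= del by rewrite ge_min lexx orbT.
have se : s < e by rewrite /s in s0 *; lra.
have sdel : s < del by rewrite /s in s0 *; lra.
have ch : {within `[0, s], continuous h}.
  by apply: derivable_within_continuous => r _; case: (dh r).
have [r] := MVT s0 (fun r _ => dh r) ch.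
rewrite in_itv/= subr0 => /andP[r0 rs] hs.
have kr : 0 < k r.
  have r_ne0 : r != 0 by rewrite gt_eqF.
  have re : r < e by exact: lt_trans rs se.
  have := he r; rewrite /ball/= sub0r normrN gtr0_norm// => /(_ re r_ne0).
  rewrite k0 subr0 addr0 [r *: 1]mulr1 => /ltr_normlP[_].
  rewrite ltrBlDr => h1; have : 0 < r^-1 * k r.
    have : r^-1 *: k r = r^-1 * k r by [].
    move=> <-; lra.
  by rewrite pmulr_rgt0// invr_gt0.
have := hmax s; rewrite gtr0_norm// => /(_ sdel).
by rewrite leNgt -subr_gt0 hs mulr_gt0.
Qed.

Lemma is_derive_quadratic (c a b s : R) :
  is_derive s (1 : R) (fun s : R => c * (a + b * s + s ^+ 2)) (c * (b + 2 * s)).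
Proof.
have d1 : is_derive s (1 : R) (fun s : R => b * s) b.
  have := is_deriveZ b (is_derive_id s (1 : R)).
  by rewrite [b *: 1]mulr1.
have d2 : is_derive s (1 : R) (fun s : R => s ^+ 2) (2 * s).
  rewrite (_ : (fun s : R => s ^+ 2) = (@id R) ^+ 2); last first.
    by apply/funext => r; rewrite fctE.
  by have := is_deriveX 2 (is_derive_id s (1 : R)); rewrite /= expr1 [_ *: 1]mulr1.
have d3 := is_deriveD (is_deriveD (is_derive_cst a s (1 : R)) d1) d2.
by have := is_deriveZ c d3; rewrite add0r.
Qed.

Lemma is_derive_affine (c a s : R) :
  is_derive s (1 : R) (fun s : R => c * (2 * (a + s))) (2 * c).
Proof.
have -> : (fun s : R => c * (2 * (a + s))) = ((c * 2) *: (cst a + (@id R))).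
  by apply/funext => r /=; rewrite !fctE /GRing.scale/= mulrA.
by apply: is_derive_eq; rewrite /GRing.scale/= add0r mulr1 mulrC.
Qed.

Context {d : nat}.
Local Notation e_ i := (delta_mx 0 i : 'rV[R]_d).

(** Perturbed by a small multiple of the square of the Euclidean norm, a
    harmonic function that vanishes at infinity and is positive somewhere would
    have an interior maximum with a positive Laplacian. *)
Lemma harmonic_le0 (g : 'rV[R]_d -> R) (g1 g2 : 'I_d -> 'rV[R]_d -> R) :
  (0 < d)%N -> continuous g ->
  (forall i y (s : R), is_derive s (1 : R) (fun s : R => g (y + s *: e_ i))
     (g1 i (y + s *: e_ i))) ->
  (forall i y (s : R), is_derive s (1 : R) (fun s : R => g1 i (y + s *: e_ i))
     (g2 i (y + s *: e_ i))) ->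
  (forall y, \sum_i g2 i y = 0) ->
  (forall x, escaping x -> g (x n) @[n --> \oo] --> 0) ->
  forall y, g y <= 0.
Proof.
move=> d0 cg dg dg1 lap dec y0; rewrite leNgt; apply/negP => gy0.
have [r hr] : exists r : nat, forall y, r%:R <= `|y| -> g y < g y0 / 2.
  apply: contrapT => nr.
  have /choice[x hx] : forall n : nat, exists y, n%:R <= `|y| /\ g y0 / 2 <= g y.
    move=> n; apply: contrapT => nn; apply: nr; exists n => y ny.
    by rewrite ltNge; apply/negP => gy; apply: nn; exists y.
  have gy2 : 0 < g y0 / 2 by rewrite divr_gt0.
  have /dec/cvgrPdist_lt/(_ _ gy2)[N _ /(_ N (leqnn N))] : escaping x.
    by move=> n; case: (hx n).
  rewrite /= sub0r normrN; have [_ gN] := hx N.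
  by rewrite ger0_norm; lra.
pose r1 : R := r%:R + `|y0| + 1.
have r10 : 0 < r1 by rewrite /r1; have := normr_ge0 y0; have := ler0n R r; lra.
have hr1 y : r1 <= `|y| -> g y < g y0 / 2.
  move=> ry; apply: hr; apply: le_trans ry.
  by rewrite /r1; have := normr_ge0 y0; lra.
pose q (y : 'rV[R]_d) : R := \sum_i y 0 i ^+ 2.
have q0 y : 0 <= q y by apply: sumr_ge0 => i _; exact: sqr_ge0.
have dr0 : 0 < d%:R * r1 ^+ 2 by rewrite mulr_gt0 ?ltr0n// exprn_gt0.
(* The perturbation [eps * q] is at most [g y0 / 4] on the cube of radius [r1],
   while [g] is below [g y0 / 2] on its boundary: the maximum is interior. *)
pose eps := g y0 / 4 / (d%:R * r1 ^+ 2).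
have eps0 : 0 < eps by rewrite !divr_gt0.
pose h y := g y + eps * q y.
have cq : continuous q.
  apply: continuous_big => [|i _ y]; first exact: add_continuous.
  under eq_fun do rewrite expr2.
  have ci : {for y, continuous (fun x : 'rV[R]_d => x 0 i)}.
    exact: continuous_coord.
  exact: (continuousM ci ci).
have ch : continuous h.
  move=> y; have ce : {for y, continuous (fun _ : 'rV[R]_d => eps)} by exact: cst_continuous.
  exact: (continuousD (cg y) (continuousM ce (cq y))).
have y0c : cube 0 r1 y0.
  apply/cubeP => i; rewrite mxE subr0; apply: le_trans (normr_coord _ _) _.
  by rewrite /r1; have := ler0n R r; lra.
have chc : {within cube 0 r1, continuous h} by exact: continuous_subspaceT.
have [ym] := compact_EVT_max (ex_intro _ y0 y0c) (@compact_cube _ _ 0 r1) chc.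
rewrite inE => /cubeP ymc hmax.
have qm : q ym <= d%:R * r1 ^+ 2.
  rewrite /q; apply: le_trans (_ : \sum_(i < d) r1 ^+ 2 <= _).
    apply: ler_sum => i _; have := ymc i; rewrite mxE subr0 => yi.
    by rewrite -real_normK ?num_real// lerXn2r ?nnegrE// ltW.
  by rewrite sumr_const card_ord mulr_natl.
have hym : g y0 <= h ym.
  apply: le_trans (hmax y0 _); last exact: mem_set.
  by rewrite lerDl mulr_ge0// ltW.
have ym_lt : `|ym| < r1.
  rewrite ltNge; apply/negP => /hr1 gym.
  have : eps * q ym <= g y0 / 4.
    apply: le_trans (ler_wpM2l (ltW eps0) qm) _.
    by rewrite /eps divfK// gt_eqF.
  by rewrite /h in hym; lra.
have lap_i i : g2 i ym + 2 * eps <= 0.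
  pose H (s : R) := h (ym + s *: e_ i).
  pose K (s : R) := g1 i (ym + s *: e_ i) + eps * (2 * (ym 0 i + s)).
  have qE s : q (ym + s *: e_ i) = q ym + 2 * ym 0 i * s + s ^+ 2.
    rewrite /q (bigD1 i)//= [in RHS](bigD1 i)//= !mxE !eqxx mulr1.
    rewrite (eq_bigr (fun j => ym 0 j ^+ 2)) => [|j /negPf ji]; last first.
      by rewrite !mxE ji andbF mulr0 addr0.
    by rewrite sqrrD; ring.
  apply: (@second_derivative_at_max H K _ (r1 - `|ym|)).
  - move=> s; rewrite /H /K /h; apply: is_deriveD.
    under eq_fun do rewrite qE.
    by have := is_derive_quadratic eps (q ym) (2 * ym 0 i) s; rewrite -mulrDr.
  - rewrite /K; apply: is_deriveD; last exact: is_derive_affine.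
    by have := dg1 i ym 0; rewrite scale0r addr0.
  - by rewrite subr_gt0.
  - move=> s sr; rewrite /H; apply: le_trans (hmax _ _) _.
      apply/mem_set/cubeP => j; rewrite !mxE subr0.
      apply: le_trans (ler_normD _ _) _; rewrite normrM.
      have := normr_coord ym j.
      have : `|s| * `|((0 == 0 :> 'I_1) && (j == i))%:R| <= `|s|.
        by rewrite ler_piMr//; case: (_ && _); rewrite ?normr1 ?normr0.
      lra.
    by rewrite scale0r addr0.
have : \sum_i (g2 i ym + 2 * eps) <= 0 by apply: sumr_le0 => i _; exact: lap_i.
rewrite big_split/= lap add0r sumr_const card_ord; apply/negP; rewrite -ltNge.
by rewrite pmulrn_rgt0// mulr_gt0.
Qed.

End liouville.

(** * Integrability and linearity of the weak formulations *)

Section sums_of_integrals.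
Context {R : realType} {disp : measure_display} {Y : measurableType disp}.
Context (mu : {measure set Y -> \bar R}) (D : set Y).
Hypothesis mD : measurable D.

Lemma integrable_addr (f g : Y -> R) : mu.-integrable D (EFin \o f) ->
  mu.-integrable D (EFin \o g) ->
  mu.-integrable D (EFin \o (fun y => f y + g y)).
Proof.
move=> fi gi; rewrite (_ : _ \o _ = (EFin \o f) \+ (EFin \o g))%E//.
exact: integrableD.
Qed.

Lemma integrable_mull c (f : Y -> R) : mu.-integrable D (EFin \o f) ->
  mu.-integrable D (EFin \o (fun y => c * f y)).
Proof.
move=> fi; rewrite (_ : _ \o _ = (fun y => c%:E * (EFin \o f) y))%E//.
exact: integrableZl.
Qed.

Lemma integrable_fin_sum (I : finType) (f : I -> Y -> R) :
  (forall i, mu.-integrable D (EFin \o f i)) ->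
  mu.-integrable D (EFin \o (fun y => \sum_i f i y)).
Proof.
move=> fi; rewrite (_ : _ \o _ = fun y => (\sum_i (f i y)%:E)%E); last first.
  by apply/funext => y /=; rewrite sumEFin.
by apply: integrable_sum => // i _; exact: fi.
Qed.

Lemma Rintegral_fin_sum (I : finType) (f : I -> Y -> R) :
  (forall i, mu.-integrable D (EFin \o f i)) ->
  \int[mu]_(y in D) (\sum_i f i y) = \sum_i \int[mu]_(y in D) f i y.
Proof.
move=> fi; have aux (s : seq I) :
    mu.-integrable D (EFin \o (fun y => \sum_(i <- s) f i y)) /\
    \int[mu]_(y in D) (\sum_(i <- s) f i y) =
    \sum_(i <- s) \int[mu]_(y in D) f i y.
  elim: s => [|i s [IHi IH]].
    under eq_fun do rewrite big_nil.
    split; last first.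
      by rewrite big_nil Rintegral_cst// mul0r.
    exact: integrable0.
  under eq_fun do rewrite big_cons.
  split; first by apply: (integrableD mD (fi i) IHi).
  by rewrite big_cons RintegralD// IH.
by have [_] := aux (index_enum I).
Qed.

End sums_of_integrals.

Section local_integrability.
Context {R : realType} {d : nat} (T : R).
Local Notation spacetime := (R * 'rV[R]_d)%type.
Local Notation nu := (@lebesgue_spacetime R d).
Implicit Types (f g : spacetime -> R).

Lemma L1locD f g : L1loc (slab T) f -> L1loc (slab T) g ->
  L1loc (slab T) (fun z => f z + g z).
Proof.
move=> [mf Lf] [mg Lg]; split; first exact: measurable_funD.
move=> K KD cK; have mK := compact_measurable_spacetime cK.
by apply: (@integrable_addr _ _ _ nu K mK); [exact: Lf|exact: Lg].
Qed.

Lemma L1locZ c f : L1loc (slab T) f -> L1loc (slab T) (fun z => c * f z).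
Proof.
move=> [mf Lf]; split; first exact: measurable_funM.
move=> K KD cK; have mK := compact_measurable_spacetime cK.
by apply: (@integrable_mull _ _ _ nu K mK); exact: Lf.
Qed.

Lemma L1loc_sum (I : finType) (f : I -> spacetime -> R) :
  (forall i, L1loc (slab T) (f i)) ->
  L1loc (slab T) (fun z => \sum_i f i z).
Proof.
move=> Lf; split.
  by apply: measurable_sum => i; case: (Lf i).
move=> K KD cK; apply: (@integrable_fin_sum _ _ _ nu); first exact: compact_measurable_spacetime.
by move=> i; case: (Lf i) => _; apply.
Qed.

End local_integrability.

Section pairing_linearity.
Context {R : realType} {d : nat}.
Local Notation spacetime := (R * 'rV[R]_d)%type.
Context {disp : measure_display} {Y : measurableType disp}.
Context (mu : {measure set Y -> \bar R}) (T : R).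
Variables (D : set Y) (iota : Y -> spacetime) (f : Y -> R).
Implicit Types phi : spacetime -> R.

(** The translated function is a separate argument, so that it can be given in
    any convenient form. *)
Lemma pair_integral_translate w phi phiw : phiw = (fun z => phi (z + w)) ->
  pair_integral mu D iota f w phi = pair_integral mu D iota f 0 phiw.
Proof. by move=> ->; apply: eq_Rintegral => y _; rewrite addr0. Qed.

Hypothesis Lf : loc_integrable mu T D iota f.

Lemma test_fun_integrable phi : test_fun (past_slab T) phi ->
  mu.-integrable D (EFin \o (fun y => f y * phi (iota y))).
Proof.
move=> tphi; have tT : test_fun setT phi by apply: test_funS tphi.
have KT : translates [set (0 : spacetime)] phi `<=` past_slab T.
  by move=> z [_ ->]; rewrite addr0; case: tphi => _ _; exact.
have := pair_integrable Lf tT (@compact_set1 spacetime 0) erefl KT.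
by under eq_fun do rewrite addr0.
Qed.

Lemma pair_integral0E phi :
  pair_integral mu D iota f 0 phi = \int[mu]_(y in D) (f y * phi (iota y)).
Proof. by apply: eq_Rintegral => y _; rewrite addr0. Qed.

Lemma pair_integralD phi1 phi2 :
  test_fun (past_slab T) phi1 -> test_fun (past_slab T) phi2 ->
  pair_integral mu D iota f 0 (fun z => phi1 z + phi2 z) =
  pair_integral mu D iota f 0 phi1 + pair_integral mu D iota f 0 phi2.
Proof.
move=> t1 t2; rewrite !pair_integral0E.
rewrite -(RintegralD (loc_measurable_dom Lf) (test_fun_integrable t1) (test_fun_integrable t2)).
by apply: eq_Rintegral => y _; rewrite mulrDr.
Qed.

Lemma pair_integralZ c phi : test_fun (past_slab T) phi ->
  pair_integral mu D iota f 0 (fun z => c * phi z) =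
  c * pair_integral mu D iota f 0 phi.
Proof.
move=> t1; rewrite !pair_integral0E.
rewrite -(RintegralZl c (loc_measurable_dom Lf) (test_fun_integrable t1)).
by apply: eq_Rintegral => y _; rewrite mulrCA.
Qed.

End pairing_linearity.

Section weak_terms.
Context {R : realType} {d : nat} (T : R).
Local Notation spacetime := (R * 'rV[R]_d)%type.
Local Notation nu := (@lebesgue_spacetime R d).
Local Notation mu := (lebesgue_measure_rV d).
Implicit Types (u v : spacetime -> 'rV[R]_d) (A : spacetime -> 'M[R]_d).
Implicit Types (psi : spacetime -> 'rV[R]_d).

Lemma derive_test_coord psi Omega z (w : spacetime) i : test_fun Omega psi ->
  ('D_w psi z) 0 i = 'D_w (fun z => psi z 0 i) z.
Proof.
by move=> tpsi; rewrite derive_coord//; exact: smooth_derivable (test_fun_smooth tpsi) _ _.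
Qed.

Let mslab := @measurable_slab R d T.
Let integrable_slab_sum (I : finType) :=
  @integrable_fin_sum R _ _ nu (slab T) mslab I.
Let Rintegral_slab_sum (I : finType) :=
  @Rintegral_fin_sum R _ _ nu (slab T) mslab I.

Lemma integrable_slab_test (f phi : spacetime -> R) : L1loc (slab T) f ->
  test_fun (past_slab T) phi ->
  nu.-integrable (slab T) (EFin \o (fun z => f z * phi z)).
Proof.
by move=> Lf tphi; exact: (test_fun_integrable (loc_integrable_slab Lf) tphi).
Qed.

Lemma integrable_dot u psi : L1loc_vec (slab T) u ->
  test_fun (past_slab T) psi ->
  nu.-integrable (slab T) (EFin \o (fun z => dot (u z) (psi z))).
Proof.
move=> Lu tpsi; apply: integrable_slab_sum => i.
by apply: integrable_slab_test => //; exact: test_fun_coord.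
Qed.

Lemma integrable_ddot A psi : L1loc_mx (slab T) A ->
  test_fun (past_slab T) psi ->
  nu.-integrable (slab T) (EFin \o (fun z => ddot (A z) (jac_x psi z))).
Proof.
move=> LA tpsi; apply: integrable_slab_sum => i.
apply: integrable_slab_sum => j.
rewrite (_ : (fun z => _) = (fun z => A z i j * 'D_(dir_x i) (fun z => psi z 0 j) z)).
  by apply: integrable_slab_test => //; apply: test_fun_derive; exact: test_fun_coord.
by apply/funext => z; rewrite mxE (derive_test_coord _ _ _ tpsi).
Qed.

Lemma Rintegral_dot u psi : L1loc_vec (slab T) u ->
  test_fun (past_slab T) psi ->
  \int[nu]_(z in slab T) dot (u z) (psi z) =
  \sum_j pair_integral nu (slab T) id (fun z => u z 0 j) 0 (fun z => psi z 0 j).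
Proof.
move=> Lu tpsi; rewrite /dot Rintegral_slab_sum; last first.
  by move=> i; apply: integrable_slab_test => //; exact: test_fun_coord.
by apply: eq_bigr => j _; rewrite pair_integral0E.
Qed.

Lemma Rintegral_ddot A psi : L1loc_mx (slab T) A ->
  test_fun (past_slab T) psi ->
  \int[nu]_(z in slab T) ddot (A z) (jac_x psi z) =
  \sum_j \sum_i pair_integral nu (slab T) id (fun z => A z i j) 0
    ('D_(dir_x i) (fun z => psi z 0 j)).
Proof.
move=> LA tpsi; rewrite exchange_big /=.
have E i j : (fun z => A z i j * jac_x psi z i j) =
    (fun z => A z i j * 'D_(dir_x i) (fun z => psi z 0 j) z).
  by apply/funext => z; rewrite mxE (derive_test_coord _ _ _ tpsi).
have int i j : nu.-integrable (slab T) (EFin \o (fun z => A z i j * jac_x psi z i j)).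
  rewrite E; apply: integrable_slab_test => //; apply: test_fun_derive.
  exact: test_fun_coord.
rewrite /ddot Rintegral_slab_sum => [|i]; last first.
  exact: integrable_slab_sum.
apply: eq_bigr => i _; rewrite Rintegral_slab_sum//.
by apply: eq_bigr => j _; rewrite pair_integral0E E.
Qed.

Lemma Rintegral_dot_initial (u0 : 'rV[R]_d -> 'rV[R]_d) psi :
  L1loc_space_vec u0 -> test_fun (past_slab T) psi ->
  \int[mu]_x dot (u0 x) (psi (0, x)) =
  \sum_j pair_integral mu setT (fun x => (0, x)) (fun x => u0 x 0 j) 0
    (fun z => psi z 0 j).
Proof.
move=> Lu tpsi; rewrite /dot Rintegral_fin_sum//; last first.
  by move=> i; exact: (test_fun_integrable (loc_integrable_space T (Lu i))
    (test_fun_coord i tpsi)).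
by apply: eq_bigr => j _; rewrite pair_integral0E.
Qed.

End weak_terms.

(** * Gradients and Laplacians of test functions *)

Section test_vectors.
Context {R : realType} {d : nat}.
Local Notation spacetime := (R * 'rV[R]_d)%type.
Implicit Types (phi : spacetime -> R).

Lemma test_fun_row Omega phi (psi : spacetime -> 'rV[R]_d) :
  test_fun Omega phi -> (forall i, smooth (fun z => psi z 0 i)) ->
  (forall i z, ~ supp phi z -> psi z 0 i = 0) -> test_fun Omega psi.
Proof.
move=> tphi spsi psi0; apply: (test_fun_sub tphi); first exact/smooth_rowP.
by move=> z nz; apply/rowP => i; rewrite mxE psi0.
Qed.

Lemma grad_x_coord phi i : (fun z => grad_x phi z 0 i) = 'D_(dir_x i) phi.
Proof. by apply/funext => z; rewrite mxE. Qed.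

Lemma jac_x_coord Omega (psi : spacetime -> 'rV[R]_d) z i j :
  test_fun Omega psi ->
  jac_x psi z i j = 'D_(dir_x i) (fun z => psi z 0 j) z.
Proof. by move=> tpsi; rewrite mxE; exact: (derive_test_coord _ _ _ tpsi). Qed.

Lemma test_fun_grad_x Omega phi : test_fun Omega phi ->
  test_fun Omega (grad_x phi).
Proof.
move=> tphi; apply: (test_fun_row tphi) => [i|i z nz].
  by rewrite grad_x_coord; exact: (smooth_derive _ (test_fun_smooth tphi)).
by rewrite mxE derive_supp.
Qed.

Lemma jac_grad_x Omega phi z i j : test_fun Omega phi ->
  jac_x (grad_x phi) z i j = 'D_(dir_x i) ('D_(dir_x j) phi) z.
Proof.
move=> tphi; rewrite (jac_x_coord _ _ _ (test_fun_grad_x tphi)).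
exact (congr1 (fun f => 'D_(dir_x i) f z) (grad_x_coord phi j)).
Qed.

Lemma test_funD Omega phi1 phi2 : test_fun Omega phi1 -> test_fun Omega phi2 ->
  test_fun Omega (fun z => phi1 z + phi2 z).
Proof.
move=> [s1 c1 O1] [s2 c2 O2].
have sub : supp (fun z => phi1 z + phi2 z) `<=` supp phi1 `|` supp phi2.
  apply: supp_sub => [|z /not_orP[n1 n2]]; last first.
    by rewrite (supp_zero n1) (supp_zero n2) addr0.
  by apply: closedU; exact: closed_closure.
split; [exact: smoothD| |].
  apply: subclosed_compact sub; first exact: closed_closure.
  exact: compactU.
by apply: subset_trans sub _ => z [/O1|/O2].
Qed.

Lemma test_funZ Omega c phi : test_fun Omega phi ->
  test_fun Omega (fun z => c * phi z).
Proof.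
move=> tphi; apply: (test_fun_sub tphi).
  by have := smoothZ c (test_fun_smooth tphi).
by move=> z /supp_zero ->; rewrite mulr0.
Qed.

Lemma test_fun0 Omega : test_fun Omega (fun _ : spacetime => 0 : R).
Proof.
have s0 : supp (fun _ : spacetime => 0 : R) `<=` set0.
  by apply: supp_sub => [|//]; exact: closed0.
have sE : supp (fun _ : spacetime => 0 : R) = set0 by apply/seteqP; split.
split; rewrite ?sE//; last exact: compact0.
apply: (@smooth_coind _ _ _ [set f : spacetime -> R | f = cst 0]); last by [].
- by move=> _ -> z; exact: cvg_cst.
- by move=> _ -> z v; exact: derivable_cst.
- by move=> _ -> v; apply/funext => z; exact: derive_cst.
Qed.

Lemma test_fun_sum Omega (I : finType) (phi : I -> spacetime -> R) :
  (forall i, test_fun Omega (phi i)) ->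
  test_fun Omega (fun z => \sum_i phi i z).
Proof.
move=> tphi; elim: (index_enum I) => [|i s IHs].
  by under eq_fun do rewrite big_nil; exact: test_fun0.
by under eq_fun do rewrite big_cons; exact: test_funD.
Qed.

Definition laplacian phi z := \sum_i 'D_(dir_x i) ('D_(dir_x i) phi) z.

Lemma test_fun_laplacian Omega phi : test_fun Omega phi ->
  test_fun Omega (laplacian phi).
Proof.
by move=> tphi; apply: test_fun_sum => i; do 2 apply: test_fun_derive.
Qed.

Let growth_initial phi (x v : 'rV[R]_d) :
  (fun h : R => h^-1 *: (((fun x => phi (0, x)) \o shift x) (h *: v) - phi (0, x))) =
  (fun h : R => h^-1 *: ((phi \o shift (0, x)) (h *: (0, v)) - phi (0, x))).
Proof.
apply/funext => h /=; congr (_ *: (phi _ - _)); congr pair.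
by rewrite /= scaler0 addr0.
Qed.

Lemma derive_initial phi (x v : 'rV[R]_d) :
  'D_v (fun x => phi (0, x)) x = 'D_((0, v) : spacetime) phi (0, x).
Proof. by rewrite /derive growth_initial. Qed.

Lemma derivable_initial phi (x v : 'rV[R]_d) :
  derivable phi (0, x) ((0, v) : spacetime) ->
  derivable (fun x => phi (0, x)) x v.
Proof. by rewrite /derivable growth_initial. Qed.

(** A directional derivative of the trace is the trace of a spatial derivative,
    so the traces of smooth functions form a class as in [smooth_coind]. *)
Lemma test_fun_initial Omega phi : test_fun Omega phi ->
  test_fun setT (fun x => phi (0, x)).
Proof.
move=> [sphi cphi _].
have cK2 : compact (snd @` supp phi).
  by apply: continuous_compact => //; apply: continuous_subspaceT => z; exact: cvg_snd.
have sub : supp (fun x => phi (0, x)) `<=` snd @` supp phi.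
  apply: supp_sub => [|x nx].
    by apply: compact_closed => //; exact: norm_hausdorff.
  by apply: supp_zero => hx; apply: nx; exists (0, x).
split => //; last by apply: subclosed_compact cK2 sub; exact: closed_closure.
apply: (@smooth_coind _ _ _ [set h | exists2 f : spacetime -> R,
  smooth f & h = fun x : 'rV[R]_d => f (0, x)]); last by exists phi.
- move=> _ [f sf ->] x.
  have c0 : {for x, continuous (fun x : 'rV[R]_d => (0 : R, x))}.
    move=> U [[P Q] /= [P0 Qx] PQU]; rewrite /nbhs/= /nbhs/=.
    apply: filterS Qx => y Qy; apply: PQU; split => //=.
    exact: (nbhs_singleton P0).
  apply: (@continuous_comp _ _ _ (fun y : 'rV[R]_d => (0 : R, y)) f _ c0).
  exact: smooth_continuous.
- move=> _ [f sf ->] x v; apply: derivable_initial.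
  exact: smooth_derivable.
- move=> _ [f sf ->] v; exists ('D_((0, v) : spacetime) f); first exact: smooth_derive.
  by apply/funext => x; rewrite derive_initial.
Qed.

Lemma grad_initial phi (x : 'rV[R]_d) :
  grad (fun x => phi (0, x)) x = grad_x phi (0, x).
Proof. by apply/rowP => i; rewrite !mxE derive_initial. Qed.

End test_vectors.

Lemma is_derive_funext (R : realType) (f g : R -> R) (s df : R) :
  (forall r, f r = g r) -> is_derive s (1 : R) f df -> is_derive s (1 : R) g df.
Proof. by move=> /funext ->. Qed.

Lemma eq_of_derive0 (R : realType) (g : R -> R) (p q s0 s1 : R) :
  (forall s, p < s < q -> is_derive s (1 : R) g 0) ->
  s0 < s1 -> p < s0 -> s1 < q -> g s0 = g s1.
Proof.
move=> dg s01 ps0 s1q.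
have cg : {within `[s0, s1], continuous g}.
  apply: derivable_within_continuous => s; rewrite in_itv/= => /andP[h0 h1].
  by case: (dg s) => //; lra.
have dg' s : s \in `]s0, s1[%R -> is_derive s (1 : R) g ((fun=> 0) s).
  by rewrite in_itv/= => /andP[h0 h1]; apply: dg; lra.
have [c _] := MVT s01 dg' cg.
by rewrite mul0r => /eqP; rewrite subr_eq0 => /eqP.
Qed.

Section directions.
Context {R : realType} {d : nat}.
Local Notation spacetime := (R * 'rV[R]_d)%type.

Lemma dir_x_line (y : 'rV[R]_d) (i : 'I_d) (r : R) :
  (0, y + r *: delta_mx 0 i) = (0, y) + r *: dir_x i :> spacetime.
Proof. by congr pair; rewrite /= scaler0 addr0. Qed.

Lemma dir_x_fst (z : spacetime) (y : 'rV[R]_d) (i : 'I_d) (r : R) :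
  (z + ((0, y) + r *: dir_x i)).1 = z.1.
Proof. by rewrite /= scaler0 !addr0. Qed.

Lemma dir_t_fst (z : spacetime) (r : R) : (z + (0 + r *: dir_t)).1 = z.1 + r.
Proof. by rewrite /= add0r [r *: 1]mulr1. Qed.

End directions.

Lemma Rintegral_open_slab (R : realType) (d : nat) (T : R) (f : R * 'rV[R]_d -> R) :
  (forall z, slab T z -> ~ open_slab T z -> f z = 0) ->
  \int[lebesgue_spacetime]_(z in open_slab T) f z =
  \int[lebesgue_spacetime]_(z in slab T) f z.
Proof.
move=> f0; rewrite Rintegral_mkcond [RHS]Rintegral_mkcond.
apply: eq_Rintegral => z _; rewrite !patchE.
case: ifPn => [/set_mem oz|]; last first.
  rewrite notin_setE => nz; case: ifPn => // /set_mem sz.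
  by rewrite f0.
rewrite mem_set//; case: oz => + _; rewrite /= in_itv/= => /andP[z0 zT].
by split => //=; rewrite in_itv/= ltW.
Qed.

Local Opaque derive pair_integral Rintegral dir_t dir_x.

(** * Weak formulations as functions of a translation *)

(** What the proofs below need from the pairings with the coefficients of an
    equation; a weak formulation in one unknown is a sum of such pairings. *)
Section weak_forms.
Context {R : realType} {d : nat} (T : R).
Local Notation spacetime := (R * 'rV[R]_d)%type.
Implicit Types (phi : spacetime -> R) (F : spacetime -> (spacetime -> R) -> R).

Record is_pairing F : Prop := IsPairing {
  pairing_translate : forall w phi phiw, phiw = (fun z => phi (z + w)) ->
    F w phi = F 0 phiw ;
  pairingD : forall phi1 phi2, test_fun (past_slab T) phi1 ->
    test_fun (past_slab T) phi2 ->
    F 0 (fun z => phi1 z + phi2 z) = F 0 phi1 + F 0 phi2 ;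
  pairingZ : forall c phi, test_fun (past_slab T) phi ->
    F 0 (fun z => c * phi z) = c * F 0 phi ;
  pairing_derive : forall v w phi (p q s : R), test_fun setT phi ->
    (forall r z, p <= r <= q -> supp phi (z + (w + r *: v)) -> past_slab T z) ->
    p < s < q ->
    is_derive s (1 : R) (fun r : R => F (w + r *: v) phi)
      (F (w + s *: v) ('D_v phi)) ;
  pairing_cvg : forall (B : set spacetime) phi (w : nat -> spacetime) w0,
    test_fun setT phi -> compact B -> translates B phi `<=` past_slab T ->
    (forall n, B (w n)) -> B w0 -> w n @[n --> \oo] --> w0 ->
    F (w n) phi @[n --> \oo] --> F w0 phi
}.

Lemma pair_integral_is_pairing disp (Y : measurableType disp)
    (mu : {measure set Y -> \bar R}) (D : set Y) (iota : Y -> spacetime)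
    (f : Y -> R) :
  loc_integrable mu T D iota f -> is_pairing (pair_integral mu D iota f).
Proof.
move=> Lf; split.
- by move=> w phi phiw; exact: pair_integral_translate.
- by move=> phi1 phi2; exact: (pair_integralD Lf).
- by move=> c phi; exact: (pair_integralZ Lf c).
- by move=> v w phi p q s; exact: (pair_integral_derive Lf).
- by move=> B phi w w0; exact: (pair_integral_cvg Lf).
Qed.

Variables (Ft : spacetime -> (spacetime -> R) -> R).
Variables (Fx : 'I_d -> spacetime -> (spacetime -> R) -> R).
Variables (F0 : spacetime -> (spacetime -> R) -> R).
Hypotheses (pt : is_pairing Ft) (px : forall i, is_pairing (Fx i)).
Hypothesis (p0 : is_pairing F0).

Definition weak_form phi (w : spacetime) : R :=
  Ft w ('D_dir_t phi) + \sum_i Fx i w ('D_(dir_x i) phi) + F0 w phi.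

Lemma weak_form_translate phi w :
  weak_form phi w = weak_form (fun z => phi (z + w)) 0.
Proof.
have E v : 'D_v (fun z => phi (z + w)) = fun z => 'D_v phi (z + w).
  by apply/funext => z; rewrite derive_translate.
rewrite /weak_form (pairing_translate pt (E _)) (pairing_translate p0 erefl).
by congr (_ + _ + _); apply: eq_bigr => i _; rewrite (pairing_translate (px i) (E _)).
Qed.

Lemma weak_formD phi1 phi2 :
  test_fun (past_slab T) phi1 -> test_fun (past_slab T) phi2 ->
  weak_form (fun z => phi1 z + phi2 z) 0 = weak_form phi1 0 + weak_form phi2 0.
Proof.
move=> t1 t2.
have E v : 'D_v (fun z => phi1 z + phi2 z) = fun z => 'D_v phi1 z + 'D_v phi2 z.
  apply/funext => z; rewrite deriveD//.
    exact: (smooth_derivable (test_fun_smooth t1) _ _).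
  exact: (smooth_derivable (test_fun_smooth t2) _ _).
have td v := test_fun_derive v t1; have td' v := test_fun_derive v t2.
have Et := etrans (congr1 (Ft 0) (E dir_t)) (pairingD pt (td _) (td' _)).
have Ex i := etrans (congr1 (Fx i 0) (E (dir_x i))) (pairingD (px i) (td _) (td' _)).
have Es : \sum_i Fx i 0 ('D_(dir_x i) (fun z => phi1 z + phi2 z)) =
    \sum_i Fx i 0 ('D_(dir_x i) phi1) + \sum_i Fx i 0 ('D_(dir_x i) phi2).
  by rewrite -big_split; apply: eq_bigr => i _; exact: Ex.
have := f_equal2 +%R (f_equal2 +%R Et Es) (pairingD p0 t1 t2).
by move=> WE; apply: (etrans WE); rewrite /weak_form; ring.
Qed.

Lemma weak_formZ c phi : test_fun (past_slab T) phi ->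
  weak_form (fun z => c * phi z) 0 = c * weak_form phi 0.
Proof.
move=> t1; have td v := test_fun_derive v t1.
have E v : 'D_v (fun z => c * phi z) = fun z => c * 'D_v phi z.
  apply/funext => z; rewrite deriveZ//.
  exact: (smooth_derivable (test_fun_smooth t1) _ _).
have Et := etrans (congr1 (Ft 0) (E dir_t)) (pairingZ pt c (td _)).
have Ex i := etrans (congr1 (Fx i 0) (E (dir_x i))) (pairingZ (px i) c (td _)).
have Es : \sum_i Fx i 0 ('D_(dir_x i) (fun z => c * phi z)) =
    c * \sum_i Fx i 0 ('D_(dir_x i) phi).
  by rewrite mulr_sumr; apply: eq_bigr => i _; exact: Ex.
have := f_equal2 +%R (f_equal2 +%R Et Es) (pairingZ p0 c t1).
by move=> WE; apply: (etrans WE); rewrite /weak_form; ring.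
Qed.

Lemma weak_form_sum (I : finType) (phi : I -> spacetime -> R) :
  (forall i, test_fun (past_slab T) (phi i)) ->
  weak_form (fun z => \sum_i phi i z) 0 = \sum_i weak_form (phi i) 0.
Proof.
move=> tphi; elim: (index_enum I) => [|i s IHs].
  under eq_fun do rewrite big_nil; rewrite big_nil.
  have := weak_formZ 0 (test_fun0 (past_slab T)).
  by rewrite !mul0r.
under eq_fun do rewrite big_cons; rewrite big_cons.
rewrite (weak_formD (tphi i)) ?IHs//.
elim: {IHs} s => [|k s IHs]; first by under eq_fun do rewrite big_nil; exact: test_fun0.
by under eq_fun do rewrite big_cons; exact: test_funD.
Qed.

(** Along a spatial translation nothing leaves the half-space [t < T]. *)
Lemma past_slab_translate phi (y : 'rV[R]_d) (i : 'I_d) (r : R) z :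
  test_fun (past_slab T) phi ->
  supp phi (z + ((0, y) + r *: dir_x i)) -> past_slab T z.
Proof.
by move=> [_ _ phiT] /phiT[]; rewrite dir_x_fst.
Qed.

(** Spatial derivatives commute with the other ones, so that the derivative of
    the form is the form of the derivative. *)
Lemma weak_form_derive phi (y : 'rV[R]_d) (i : 'I_d) (s : R) :
  test_fun (past_slab T) phi ->
  is_derive s (1 : R) (fun r : R => weak_form phi (0, y + r *: delta_mx 0 i))
    (weak_form ('D_(dir_x i) phi) (0, y + s *: delta_mx 0 i)).
Proof.
move=> tphi; have sphi := test_fun_smooth tphi.
under eq_fun do rewrite dir_x_line; rewrite dir_x_line.
have sI : s - 1 < s < s + 1 by lra.
have dF F phi' : is_pairing F -> test_fun (past_slab T) phi' ->
    is_derive s (1 : R) (fun r : R => F ((0, y) + r *: dir_x i) phi')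
      (F ((0, y) + s *: dir_x i) ('D_(dir_x i) phi')).
  move=> pF t'; apply: (pairing_derive pF _ _ sI).
    by apply: test_funS t'.
  by move=> r z _; exact: past_slab_translate.
have td v := test_fun_derive v tphi.
have comm v := derive_comm v (dir_x i) sphi.
set w := (0, y) + s *: dir_x i.
have Es : \sum_k Fx k w ('D_(dir_x k) ('D_(dir_x i) phi)) =
    \sum_k Fx k w ('D_(dir_x i) ('D_(dir_x k) phi)).
  by apply: eq_bigr => k _; exact: (congr1 (Fx k w) (comm (dir_x k))).
have := f_equal2 +%R (f_equal2 +%R (congr1 (Ft w) (comm dir_t)) Es)
  (erefl (F0 w ('D_(dir_x i) phi))).
move=> WE; rewrite [X in is_derive _ _ _ X]WE {WE}.
have dt := dF _ _ pt (td dir_t); have d0 := dF _ _ p0 tphi.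
have dx := is_derive_sum (fun k => dF _ _ (px k) (td (dir_x k))).
refine (is_derive_funext _ (is_deriveD (is_deriveD dt dx) d0)) => r.
by rewrite !fctE fct_sumE.
Qed.

(** By contradiction: along a sequence of points [x n] that tends to [y], all
    the translates of [phi] are supported in one compact set, and
    [pairing_cvg] applies. *)
Lemma weak_form_continuous phi : test_fun (past_slab T) phi ->
  continuous (fun y : 'rV[R]_d => weak_form phi (0, y)).
Proof.
move=> tphi y; apply/(@cvgrPdist_lt _ _ _ (nbhs y)) => e e0; apply: contrapT => nh.
have /choice[x hx] : forall n : nat, exists x : 'rV[R]_d,
    `|y - x| < n.+1%:R^-1 /\ e <= `|weak_form phi (0, y) - weak_form phi (0, x)|.
  move=> n; apply: contrapT => nn; apply: nh.
  have n0 : 0 < (n.+1%:R^-1 : R) by rewrite invr_gt0 ltr0n.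
  apply/nbhs_ballP; exists n.+1%:R^-1 => //= x; rewrite -ball_normE/= => yx.
  by rewrite ltNge; apply/negP => ex; apply: nn; exists x.
have xy : x n @[n --> \oo] --> y.
  apply/cvgrPdist_lt => r r0; near=> n.
  apply: lt_trans (proj1 (hx n)) _; near: n.
  exact: (near_infty_natSinv_lt (PosNum r0)).
have x0y : (0 : R, x n) @[n --> \oo] --> (0 : R, y).
  exact: (cvg_pair (cvg_cst _) xy).
pose B : set spacetime := [set 0] `*` cube y 1.
have cB : compact B by apply: compact_setX; [exact: compact_set1|exact: compact_cube].
have Bx n : B (0, x n).
  split => //; apply/cubeP => i; have := normr_coord (x n - y) i; rewrite !mxE.
  move=> /le_trans; apply; rewrite distrC; apply: le_trans (ltW (proj1 (hx n))) _.
  by rewrite invf_le1 ?ler1n ?ltr0n.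
have By : B (0, y) by split => //; apply/cubeP => i; rewrite subrr normr0.
have cF F phi' : is_pairing F -> test_fun (past_slab T) phi' ->
    F (0, x n) phi' @[n --> \oo] --> F (0, y) phi'.
  move=> pF t'; apply: (pairing_cvg pF _ cB _ Bx By x0y).
    by apply: test_funS t'.
  move=> z [w [/= w0 _] wz]; case: t' => _ _ /(_ _ wz) [/=].
  by rewrite w0 addr0 => zT _; exact: conj zT I.
have td v := test_fun_derive v tphi.
have cW : weak_form phi (0, x n) @[n --> \oo] --> weak_form phi (0, y).
  apply: cvgD; last exact: (cF _ _ p0 tphi).
  apply: cvgD; first exact: (cF _ _ pt (td _)).
  apply: cvg_big => [|i _]; first exact: add_continuous.
  exact: (cF _ _ (px i) (td _)).
have /cvgrPdist_lt/(_ _ e0)[N _ /(_ N (leqnn N))] := cW.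
by rewrite /= ltNge (proj2 (hx N)).
Unshelve. all: by end_near. Qed.

End weak_forms.

(** * The induction equation *)

Section induction_equation.
Context {R : realType} {d : nat} (T : R).
Local Notation spacetime := (R * 'rV[R]_d)%type.
Local Notation nu := (@lebesgue_spacetime R d).
Local Notation mu := (lebesgue_measure_rV d).
Variables (b : spacetime -> 'rV[R]_d) (A : spacetime -> 'M[R]_d).
Variable b0 : 'rV[R]_d -> 'rV[R]_d.
Hypothesis Lb : L1loc_vec (slab T) b.
Hypothesis LA : L1loc_mx (slab T) A.
Hypothesis Lb0 : L1loc_space_vec b0.
Implicit Types (phi chi : spacetime -> R) (zeta : spacetime -> 'rV[R]_d).

(** The left-hand side of the induction equation, for a general flux [A]. *)
Definition magnetic_form zeta : R :=
  \int[nu]_(z in slab T)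
    (dot (b z) ('D_dir_t zeta z) + ddot (A z) (jac_x zeta z))
  + \int[mu]_x dot (b0 x) (zeta (0, x)).

(** The contribution of the [j]-th coordinate of the test field, as a function
    of the translation applied to it. *)
Definition component (j : 'I_d) : (spacetime -> R) -> spacetime -> R :=
  weak_form (pair_integral nu (slab T) id (fun z => b z 0 j))
    (fun i => pair_integral nu (slab T) id (fun z => A z i j))
    (pair_integral mu setT (fun x => (0, x)) (fun x => b0 x 0 j)).

Let mslab : measurable (slab T : set spacetime) := @measurable_slab R d T.

Lemma magnetic_formE zeta : test_fun (past_slab T) zeta ->
  magnetic_form zeta = \sum_j component j (fun z => zeta z 0 j) 0.
Proof.
move=> tz; have tDz := test_fun_derive (dir_t : spacetime) tz.
rewrite /magnetic_form (@RintegralD _ _ _ nu _ _ _ mslab (integrable_dot Lb tDz) (integrable_ddot LA tz)).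
rewrite (Rintegral_dot Lb tDz) (Rintegral_ddot LA tz) (Rintegral_dot_initial Lb0 tz).
rewrite -!big_split/=; apply: eq_bigr => j _; rewrite /component /weak_form.
congr (pair_integral _ _ _ _ _ _ + _ + _); apply/funext => z.
by rewrite (derive_test_coord _ _ _ tz).
Qed.

Hypothesis antisymA : forall z, (A z)^T = - A z.
Hypothesis divb0 : div_free_space b0.

(** On gradients, the flux term vanishes because a Hessian is symmetric, and
    the initial term because [b0] is divergence free. *)
Lemma magnetic_form_grad chi : test_fun (past_slab T) chi ->
  magnetic_form (grad_x chi) =
  \int[nu]_(z in slab T) dot (b z) (grad_x ('D_dir_t chi) z).
Proof.
move=> tchi; have schi := test_fun_smooth tchi.
have tg := test_fun_grad_x tchi.
rewrite /magnetic_form [X in _ + X](_ : _ = 0) ?addr0; last first.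
  apply: etrans (divb0 (test_fun_initial tchi)).
  by apply: eq_Rintegral => x _; rewrite grad_initial.
apply: eq_Rintegral => z _.
rewrite [X in _ + X](_ : _ = 0) ?addr0; last first.
  have H i j : jac_x (grad_x chi) z i j = jac_x (grad_x chi) z j i.
    have D v w := congr1 (@^~ z) (derive_comm v w schi).
    exact: etrans (jac_grad_x z i j tchi) (etrans (D _ _) (esym (jac_grad_x z j i tchi))).
  have : ddot (A z) (jac_x (grad_x chi) z) = - ddot (A z) (jac_x (grad_x chi) z).
    rewrite {1}/ddot exchange_big/= /ddot -sumrN; apply: eq_bigr => i _.
    rewrite -sumrN; apply: eq_bigr => j _; rewrite H.
    by have /matrixP/(_ i j) := antisymA z; rewrite !mxE => ->; rewrite mulNr.
  lra.
congr dot; apply/rowP => i.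
apply: etrans (derive_test_coord _ _ _ tg) _.
apply: etrans (congr1 (fun f => 'D_dir_t f z) (grad_x_coord chi i)) _.
by rewrite mxE; exact (congr1 (@^~ z) (derive_comm dir_t (dir_x i) schi)).
Qed.

(** The divergence of [b] does not depend on time: the pairing of [b] with the
    gradient of [chi], shifted in time towards the past, is constant, and the
    shifted test function ends up supported in [t < 0]. *)
Lemma div_free_of_induction :
  (forall zeta, test_fun (past_slab T) zeta -> magnetic_form zeta = 0) ->
  0 < T -> div_free T b.
Proof.
move=> form0 T0 chi tchi; have schi := test_fun_smooth tchi.
have tchiT : test_fun setT chi by apply: test_funS tchi.
have tpast : test_fun (past_slab T) chi.
  apply: test_funS tchi => z [+ _]; rewrite /= in_itv/= => /andP[_ zT].
  by split => //=; rewrite in_itv.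
have [T' [m [T'T _ hsupp]]] := supp_cylinder tpast.
pose del := (T - T') / 2.
have del0 : 0 < del by rewrite /del; lra.
(* [gam s] is the pairing of [b] with the gradient of [chi (. + s e_t)]. *)
pose gam (s : R) := \sum_k pair_integral nu (slab T) id (fun z => b z 0 k)
  (0 + s *: dir_t) ('D_(dir_x k) chi).
have sub r z : - del <= r <= T + 1 -> supp chi (z + (0 + r *: dir_t)) ->
    past_slab T z.
  move=> /andP[r1 r2] /hsupp[+ _]; rewrite dir_t_fst => zr.
  by split => //=; rewrite in_itv/=; rewrite /del in r1 del0; lra.
have supp_D k : supp ('D_(dir_x k) chi) `<=` supp chi.
  by apply: supp_sub => [|z]; [exact: closed_closure|exact: derive_supp].
have dgam s : - del < s < T + 1 -> is_derive s (1 : R) gam 0.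
  move=> sI.
  have dk k : is_derive s (1 : R) (fun s : R => pair_integral nu (slab T) id (fun z => b z 0 k)
      (0 + s *: dir_t) ('D_(dir_x k) chi))
      (pair_integral nu (slab T) id (fun z => b z 0 k) (0 + s *: dir_t)
        ('D_dir_t ('D_(dir_x k) chi))).
    apply: (pair_integral_derive (loc_integrable_slab (Lb k)) _ _ sI).
      exact: test_fun_derive.
    by move=> r z rI /supp_D; exact: sub.
  pose tau z := chi (z + (0 + s *: dir_t)).
  have ttau : test_fun (past_slab T) tau.
    apply: (test_fun_translate tchi) => z [_ ->]; apply: sub.
    by case/andP: sI => ? ?; rewrite !ltW.
  have gam_sum : gam = \sum_k (fun s : R => pair_integral nu (slab T) id (fun z => b z 0 k)
      (0 + s *: dir_t) ('D_(dir_x k) chi)).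
    by apply/funext => r; rewrite fct_sumE.
  rewrite gam_sum; have := is_derive_sum (fun k => dk k).
  rewrite [X in is_derive _ _ _ X](_ : _ = 0)//.
  have Z := form0 _ (test_fun_grad_x ttau).
  rewrite (magnetic_form_grad ttau) in Z.
  rewrite (Rintegral_dot Lb (test_fun_grad_x (test_fun_derive _ ttau))) in Z.
  apply: etrans Z; apply: eq_bigr => k _; apply: pair_integral_translate.
  apply: etrans (grad_x_coord _ _) _.
  apply: etrans (derive_comm (dir_x k) dir_t (test_fun_smooth ttau)) _.
  exact (etrans (congr1 (fun f => 'D_dir_t f) (derive_translateE chi _ (dir_x k)))
    (derive_translateE ('D_(dir_x k) chi) _ dir_t)).
have gam0T : gam 0 = gam T.
  by apply: (eq_of_derive0 dgam T0); lra.
have gamT : gam T = 0.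
  apply: big1 => k _.
  apply: (@etrans _ _ (\int[nu]_(z in slab T) 0)); last first.
    by rewrite (@Rintegral_cst _ _ _ nu _ mslab) mul0r.
  apply: eq_Rintegral => z /set_mem[+ _]; rewrite /= in_itv/= => /andP[z0 _].
  have D0 : 'D_(dir_x k) chi (z + (0 + T *: dir_t)) = 0.
    apply: derive_supp; case: tchi => _ _ /[apply] -[+ _].
    by rewrite dir_t_fst /= in_itv/= => /andP[_]; rewrite gtrDr ltNge z0.
  exact (etrans (congr1 ( *%R _) D0) (mulr0 _)).
rewrite (Rintegral_open_slab (f := fun z => dot (b z) (grad_x chi z))); last first.
  move=> z _ nz; apply: big1 => k _; rewrite mxE.
  have D0 : 'D_(dir_x k) chi z = 0.
    by apply: derive_supp; case: tchi => _ _ /[apply].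
  exact (etrans (congr1 ( *%R _) D0) (mulr0 _)).
rewrite (Rintegral_dot Lb (test_fun_grad_x tpast)).
apply: etrans (etrans gam0T gamT).
apply: eq_bigr => k _; rewrite /gam scale0r addr0.
exact (congr1 (pair_integral _ _ _ _ _) (grad_x_coord chi k)).
Qed.

End induction_equation.

Local Transparent derive pair_integral Rintegral dir_t dir_x.

(** * Cutoff near the initial time *)

Section flat.
Context {R : realType}.

(** The factors [t ^ (- n)] make the family stable under differentiation up to
    linear combinations. *)
Definition flat (n : nat) (t : R) : R :=
  if 0 < t then t^-1 ^+ n * expR (- t^-1) else 0.

Lemma flat_ge0 n t : 0 <= flat n t.
Proof.
rewrite /flat; case: ifPn => // t0.
by rewrite mulr_ge0 ?expR_ge0// exprn_ge0// invr_ge0 ltW.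
Qed.

Lemma flat_le0 n t : t <= 0 -> flat n t = 0.
Proof. by rewrite /flat ltNge => ->. Qed.

Lemma flatS n t : flat n.+1 t = t^-1 * flat n t.
Proof. by rewrite /flat; case: ifPn => _; rewrite ?mulr0// exprS mulrA. Qed.

(** Since [exp x >= (x / (n + 1)) ^ (n + 1)]. *)
Lemma flat_le n t : flat n t <= n.+1%:R ^+ n.+1 * `|t|.
Proof.
rewrite /flat; case: ifPn => t0; last by rewrite mulr_ge0// exprn_ge0.
have t1 : 0 < t^-1 by rewrite invr_gt0.
have n0 : 0 < n.+1%:R :> R by rewrite ltr0n.
have hexp : (t^-1 / n.+1%:R) ^+ n.+1 <= expR t^-1.
  have -> : expR t^-1 = expR (t^-1 / n.+1%:R) ^+ n.+1.
    by rewrite -expRM_natl mulrC divfK// gt_eqF.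
  apply: lerXn2r; rewrite ?nnegrE ?expR_ge0//; first by rewrite divr_ge0 ?ltW.
  by apply: le_trans (expR_ge1Dx _); rewrite lerDr.
rewrite expRN gtr0_norm// ler_pdivrMr ?expR_gt0//.
apply: le_trans (ler_wpM2l _ hexp); last first.
  by rewrite mulr_ge0 ?ltW// exprn_gt0.
rewrite expr_div_n; set X := n.+1%:R ^+ n.+1.
have X0 : X != 0 by rewrite gt_eqF// exprn_gt0.
have -> : X * t * (t^-1 ^+ n.+1 / X) = (X / X) * (t / t) * t^-1 ^+ n.
  by rewrite exprS; ring.
by rewrite (divff X0) divff ?gt_eqF// !mul1r.
Qed.

Lemma is_derive_flat n t :
  is_derive t (1 : R) (flat n) (flat n.+2 t - n%:R * flat n.+1 t).
Proof.
have [t0|t0|->] := ltgtP t 0.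
- rewrite !flat_le0 ?ltW// mulr0 subr0.
  refine (near_eq_is_derive _ (is_derive_cst (0 : R) t (1 : R))).
  near=> s; rewrite flat_le0// ltW//.
  by near: s; exact: lt_nbhsl.
- pose f0 (s : R) : R := s^-1 ^+ n * expR (- s^-1).
  have f0E : \near t, f0 t = flat n t.
    near=> s; rewrite /flat ifT//.
    by near: s; exact: lt_nbhsr.
  refine (near_eq_is_derive f0E _).
  have tn0 : t != 0 by rewrite gt_eqF.
  pose g (s : R) : R := s^-1.
  have dg : is_derive t (1 : R) g (- (t^-1 * t^-1)).
    have := is_deriveV tn0 (is_derive_id t (1 : R)).
    by rewrite [_ *: 1]mulr1 -expr2 exprVn.
  have dgn := is_deriveX n dg.
  have de : is_derive t (1 : R) (expR \o (- g)) (expR (- t^-1) * (t^-1 * t^-1)).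
    have := is_derive1_comp (is_derive_expR ((- g) t)) (is_deriveN dg).
    by rewrite opprK.
  have := is_deriveM dgn de.
  set V := (X in is_derive _ _ _ X -> _) => dV.
  rewrite (_ : _ - _ = V).
    by rewrite (_ : f0 = (g ^+ n * (expR \o - g)))//; apply/funext => s; rewrite !fctE.
  rewrite /V /flat t0 /GRing.scale/= !fctE /=.
  by case: (n) => [|m]; rewrite ?exprS; ring.
- rewrite !flat_le0// mulr0 subr0.
  have c0 : (fun h => h^-1 *: ((flat n \o shift 0) (h *: 1) - flat n 0)) @ 0^' --> 0.
    apply/cvgrPdist_le => e e0.
    have C0 : 0 < n.+2%:R ^+ n.+2 :> R by rewrite exprn_gt0// ltr0n.
    near=> h; rewrite sub0r normrN /= addr0 [h *: 1]mulr1 (flat_le0 n (lexx 0)) subr0.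
    rewrite -[_ *: _]/(h^-1 * flat n h) -flatS ger0_norm ?flat_ge0//.
    apply: le_trans (flat_le _ _) _; rewrite -ler_pdivlMl// mulrC.
    near: h; apply: dnbhs0_le; exact: divr_gt0.
  by apply: DeriveDef; [apply/cvg_ex; exists 0|exact/cvg_lim].
Unshelve. all: by end_near. Qed.

Lemma is_derive_flat_dir n (c t : R) :
  is_derive t c (flat n) (c * (flat n.+2 t - n%:R * flat n.+1 t)).
Proof.
have dfl := is_derive_flat n t.
have df : differentiable (flat n) t by apply/derivable1_diffP; case: dfl.
apply: DeriveDef; first exact: diff_derivable.
rewrite deriveE//; case: dfl => _; rewrite deriveE// => <-.
by rewrite -{1}[c]mulr1 -[c * 1]/(c *: 1) linearZ.
Qed.

Lemma continuous_flat n : continuous (flat n).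
Proof.
move=> t; apply: differentiable_continuous; apply/derivable1_diffP.
by case: (is_derive_flat n t).
Qed.

Lemma flat0_le1 t : flat 0 t <= 1.
Proof.
rewrite /flat; case: ifPn => // t0; rewrite expr0 mul1r -expR0 ler_expR.
by rewrite oppr_le0 invr_ge0 ltW.
Qed.

Lemma flat0_cvg1 (t : R) : 0 < t -> flat 0 (k%:R * t - 1) @[k --> \oo] --> (1 : R).
Proof.
move=> t0.
apply/cvgrPdist_le => e e0; near=> k.
have ek : e^-1 <= k%:R * t - 1.
  rewrite lerBrDr -ler_pdivrMr//; near: k; exact: nbhs_infty_ger.
have k0 : 0 < k%:R * t - 1 by apply: lt_le_trans ek; rewrite invr_gt0.
rewrite ger0_norm ?subr_ge0 ?flat0_le1//.
rewrite /flat k0 expr0 mul1r; have := expR_ge1Dx (- (k%:R * t - 1)^-1).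
have : (k%:R * t - 1)^-1 <= e by rewrite -[leRHS]invrK lef_pV2 ?posrE ?invr_gt0.
lra.
Unshelve. all: by end_near. Qed.

End flat.

Section cutoff.
Context {R : realType} {d : nat}.
Local Notation spacetime := (R * 'rV[R]_d)%type.

(** A class that contains the cut-off functions and is stable under directional
    derivatives, to be used with [smooth_coind]. *)
Inductive cutoff_class (k : R) : (spacetime -> R) -> Prop :=
| CutoffMul n phi of smooth phi :
    cutoff_class k (fun z => flat n (k * z.1 - 1) * phi z)
| CutoffAdd f g of cutoff_class k f & cutoff_class k g :
    cutoff_class k (fun z => f z + g z).

Lemma is_derive_flat_time n (k : R) (z v : spacetime) :
  is_derive z v (fun z : spacetime => flat n (k * z.1 - 1))
    (k * v.1 * (flat n.+2 (k * z.1 - 1) - n%:R * flat n.+1 (k * z.1 - 1))).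
Proof.
have E : (fun h : R => h^-1 *: (((fun z : spacetime => flat n (k * z.1 - 1)) \o shift z) (h *: v)
      - flat n (k * z.1 - 1))) =
    (fun h => h^-1 *: ((flat n \o shift (k * z.1 - 1)) (h *: (k * v.1)) - flat n (k * z.1 - 1))).
  apply/funext => h /=; congr (_ *: (flat n _ - _)).
  by rewrite /GRing.scale/=; ring.
have [df vf] := is_derive_flat_dir n (k * v.1) (k * z.1 - 1).
by apply: DeriveDef; [rewrite /derivable E|rewrite /derive E].
Qed.

Lemma smooth_cutoff n (k : R) (phi : spacetime -> R) : smooth phi ->
  smooth (fun z : spacetime => flat n (k * z.1 - 1) * phi z).
Proof.
move=> sphi.
have dmul m f (z v : spacetime) : smooth f ->
    is_derive z v (fun z : spacetime => flat m (k * z.1 - 1) * f z)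
      (flat m.+2 (k * z.1 - 1) * (k * v.1 * f z) +
       flat m.+1 (k * z.1 - 1) * (- (m%:R * k * v.1) * f z) +
       flat m (k * z.1 - 1) * 'D_v f z).
  move=> sf; have df := derivableP (smooth_derivable sf z v).
  have := is_deriveM (is_derive_flat_time m k z v) df.
  set V := (X in is_derive _ _ _ X -> _) => dV.
  apply: is_derive_eq dV _; rewrite /V /GRing.scale/=; ring.
apply: (@smooth_coind _ _ _ (cutoff_class k)); last exact: CutoffMul.
- move=> f; elim=> [m g sg|f1 f2 _ c1 _ c2] z.
    have cf : {for z, continuous (fun z : spacetime => flat m (k * z.1 - 1))}.
      apply: (@continuous_comp _ _ _ (fun z : spacetime => k * z.1 - 1) (flat m)).
        apply: cvgB; last exact: cvg_cst.
        by apply: cvgMr; exact: cvg_fst.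
      exact: continuous_flat.
    exact: (continuousM cf (smooth_continuous sg z)).
  by apply: cvgD; [exact: c1|exact: c2].
- move=> f; elim=> [m g sg|f1 f2 _ c1 _ c2] z v.
    by case: (dmul m g z v sg).
  exact: derivableD.
- have dP f : cutoff_class k f -> forall z v, derivable f z v.
    elim=> [m g sg|f1 f2 _ c1 _ c2] z v; first by case: (dmul m g z v sg).
    exact: derivableD.
  move=> f cf v; elim: cf => [m g sg|f1 f2 h1 c1 h2 c2].
    rewrite (_ : 'D_v _ = (fun z =>
       flat m.+2 (k * z.1 - 1) * (k * v.1 * g z) +
       flat m.+1 (k * z.1 - 1) * (- (m%:R * k * v.1) * g z) +
       flat m (k * z.1 - 1) * 'D_v g z)); last first.
      by apply/funext => z; case: (dmul m g z v sg).
    apply: CutoffAdd; first apply: CutoffAdd; apply: CutoffMul.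
    + exact: (smoothZ (k * v.1) sg).
    + exact: (smoothZ (- (m%:R * k * v.1)) sg).
    + exact: smooth_derive.
  rewrite (_ : 'D_v _ = fun z => 'D_v f1 z + 'D_v f2 z); first exact: CutoffAdd.
  by apply/funext => z; rewrite deriveD//; exact: dP.
Qed.

Lemma derive_cutoff_x n (k : R) (phi : spacetime -> R) (i : 'I_d) z :
  smooth phi ->
  'D_(dir_x i) (fun z : spacetime => flat n (k * z.1 - 1) * phi z) z =
  flat n (k * z.1 - 1) * 'D_(dir_x i) phi z.
Proof.
move=> sphi.
have d1 := is_derive_flat_time n k z (dir_x i).
have d2 := derivableP (smooth_derivable sphi z (dir_x i)).
have [_ ->] := is_deriveM d1 d2.
by rewrite /= mulr0 mul0r scaler0 addr0.
Qed.

(** The cutoff vanishes for [t <= 1 / k]. *)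
Lemma test_fun_cutoff n (k T : R) (phi : spacetime -> R) : 0 < k ->
  test_fun (past_slab T) phi ->
  test_fun (open_slab T) (fun z : spacetime => flat n (k * z.1 - 1) * phi z).
Proof.
move=> k0 [sphi cphi phiT].
have cge : closed [set z : spacetime | k^-1 <= z.1].
  rewrite (_ : mkset _ = fst @^-1` `[k^-1, +oo[%classic); last first.
    by apply/seteqP; split => z /=; rewrite in_itv/= andbT.
  apply: preimage_closed; last exact: interval_closed.
  by move=> z _; exact: cvg_fst.
have sub : supp (fun z : spacetime => flat n (k * z.1 - 1) * phi z) `<=`
    supp phi `&` [set z | k^-1 <= z.1].
  apply: supp_sub => [|z nz]; first by apply: closedI => //; exact: closed_closure.
  have [kz|kz] := leP (k * z.1 - 1) 0; first by rewrite flat_le0// mul0r.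
  rewrite (@supp_zero _ _ _ phi) ?mulr0// => hz; apply: nz; split => //=.
  by rewrite -[leLHS]mulr1 ler_pdivrMl//; lra.
split; first exact: smooth_cutoff.
  apply: subclosed_compact cphi _; first exact: closed_closure.
  by move=> z /sub[].
move=> z /sub[/phiT[+ _] /= kz]; rewrite /= in_itv/= => zT.
split => //=; rewrite in_itv/= zT andbT; apply: lt_le_trans kz.
by rewrite invr_gt0.
Qed.

Local Notation nu := (@lebesgue_spacetime R d).

Lemma initial_slice_negligible : nu ([set 0] `*` setT) = 0%E.
Proof.
rewrite /lebesgue_spacetime product_measure1E//.
exact (etrans (congr1 (fun x => x * _)%E (lebesgue_measure_set1 0)) (mul0e _)).
Qed.

(** Being divergence free on [0 < t < T] extends to test functions that do not
    vanish at [t = 0]: cut them off by [flat 0 (k t - 1)], which tends to [1]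
    for every [t > 0] as [k] tends to infinity. *)
Lemma div_free_past (T : R) (b : spacetime -> 'rV[R]_d) (chi : spacetime -> R) :
  L1loc_vec (slab T) b -> div_free T b -> test_fun (past_slab T) chi ->
  \int[nu]_(z in slab T) dot (b z) (grad_x chi z) = 0.
Proof.
move=> Lb divb tchi; have schi := test_fun_smooth tchi.
(* [th k] vanishes for [t <= 1 / (k + 1)]; [k.+1] keeps the scale positive. *)
pose th (k : nat) (z : spacetime) : R := flat 0 (k.+1%:R * z.1 - 1).
pose f (z : spacetime) := dot (b z) (grad_x chi z).
have int_f : nu.-integrable (slab T) (EFin \o f).
  exact: (integrable_dot Lb (test_fun_grad_x tchi)).
have th_int k : \int[nu]_(z in slab T) (th k z * f z) = 0.
  have k0 : 0 < k.+1%:R :> R by rewrite ltr0n.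
  have tc := test_fun_cutoff 0 k0 tchi.
  have E z : dot (b z) (grad_x (fun z : spacetime => th k z * chi z) z) = th k z * f z.
    rewrite /f /dot mulr_sumr; apply: eq_bigr => i _; rewrite !mxE.
    by rewrite derive_cutoff_x// mulrCA.
  have := divb _ tc; rewrite (Rintegral_open_slab (f := fun z => dot (b z) _)).
    by move=> <-; apply: eq_Rintegral => z _; rewrite -E.
  move=> z _ nz; apply: big1 => i _; rewrite mxE.
  rewrite derive_supp ?mulr0// => hz; apply: nz.
  by case: tc => _ _; exact.
have mth k : measurable_fun setT (th k).
  apply: continuous_measurable_spacetime => z.
  apply: (@continuous_comp _ _ _ (fun z : spacetime => k.+1%:R * z.1 - 1) (flat 0)).
    apply: cvgB; last exact: cvg_cst.
    by apply: cvgMr; exact: cvg_fst.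
  exact: continuous_flat.
have mthD k : measurable_fun (slab T) (th k) by exact: measurable_funTS.
have mf : measurable_fun (slab T) f.
  by have /integrableP[/measurable_EFinP] := int_f.
have mslab := @measurable_slab R d T.
have th_cvg : {ae nu, forall z, slab T z ->
    (th k z * f z)%:E @[k --> \oo] --> (EFin \o f) z}.
  exists ([set 0] `*` setT); split.
  - exact: measurableX.
  - exact: initial_slice_negligible.
  move=> z /= nz; split => //=; apply: contrapT => z0; apply: nz => -[+ _].
  rewrite /= in_itv/= => /andP[zge0 _].
  have zgt0 : 0 < z.1 by rewrite lt_neqAle zge0 andbT eq_sym; apply/eqP.
  apply: cvg_EFin; first exact: nearW.
  rewrite -[X in _ --> X]mul1r; apply: cvgMl.
  by have := flat0_cvg1 zgt0; rewrite -(cvg_shiftS (fun k => flat 0 (k%:R * z.1 - 1))).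
have [] := @dominated_convergence _ _ _ nu (slab T) mslab
  (fun k z => (th k z * f z)%:E) (EFin \o f) (fun z => `|f z|%:E).
- move=> k; apply/measurable_EFinP/measurable_funM => //.
  exact: mthD.
- exact/measurable_EFinP.
- exact: th_cvg.
- exact: (integrable_norm int_f).
- apply: aeW => z k _; rewrite /= lee_fin normrM ger0_norm ?flat_ge0//.
  by rewrite ler_piMl// flat0_le1.
move=> _ _; rewrite -[X in _ --> X]fineK; last exact: integrable_fin_num.
move=> /fine_cvg; rewrite (_ : fine \o _ = cst 0); last first.
  by apply/funext => k; exact: th_int.
by move=> /(cvg_unique (@norm_hausdorff _ R) (cvg_cst 0)); exact: esym.
Qed.

End cutoff.

Local Opaque derive pair_integral Rintegral dir_t dir_x.

(** * Rigidity of the induction equation *)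

Section decaying.
Context {R : realType} {d : nat} (T : R).
Local Notation spacetime := (R * 'rV[R]_d)%type.
Context {disp : measure_display} {Y : measurableType disp}.
Context (la : {measure set Y -> \bar R}) (D : set Y) (iota : Y -> spacetime).
Implicit Types f g : Y -> R.

(** This is all that the rigidity argument retains of the integrability
    assumptions.  The exponent, which differs from one coefficient to the other,
    no longer appears. *)
Definition decaying f : Prop :=
  forall (phi : spacetime -> R) (x : nat -> 'rV[R]_d),
    test_fun (past_slab T) phi -> escaping x ->
    pair_integral la D iota f (0, x n) phi @[n --> \oo] --> 0.

Lemma decaying_lin a c f g :
  loc_integrable la T D iota f -> loc_integrable la T D iota g ->
  decaying f -> decaying g -> decaying (fun y => a * f y + c * g y).
Proof.
move=> Lf Lg df dg phi x tphi xoo.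
rewrite (_ : (fun n => _) = (fun n =>
    a * pair_integral la D iota f (0, x n) phi +
    c * pair_integral la D iota g (0, x n) phi)); last first.
  apply/funext => n; pose tau z := phi (z + (0, x n)).
  have ttau : test_fun (past_slab T) tau.
    apply: (test_fun_translate tphi) => z [_ ->] hz.
    by case: tphi => _ _ /(_ _ hz) [+ _]; rewrite /= addr0.
  rewrite !(pair_integral_translate _ _ _ _ (erefl tau)) !pair_integral0E.
  have mD := loc_measurable_dom Lf.
  have intf := test_fun_integrable Lf ttau.
  have intg := test_fun_integrable Lg ttau.
  rewrite -(RintegralZl a mD intf) -(RintegralZl c mD intg).
  rewrite -(RintegralD mD (integrable_mull mD a intf) (integrable_mull mD c intg)).
  by apply: eq_Rintegral => y _; ring.
have h : a * pair_integral la D iota f (0, x n) phi +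
    c * pair_integral la D iota g (0, x n) phi @[n --> \oo] --> a * 0 + c * 0.
  by apply: cvgD; apply: cvgMr; [exact: df|exact: dg].
by rewrite !mulr0 addr0 in h.
Qed.

End decaying.

Section rigidity.
Context {R : realType} {d : nat} (T : R).
Local Notation spacetime := (R * 'rV[R]_d)%type.
Local Notation nu := (@lebesgue_spacetime R d).
Local Notation mu := (lebesgue_measure_rV d).
Implicit Types (phi chi : spacetime -> R) (zeta : spacetime -> 'rV[R]_d).

Lemma derive_sum_test Omega (f : 'I_d -> spacetime -> R) (v z : spacetime) :
  (forall i, test_fun Omega (f i)) ->
  'D_v (fun z => \sum_i f i z) z = \sum_i 'D_v (f i) z.
Proof.
move=> tf; have df i : derivable (f i) z v.
  exact: smooth_derivable (test_fun_smooth (tf i)) _ _.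
have -> : (fun z => \sum_i f i z) = \sum_i f i by apply/funext => y; rewrite fct_sumE.
exact: derive_sum.
Qed.

(** The field [Delta phi e_j - grad (d_j phi)], which is divergence free. *)
Definition curl_field (j : 'I_d) phi (z : spacetime) : 'rV[R]_d :=
  \row_k ((k == j)%:R * laplacian phi z +
          (-1) * 'D_(dir_x k) ('D_(dir_x j) phi) z).

Lemma curl_field_coord j phi k : (fun z => curl_field j phi z 0 k) =
  (fun z => (k == j)%:R * laplacian phi z +
            (-1) * 'D_(dir_x k) ('D_(dir_x j) phi) z).
Proof. by apply/funext => z; rewrite mxE. Qed.

Lemma test_fun_curl_field Omega j phi : test_fun Omega phi ->
  test_fun Omega (curl_field j phi).
Proof.
move=> tphi; have tl := test_fun_laplacian tphi.
have td v w := test_fun_derive v (test_fun_derive w tphi).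
apply: (test_fun_row tphi) => [k|k z nz].
  rewrite curl_field_coord; apply: (@test_fun_smooth _ _ _ Omega).
  exact: (test_funD (test_funZ _ tl) (test_funZ _ (td _ _))).
have nD v : ~ supp ('D_v phi) z.
  move=> hz; apply: nz; apply: (supp_sub _ _ hz) => [|y ny].
    exact: closed_closure.
  exact: derive_supp.
rewrite mxE (derive_supp _ (nD _)) /laplacian big1 ?mulr0 ?addr0// => i _.
exact: derive_supp (nD _).
Qed.

Lemma div_curl_field Omega j phi z : test_fun Omega phi ->
  div_x (curl_field j phi) z = 0.
Proof.
move=> tphi; have sphi := test_fun_smooth tphi.
have td v w := test_fun_derive v (test_fun_derive w tphi).
have tl := test_fun_laplacian tphi.
have E k : jac_x (curl_field j phi) z k k =
    (k == j)%:R * 'D_(dir_x k) (laplacian phi) z -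
    'D_(dir_x k) ('D_(dir_x k) ('D_(dir_x j) phi)) z.
  apply: etrans (jac_x_coord _ _ _ (test_fun_curl_field j tphi)) _.
  apply: etrans (congr1 (fun f => 'D_(dir_x k) f z) (curl_field_coord j phi k)) _.
  have d1 := smooth_derivable (test_fun_smooth tl) z (dir_x k).
  have d2 := smooth_derivable (test_fun_smooth (td (dir_x k) (dir_x j))) z (dir_x k).
  apply: etrans (deriveD (derivableZ d1) (derivableZ d2)) _.
  by rewrite (deriveZ _ d1) (deriveZ _ d2) scaleN1r.
rewrite /div_x /mxtrace (eq_bigr _ (fun k _ => E k)) big_split/= sumrN.
have -> : \sum_k (k == j)%:R * 'D_(dir_x k) (laplacian phi) z =
    'D_(dir_x j) (laplacian phi) z.
  rewrite (bigD1 j)//= eqxx mul1r big1 ?addr0// => k /negPf ->.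
  by rewrite mul0r.
have -> : 'D_(dir_x j) (laplacian phi) z =
    \sum_k 'D_(dir_x j) ('D_(dir_x k) ('D_(dir_x k) phi)) z.
  exact: derive_sum_test (fun k => td (dir_x k) (dir_x k)).
apply/eqP; rewrite subr_eq0; apply/eqP; apply: eq_bigr => k _.
apply: etrans (congr1 (@^~ z) (derive_comm (dir_x j) (dir_x k) (smooth_derive (dir_x k) sphi))) _.
exact (congr1 (fun f => 'D_(dir_x k) f z) (derive_comm (dir_x j) (dir_x k) sphi)).
Qed.

Variables (b : spacetime -> 'rV[R]_d) (A : spacetime -> 'M[R]_d).
Variable b0 : 'rV[R]_d -> 'rV[R]_d.
Hypothesis Lb : L1loc_vec (slab T) b.
Hypothesis LA : L1loc_mx (slab T) A.
Hypothesis Lb0 : L1loc_space_vec b0.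
Hypothesis antisymA : forall z, (A z)^T = - A z.
Hypothesis divb0 : div_free_space b0.
Hypothesis divb : div_free T b.
Hypothesis form_div_free : forall zeta, test_fun (past_slab T) zeta ->
  (forall z, 0 <= z.1 -> div_x zeta z = 0) -> magnetic_form T b A b0 zeta = 0.

Local Notation component := (component T b A b0).

Let pt j := pair_integral_is_pairing (loc_integrable_slab (Lb j)).
Let px j i := pair_integral_is_pairing (loc_integrable_slab (LA i j)).
Let p0 j := pair_integral_is_pairing (loc_integrable_space T (Lb0 j)).

(** [Delta phi e_j] is the sum of a gradient and of a divergence-free field,
    and the equation holds against both. *)
Lemma component_laplacian j phi : test_fun (past_slab T) phi ->
  component j (laplacian phi) 0 = 0.
Proof.
move=> tphi; have td v w := test_fun_derive v (test_fun_derive w tphi).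
have tl := test_fun_laplacian tphi.
have grad0 : \sum_k component k ('D_(dir_x k) ('D_(dir_x j) phi)) 0 = 0.
  have tj := test_fun_derive (dir_x j) tphi.
  have := magnetic_formE Lb LA Lb0 (test_fun_grad_x tj).
  rewrite (magnetic_form_grad b antisymA divb0 tj).
  rewrite (div_free_past Lb divb (test_fun_derive dir_t tj)) => Z.
  apply: etrans (esym Z); apply: eq_bigr => k _.
  exact (congr1 (fun f => component k f 0) (esym (grad_x_coord _ _))).
have := form_div_free (test_fun_curl_field j tphi) (fun z _ => div_curl_field j z tphi).
rewrite (magnetic_formE Lb LA Lb0 (test_fun_curl_field j tphi)).
have E k : component k (fun z => curl_field j phi z 0 k) 0 =
    (k == j)%:R * component k (laplacian phi) 0 -
    component k ('D_(dir_x k) ('D_(dir_x j) phi)) 0.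
  apply: etrans (congr1 (fun f => component k f 0) (curl_field_coord j phi k)) _.
  apply: etrans (weak_formD (pt k) (px k) (p0 k) (test_funZ _ tl) (test_funZ _ (td _ _))) _.
  rewrite (weak_formZ (pt k) (px k) (p0 k) _ tl).
  by rewrite (weak_formZ (pt k) (px k) (p0 k) _ (td _ _)) mulN1r.
rewrite (eq_bigr _ (fun k _ => E k)) big_split/= sumrN grad0 subr0.
rewrite (bigD1 j)//= eqxx mul1r big1 ?addr0// => k /negPf ->.
by rewrite mul0r.
Qed.

Hypothesis d0 : (0 < d)%N.
Hypothesis decb : forall j, decaying T nu (slab T) id (fun z => b z 0 j).
Hypothesis decA : forall i j, decaying T nu (slab T) id (fun z => A z i j).
Hypothesis decb0 : forall j,
  decaying T mu setT (fun x => (0, x)) (fun x => b0 x 0 j).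

Lemma component_decay j phi (x : nat -> 'rV[R]_d) :
  test_fun (past_slab T) phi -> escaping x ->
  component j phi (0, x n) @[n --> \oo] --> 0.
Proof.
move=> tphi xoo; have td v := test_fun_derive v tphi.
have S : \sum_i pair_integral nu (slab T) id (fun z => A z i j) (0, x n)
    ('D_(dir_x i) phi) @[n --> \oo] --> \sum_(i < d) (0 : R).
  apply: cvg_big => [|i _]; first exact: add_continuous.
  have D := decA i j (td (dir_x i)) xoo; exact D.
rewrite big1// in S; have Db := decb j (td dir_t) xoo; have D0 := decb0 j tphi xoo.
rewrite -[X in _ --> X](addr0 0) -[X in _ --> X + _](addr0 0).
exact (cvgD (cvgD Db S) D0).
Qed.

(** As a function of the translation [y], the component is harmonic, since its
    Laplacian is the component of the Laplacian of [phi], and it tends to [0] at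
    infinity. *)
Lemma component_le0 j phi : test_fun (past_slab T) phi -> component j phi 0 <= 0.
Proof.
move=> tphi; have td v := test_fun_derive v tphi.
pose g (y : 'rV[R]_d) := component j phi (0, y).
apply: (@harmonic_le0 R d g (fun i y => component j ('D_(dir_x i) phi) (0, y))
  (fun i y => component j ('D_(dir_x i) ('D_(dir_x i) phi)) (0, y)) d0 _ _ _ _ _ 0).
- exact: (weak_form_continuous (pt j) (px j) (p0 j) tphi).
- by move=> i y s; exact: (weak_form_derive (pt j) (px j) (p0 j) y i s tphi).
- by move=> i y s; exact: (weak_form_derive (pt j) (px j) (p0 j) y i s (td (dir_x i))).
- move=> y; pose tau z := phi (z + (0, y)).
  have ttau : test_fun (past_slab T) tau.
    apply: (test_fun_translate tphi) => z [_ ->] hz.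
    by case: tphi => _ _ /(_ _ hz) [+ _]; rewrite /= addr0.
  apply: etrans (component_laplacian j ttau).
  have tdt v w := test_fun_derive v (test_fun_derive w ttau).
  refine (etrans _ (esym (weak_form_sum (pt j) (px j) (p0 j)
    (fun i => tdt (dir_x i) (dir_x i))))).
  apply: eq_bigr => i _; apply: etrans (weak_form_translate (pt j) (px j) (p0 j) _ _) _.
  refine (congr1 (fun f => component j f 0) (esym _)).
  exact (etrans (congr1 (fun f => 'D_(dir_x i) f) (derive_translateE phi _ (dir_x i)))
    (derive_translateE ('D_(dir_x i) phi) _ (dir_x i))).
- by move=> x xoo; exact: component_decay.
Qed.

(** Each component is nonpositive on every test function, hence also
    nonnegative by applying this to the opposite test function. *)
Lemma induction_rigidity zeta : test_fun (past_slab T) zeta ->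
  magnetic_form T b A b0 zeta = 0.
Proof.
move=> tz; rewrite (magnetic_formE Lb LA Lb0 tz) big1// => j _.
have tj := test_fun_coord j tz.
apply/eqP; rewrite eq_le component_le0//=.
have Z := weak_formZ (pt j) (px j) (p0 j) (-1) tj.
have := component_le0 j (test_funZ (-1) tj); rewrite [X in X <= 0]Z.
by rewrite mulN1r oppr_le0.
Qed.

End rigidity.

Local Transparent derive pair_integral Rintegral dir_t dir_x.

(** * Linear combinations *)

Lemma Rintegral_lin (R : realType) disp (Y : measurableType disp)
    (la : {measure set Y -> \bar R}) (D : set Y) (a c : R) (f g : Y -> R) :
  measurable D -> la.-integrable D (EFin \o f) -> la.-integrable D (EFin \o g) ->
  \int[la]_(y in D) (a * f y + c * g y) =
  a * \int[la]_(y in D) f y + c * \int[la]_(y in D) g y.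
Proof.
move=> mD intf intg; rewrite -(RintegralZl a mD intf) -(RintegralZl c mD intg).
by rewrite -(RintegralD mD (integrable_mull mD a intf) (integrable_mull mD c intg)).
Qed.

Section linear_combinations.
Context {R : realType} {d : nat} (T : R).
Local Notation spacetime := (R * 'rV[R]_d)%type.
Local Notation nu := (@lebesgue_spacetime R d).
Local Notation mu := (lebesgue_measure_rV d).
Implicit Types (f g phi : spacetime -> R) (u v psi : spacetime -> 'rV[R]_d).
Implicit Types (P Q : functional R d) (Omega : set spacetime).

Lemma L1loc_lin a c f g : L1loc (slab T) f -> L1loc (slab T) g ->
  L1loc (slab T) (fun z => a * f z + c * g z).
Proof. by move=> Lf Lg; apply: L1locD; exact: L1locZ. Qed.

(** A compact set of R^d is the slice at [t = 0] of a compact set of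
    space-time. *)
Lemma compact_measurable_rV (K : set 'rV[R]_d) : compact K -> measurable K.
Proof.
move=> cK; have c0K : compact ([set (0 : R)] `*` K).
  by apply: compact_setX => //; exact: compact_set1.
have := @measurable_initial R d measurableT _ (compact_measurable_spacetime c0K).
rewrite setTI; congr measurable.
by apply/seteqP; split => [x []|x Kx].
Qed.

Lemma L1loc_space_lin a c (f g : 'rV[R]_d -> R) :
  L1loc_space f -> L1loc_space g -> L1loc_space (fun x => a * f x + c * g x).
Proof.
move=> [mf Lf] [mg Lg]; split.
  by apply: measurable_funD; apply: measurable_funM.
move=> K cK; have mK := compact_measurable_rV cK.
apply: (@integrable_addr _ _ _ mu K mK); apply: (@integrable_mull _ _ _ mu K mK).
  exact: Lf.
exact: Lg.
Qed.

Lemma schwartz_bound_le N N' phi M : (N <= N')%N ->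
  schwartz_bound N' phi M -> schwartz_bound N phi M.
Proof.
move=> NN' bM s sN z; apply: le_trans (bM s (leq_trans sN NN') z).
by rewrite ler_wpM2r// ler_weXn2l// lerDl.
Qed.

Lemma tempered_lin Omega a c P Q S : tempered Omega P -> tempered Omega Q ->
  (forall phi, test_fun Omega phi -> S phi = a * P phi + c * Q phi) ->
  tempered Omega S.
Proof.
move=> [linP [N1 [K1 bP]]] [linQ [N2 [K2 bQ]]] SE; split.
  move=> k phi1 phi2 t1 t2; rewrite SE; last by apply: test_funD => //; exact: test_funZ.
  by rewrite !SE// linP// linQ//; ring.
exists (maxn N1 N2), (`|a| * K1 + `|c| * K2) => phi M tphi bM.
rewrite SE//; apply: le_trans (ler_normD _ _) _; rewrite !normrM mulrDl -!mulrA.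
apply: lerD; apply: ler_wpM2l => //.
  by apply: bP => //; exact: schwartz_bound_le (leq_maxl _ _) bM.
by apply: bQ => //; exact: schwartz_bound_le (leq_maxr _ _) bM.
Qed.

Lemma tempered_fun_lin a c f g : L1loc (slab T) f -> L1loc (slab T) g ->
  tempered_fun T f -> tempered_fun T g ->
  tempered_fun T (fun z => a * f z + c * g z).
Proof.
move=> Lf Lg tf tg; apply: (@tempered_lin _ a c _ _ _ tf tg) => phi tphi.
have mslab := @measurable_slab R d T.
have intf := integrable_slab_test Lf tphi; have intg := integrable_slab_test Lg tphi.
have E := @Rintegral_lin _ _ _ nu _ a c _ _ mslab intf intg.
rewrite /reg_dist; refine (etrans _ E).
by apply: eq_Rintegral => z _; ring.
Qed.

Lemma dotDl a c (x y w : 'rV[R]_d) :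
  dot (a *: x + c *: y) w = a * dot x w + c * dot y w.
Proof.
rewrite /dot !mulr_sumr -big_split/=; apply: eq_bigr => i _.
by rewrite !mxE; ring.
Qed.

Lemma ddotDl a (A B W : 'M[R]_d) : ddot (A + a *: B) W = ddot A W + a * ddot B W.
Proof.
rewrite /ddot mulr_sumr -big_split/=; apply: eq_bigr => i _.
rewrite mulr_sumr -big_split/=; apply: eq_bigr => j _.
by rewrite !mxE; ring.
Qed.

Lemma div_free_slab u phi : test_fun (open_slab T) phi ->
  \int[nu]_(z in open_slab T) dot (u z) (grad_x phi z) =
  \int[nu]_(z in slab T) dot (u z) (grad_x phi z).
Proof.
move=> [_ _ suppT].
rewrite (Rintegral_open_slab (f := fun z => dot (u z) (grad_x phi z)))// => z _ nz.
apply: big1 => k _; rewrite mxE.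
have D0 : 'D_(dir_x k) phi z = 0 by apply: derive_supp => /suppT.
exact (etrans (congr1 ( *%R _) D0) (mulr0 _)).
Qed.

Lemma test_fun_past (W : normedModType R) (psi : spacetime -> W) :
  test_fun (open_slab T) psi -> test_fun (past_slab T) psi.
Proof.
by apply: test_funS => z [+ _]; rewrite /= !in_itv/= => /andP[_ ?]; split.
Qed.

Lemma div_free_lin a c u v : L1loc_vec (slab T) u -> L1loc_vec (slab T) v ->
  div_free T u -> div_free T v -> div_free T (fun z => a *: u z + c *: v z).
Proof.
move=> Lu Lv du dv phi tphi; rewrite div_free_slab//.
have mslab := @measurable_slab R d T.
have tg := test_fun_grad_x (test_fun_past tphi).
have intu := integrable_dot Lu tg; have intv := integrable_dot Lv tg.
under eq_Rintegral do rewrite dotDl.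
apply: etrans (@Rintegral_lin _ _ _ nu _ a c _ _ mslab intu intv) _.
by rewrite -!div_free_slab// du// dv// !mulr0 addr0.
Qed.

(** The counterpart of [test_fun_integrable] for test functions that live on R^d
    only. *)
Lemma integrable_space_test (f phi : 'rV[R]_d -> R) :
  L1loc_space f -> test_fun setT phi ->
  mu.-integrable setT (EFin \o (fun x => f x * phi x)).
Proof.
move=> [mf Lf] tphi; have [M M0 phiM] := test_fun_bounded tphi.
have [sphi cphi _] := tphi; have mK := compact_measurable_rV cphi.
have mphi : measurable_fun setT phi.
  have -> : phi = (phi \o snd) \o (fun x => (0 : R, x)) by [].
  apply: measurableT_comp (@measurable_initial R d).
  apply: continuous_measurable_spacetime => z.
  by apply: continuous_comp; [exact: cvg_snd|exact: smooth_continuous].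
have int_K : mu.-integrable (supp phi) (EFin \o (fun x => f x * phi x)).
  apply: (integrableMl mK (Lf _ cphi)); first exact: measurable_funTS.
  exists M; split => [|x Mx y _ /=]; first exact: num_real.
  exact: le_trans (phiM y) (ltW Mx).
rewrite (integrable_mkcond _ mK) in int_K.
apply: eq_integrable int_K => // x _; rewrite patchE; case: ifPn => // /negP nx.
by rewrite /= (supp_zero (f := phi)) ?mulr0// => hx; apply: nx; rewrite inE.
Qed.

Lemma div_free_space_lin a c (u v : 'rV[R]_d -> 'rV[R]_d) :
  L1loc_space_vec u -> L1loc_space_vec v ->
  div_free_space u -> div_free_space v ->
  div_free_space (fun x => a *: u x + c *: v x).
Proof.
move=> Lu Lv du dv phi tphi.
have int w : L1loc_space_vec w ->
    mu.-integrable setT (EFin \o (fun x => dot (w x) (grad phi x))).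
  move=> Lw; apply: integrable_fin_sum => // i.
  rewrite (_ : (fun x => _) = (fun x => w x 0 i * 'D_(delta_mx 0 i) phi x)).
    by apply: integrable_space_test => //; exact: test_fun_derive.
  by apply/funext => x; rewrite mxE.
under eq_Rintegral do rewrite dotDl.
have mT := @measurableT _ 'rV[R]_d.
apply: etrans (@Rintegral_lin _ _ _ mu _ a c _ _ mT (int _ Lu) (int _ Lv)) _.
by rewrite du// dv// !mulr0 addr0.
Qed.

Lemma Rintegral_dot_initial_lin a c (u0 v0 : 'rV[R]_d -> 'rV[R]_d) psi :
  L1loc_space_vec u0 -> L1loc_space_vec v0 -> test_fun (past_slab T) psi ->
  \int[mu]_x dot (a *: u0 x + c *: v0 x) (psi (0, x)) =
  a * \int[mu]_x dot (u0 x) (psi (0, x)) + c * \int[mu]_x dot (v0 x) (psi (0, x)).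
Proof.
move=> Lu Lv tpsi.
have int w : L1loc_space_vec w ->
    mu.-integrable setT (EFin \o (fun x => dot (w x) (psi (0, x)))).
  move=> Lw; apply: integrable_fin_sum => // i.
  exact: (test_fun_integrable (loc_integrable_space T (Lw i)) (test_fun_coord i tpsi)).
under eq_Rintegral do rewrite dotDl.
have mT := @measurableT _ 'rV[R]_d.
exact: (@Rintegral_lin _ _ _ mu _ a c _ _ mT (int _ Lu) (int _ Lv)).
Qed.

Lemma initial_open_slab (u0 : 'rV[R]_d -> 'rV[R]_d) psi :
  test_fun (open_slab T) psi -> \int[mu]_x dot (u0 x) (psi (0, x)) = 0.
Proof.
move=> [_ _ suppT]; rewrite -[RHS](mul0r (fine (mu setT))).
rewrite -(@Rintegral_cst _ _ _ mu _ (@measurableT _ _)); apply: eq_Rintegral => x _.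
rewrite (supp_zero (f := psi)); last first.
  by move=> /suppT[]; rewrite /= in_itv/= ltxx.
by apply: big1 => i _; rewrite mxE mulr0.
Qed.

Lemma L1loc0 Omega : L1loc Omega (fun _ => 0).
Proof. by split => [|K _ _]; [exact: measurable_cst|exact: integrable0]. Qed.

Lemma reg_dist0 Omega phi : measurable Omega -> reg_dist Omega (fun=> 0) phi = 0.
Proof.
move=> mO; rewrite /reg_dist; under eq_Rintegral do rewrite mul0r.
by rewrite (@Rintegral_cst _ _ _ nu _ mO) mul0r.
Qed.

Lemma measurable_open_slab : measurable (open_slab T : set spacetime).
Proof. by apply: measurableX => //; exact: measurable_itv. Qed.

End linear_combinations.

(** * Elsasser variables *)

Section elsasser.
Context {R : realType} {d : nat} (C : 'M[R]_d) (T : R).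
Local Notation spacetime := (R * 'rV[R]_d)%type.
Local Notation nu := (@lebesgue_spacetime R d).
Local Notation mu := (lebesgue_measure_rV d).

Lemma tensE (u v : 'rV[R]_d) i j : tens u v i j = u 0 i * v 0 j.
Proof. by rewrite /tens !mxE big_ord1 !mxE. Qed.

Lemma mhd_fluxE (u b : spacetime -> 'rV[R]_d) z i j :
  mhd_flux u b z i j = u z 0 i * u z 0 j - b z 0 i * b z 0 j.
Proof. by rewrite /mhd_flux mxE [X in _ + X]mxE !tensE. Qed.

Lemma induction_fluxE (u b : spacetime -> 'rV[R]_d) z i j :
  induction_flux u b z i j = u z 0 i * b z 0 j - b z 0 i * u z 0 j.
Proof. by rewrite /induction_flux mxE [X in _ + X]mxE !tensE. Qed.

Lemma induction_flux_antisym (u b : spacetime -> 'rV[R]_d) z :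
  (induction_flux u b z)^T = - induction_flux u b z.
Proof.
by apply/matrixP => i j; rewrite mxE [RHS]mxE !induction_fluxE; ring.
Qed.

Lemma mulmxvE (A : 'M[R]_d) (x : 'rV[R]_d) i :
  mulmxv A x 0 i = \sum_k A i k * x 0 k.
Proof. by rewrite /mulmxv mxE; apply: eq_bigr => k _; rewrite mxE mulrC. Qed.

Section momentum.
Variables (rho : spacetime -> R) (u b : spacetime -> 'rV[R]_d).
Variables (u0 b0 : 'rV[R]_d -> 'rV[R]_d).
Hypothesis Lu : L1loc_vec (slab T) u.
Hypothesis Lb : L1loc_vec (slab T) b.
Hypothesis Lflux : L1loc_mx (slab T) (mhd_flux u b).
Hypothesis Linduction : L1loc_mx (slab T) (induction_flux u b).
Hypothesis Lru : L1loc_vec (slab T) (fun z => rho z *: u z).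
Implicit Types psi : spacetime -> 'rV[R]_d.

Definition induction_momentum psi : R :=
  \int[nu]_(z in slab T)
     (dot (b z) ('D_dir_t psi z) + ddot (induction_flux u b z) (jac_x psi z)).

Lemma L1loc_coriolis : L1loc_vec (slab T) (fun z => rho z *: mulmxv C (u z)).
Proof.
move=> i; rewrite (_ : (fun z => _) =
    (fun z => \sum_k C i k * (rho z *: u z) 0 k)); last first.
  apply/funext => z; rewrite mxE mulmxvE mulr_sumr; apply: eq_bigr => k _.
  by rewrite mxE mulrCA.
by apply: L1loc_sum => k; apply: L1locZ; exact: Lru.
Qed.

(** With [e = 1] or [e = - 1], the flux of [u + e b] transported by [u - e b]
    is the sum of the momentum flux and of [e] times the induction flux. *)
Lemma elsasser_momentumE (e : R) (alpha beta : spacetime -> 'rV[R]_d) psi :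
  e * e = 1 -> (forall z, alpha z = u z + e *: b z) ->
  (forall z, beta z = u z - e *: b z) -> test_fun (past_slab T) psi ->
  elsasser_momentum C T rho alpha beta psi =
  mhd_momentum C T rho u b psi + e * induction_momentum psi.
Proof.
move=> e1 aE bE tpsi; have mslab := @measurable_slab R d T.
have tDt := test_fun_derive (dir_t : spacetime) tpsi.
have addI := @integrable_addr _ _ _ nu _ mslab.
have int1 := addI _ _ (addI _ _ (integrable_dot Lu tDt) (integrable_ddot Lflux tpsi))
  (@integrable_mull _ _ _ nu _ mslab (-1) _ (integrable_dot L1loc_coriolis tpsi)).
have int2 := addI _ _ (integrable_dot Lb tDt) (integrable_ddot Linduction tpsi).
(* The Coriolis term belongs to the momentum part: [alpha + beta = 2 u]. *)
have E := @Rintegral_lin _ _ _ nu _ 1 e _ _ mslab int1 int2.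
rewrite mul1r in E; refine (etrans (etrans _ E) _); last first.
  by congr (_ + _); apply: eq_Rintegral => z _; rewrite mulN1r.
apply: eq_Rintegral => z _.
have -> : tens (beta z) (alpha z) = mhd_flux u b z + e *: induction_flux u b z.
  apply/matrixP => i j; rewrite [RHS]mxE [X in _ + X]mxE mhd_fluxE induction_fluxE tensE.
  rewrite aE bE !mxE -[b z 0 i * b z 0 j]mul1r -e1; ring.
have -> : (2^-1 * rho z) *: mulmxv C (alpha z + beta z) = rho z *: mulmxv C (u z).
  have -> : alpha z + beta z = 2 *: u z by rewrite aE bE addrCA addrK scaler_nat mulr2n.
  rewrite /mulmxv -scalemxAl scalerA; congr (_ *: _).
  by field.
have dotE w : dot (alpha z) w = dot (u z) w + e * dot (b z) w.
  by rewrite aE -{1}[u z]scale1r dotDl mul1r.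
by rewrite ddotDl dotE; ring.
Qed.

Hypothesis Lu0 : L1loc_space_vec u0.
Hypothesis Lb0 : L1loc_space_vec b0.

(** The same identity with the initial data; [e = 1] gives the equation on
    [alpha] and [e = - 1] the equation on [beta]. *)
Lemma elsasser_weakE (e : R) (alpha beta : spacetime -> 'rV[R]_d)
    (alpha0 : 'rV[R]_d -> 'rV[R]_d) psi :
  e * e = 1 -> (forall z, alpha z = u z + e *: b z) ->
  (forall z, beta z = u z - e *: b z) ->
  (forall x, alpha0 x = u0 x + e *: b0 x) -> test_fun (past_slab T) psi ->
  elsasser_momentum C T rho alpha beta psi + \int[mu]_x dot (alpha0 x) (psi (0, x)) =
  mhd_momentum C T rho u b psi + \int[mu]_x dot (u0 x) (psi (0, x)) +
  e * magnetic_form T b (induction_flux u b) b0 psi.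
Proof.
move=> e1 aE bE a0E tpsi; rewrite (elsasser_momentumE e1 aE bE tpsi).
have -> : \int[mu]_x dot (alpha0 x) (psi (0, x)) =
    1 * \int[mu]_x dot (u0 x) (psi (0, x)) + e * \int[mu]_x dot (b0 x) (psi (0, x)).
  apply: etrans (Rintegral_dot_initial_lin 1 e Lu0 Lb0 tpsi).
  by apply: eq_Rintegral => x _; rewrite a0E scale1r.
by rewrite mul1r /magnetic_form /induction_momentum mulrDr addrACA.
Qed.

(** On test functions that vanish near [t = 0], the initial datum disappears. *)
Lemma elsasser_momentum_open (e : R) (alpha beta : spacetime -> 'rV[R]_d) psi :
  e * e = 1 -> (forall z, alpha z = u z + e *: b z) ->
  (forall z, beta z = u z - e *: b z) -> test_fun (open_slab T) psi ->
  magnetic_form T b (induction_flux u b) b0 psi = 0 ->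
  elsasser_momentum C T rho alpha beta psi = mhd_momentum C T rho u b psi.
Proof.
move=> e1 aE bE tpsi F0; rewrite (elsasser_momentumE e1 aE bE (test_fun_past tpsi)).
move: F0; rewrite /magnetic_form (initial_open_slab _ tpsi) addr0 => F0.
by rewrite /induction_momentum F0 mulr0 addr0.
Qed.

End momentum.
End elsasser.

Section pressures.
Context {R : realType} {d : nat} (T : R).
Local Notation spacetime := (R * 'rV[R]_d)%type.

(** Take [psi = phi e_i]: pressures, which are only seen through the divergence
    of test fields, are thus determined up to their gradient. *)
Lemma div_x_single (i : 'I_d) (phi : spacetime -> R) :
  test_fun (open_slab T) phi -> exists2 psi : spacetime -> 'rV[R]_d,
    test_fun (open_slab T) psi & div_x psi = 'D_(dir_x i) phi.
Proof.
move=> tphi; pose psi z : 'rV[R]_d := \row_k ((k == i)%:R * phi z).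
have psiE k : (fun z => psi z 0 k) = (fun z => (k == i)%:R * phi z).
  by apply/funext => z; rewrite mxE.
have tpsi : test_fun (open_slab T) psi.
  apply: (test_fun_row tphi) => [k|k z nz].
    by rewrite psiE; exact: test_fun_smooth (test_funZ _ tphi).
  by rewrite mxE (supp_zero nz) mulr0.
exists psi => //; apply/funext => z.
have E k : jac_x psi z k k = (k == i)%:R * 'D_(dir_x k) phi z.
  apply: etrans (jac_x_coord _ _ _ tpsi) _.
  apply: etrans (congr1 (fun f => 'D_(dir_x k) f z) (psiE k)) _.
  exact: (deriveZ _ (smooth_derivable (test_fun_smooth tphi) _ _)).
rewrite /div_x /mxtrace (eq_bigr _ (fun k _ => E k)) (bigD1 i)//= eqxx mul1r.
by rewrite big1 ?addr0// => k /negPf ->; rewrite mul0r.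
Qed.

End pressures.

(** * Equivalence of the two systems *)

Section equivalence.
Context {R : realType} {d : nat} (C : 'M[R]_d) (T : R).
Hypothesis T0 : 0 < T.
Local Notation spacetime := (R * 'rV[R]_d)%type.
Local Notation nu := (@lebesgue_spacetime R d).
Local Notation mu := (lebesgue_measure_rV d).

Lemma same_grad_refl (p : @pressure R d) : same_grad T p p.
Proof.
split=> [|i phi tphi]; rewrite /sub_pressure /=.
  by under eq_fun do rewrite subrr; exact: L1loc0.
rewrite /pairing/= subrr add0r; under eq_fun do rewrite subrr.
by rewrite reg_dist0//; exact: measurable_open_slab.
Qed.

Section to_elsasser.
Variables (rho0 : 'rV[R]_d -> R) (u0 b0 : 'rV[R]_d -> 'rV[R]_d).
Variables (rho : spacetime -> R) (u b : spacetime -> 'rV[R]_d).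
Hypothesis Lu0 : L1loc_space_vec u0.
Hypothesis Lb0 : L1loc_space_vec b0.
Hypothesis divb0 : div_free_space b0.
Hypothesis sol : mhd_weak_solution C T rho0 u0 b0 rho u b.

Let alpha z := u z + b z.
Let beta z := u z - b z.
Let aE z : alpha z = u z + 1 *: b z. Proof. by rewrite scale1r. Qed.
Let bE z : beta z = u z - 1 *: b z. Proof. by rewrite scale1r. Qed.
Let aE' z : alpha z = u z - (-1) *: b z. Proof. by rewrite scaleN1r opprK. Qed.
Let bE' z : beta z = u z + (-1) *: b z. Proof. by rewrite scaleN1r. Qed.

Lemma elsasser_of_mhd :
  elsasser_weak_solution C T rho0 (fun x => u0 x + b0 x) (fun x => u0 x - b0 x)
    rho alpha beta.
Proof.
have [tr tu tb] := mhd_tempered sol; have [Lr Lu Lb] := mhd_L1loc sol.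
have [LF LI Lru] := mhd_L1loc_products sol.
have divb : div_free T b.
  exact (div_free_of_induction Lb (induction_flux_antisym u b) divb0
    (mhd_magnetic sol) T0).
have coordE e i : (fun z => (u z + e *: b z) 0 i) =
    (fun z => 1 * u z 0 i + e * b z 0 i).
  by apply/funext => z; rewrite !mxE mul1r.
have alphaE : alpha = fun z => u z + 1 *: b z by apply/funext.
have betaE : beta = fun z => u z + (-1) *: b z by apply/funext.
have meanE : (fun z => 2^-1 *: (alpha z + beta z)) = u.
  by apply/funext => z; apply/rowP => i; rewrite !mxE; field.
constructor.
- split => [//|i|i]; rewrite ?alphaE ?betaE coordE; exact: tempered_fun_lin.
- split => [//|i|i]; rewrite ?alphaE ?betaE coordE; exact: L1loc_lin.
- split => [i j|i].
    rewrite (_ : (fun z => _) =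
      fun z => 1 * mhd_flux u b z i j + (-1) * induction_flux u b z i j).
      exact: L1loc_lin.
    by apply/funext => z; rewrite tensE mhd_fluxE induction_fluxE !mxE; ring.
  rewrite (_ : (fun z => _) = fun z => 2 * (rho z *: u z) 0 i); first exact: L1locZ.
  by apply/funext => z; rewrite !mxE; ring.
- by rewrite meanE; exact: mhd_transport sol.
- move=> psi tpsi dpsi.
  rewrite (elsasser_weakE C Lu Lb LF LI Lru Lu0 Lb0 (mulr1 1) aE bE _ tpsi); last first.
    by move=> x; rewrite scale1r.
  rewrite (mhd_velocity sol tpsi dpsi) add0r mul1r; exact: mhd_magnetic sol _ tpsi.
- move=> psi tpsi dpsi.
  have e1 : (-1) * (-1) = 1 :> R by rewrite mulrNN mulr1.
  rewrite (elsasser_weakE C Lu Lb LF LI Lru Lu0 Lb0 e1 bE' aE' _ tpsi); last first.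
    by move=> x; rewrite scaleN1r.
  rewrite (mhd_velocity sol tpsi dpsi) add0r.
  by rewrite (_ : magnetic_form _ _ _ _ _ = 0) ?mulr0//; exact: mhd_magnetic sol _ tpsi.
- have divu := mhd_div_free sol.
  have lin e : div_free T (fun z => 1 *: u z + e *: b z) by exact: div_free_lin.
  split; [have := lin 1|have := lin (-1)]; congr div_free; apply/funext => z.
    by rewrite !scale1r.
  by rewrite scale1r scaleN1r.
Qed.

Lemma elsasser_pressures_of_mhd (Pi : @pressure R d) :
  mhd_pressure C T rho u b Pi ->
  let pi := pairing T (add_pressure Pi (magnetic_pressure b)) in
  elsasser_pressures C T rho alpha beta pi pi.
Proof.
have [Lr Lu Lb] := mhd_L1loc sol; have [LF LI Lru] := mhd_L1loc_products sol.
have e1 : (-1) * (-1) = 1 :> R by rewrite mulrNN mulr1.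
move=> [[_ tpi] eqpi] pi.
have E psi (tpsi : test_fun (open_slab T) psi) := elsasser_momentum_open C Lu Lb LF LI
  Lru (mulr1 1) aE bE tpsi (mhd_magnetic sol (test_fun_past tpsi)).
have E' psi (tpsi : test_fun (open_slab T) psi) := elsasser_momentum_open C Lu Lb LF LI
  Lru e1 bE' aE' tpsi (mhd_magnetic sol (test_fun_past tpsi)).
split; [exact: tpi|exact: tpi| |] => psi tpsi.
  exact (etrans (congr1 (fun r => r + pi (div_x psi)) (E psi tpsi)) (eqpi psi tpsi)).
exact (etrans (congr1 (fun r => r + pi (div_x psi)) (E' psi tpsi)) (eqpi psi tpsi)).
Qed.

(** The function part of a pressure is absorbed in its distribution part. *)
Lemma same_grad_pairing (p : @pressure R d) : tempered_pressure T p ->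
  same_grad T p (dist_pressure (pairing T p)).
Proof.
move=> [Lp _]; have E : (fun z => p_fun p z - 0) = p_fun p.
  by apply/funext => z; rewrite subr0.
split=> [|i phi tphi]; rewrite /sub_pressure/=; first by rewrite E.
rewrite /pairing/= E; move: (p_dist p _) (reg_dist _ _ _) => P Q.
by ring.
Qed.

End to_elsasser.

Section to_mhd.
Variables (rho0 : 'rV[R]_d -> R) (alpha0 beta0 : 'rV[R]_d -> 'rV[R]_d).
Variables (rho : spacetime -> R) (alpha beta : spacetime -> 'rV[R]_d).
Variables p q : R.
Hypothesis d0 : (0 < d)%N.
Hypothesis Lalpha0 : L1loc_space_vec alpha0.
Hypothesis Lbeta0 : L1loc_space_vec beta0.
Hypothesis divalpha0 : div_free_space alpha0.
Hypothesis divbeta0 : div_free_space beta0.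
Hypothesis sol : elsasser_weak_solution C T rho0 alpha0 beta0 rho alpha beta.
Hypotheses (p1 : 1 <= p) (q1 : 1 <= q).
Hypothesis Lp0 : forall i, (fun x => alpha0 x 0 i - beta0 x 0 i) \in Lfun mu p%:E.
Hypothesis Lp : forall i, L1loc_Lp T p (fun z => alpha z 0 i - beta z 0 i).
Hypothesis Lq : forall j k, L1loc_Lp T q (fun z => alpha z 0 j * beta z 0 k).

Let u0 x := 2^-1 *: (alpha0 x + beta0 x).
Let b0 x := 2^-1 *: (alpha0 x - beta0 x).
Let u z := 2^-1 *: (alpha z + beta z).
Let b z := 2^-1 *: (alpha z - beta z).

Let e1 : (-1) * (-1) = 1 :> R. Proof. by rewrite mulrNN mulr1. Qed.

Let sum_half (x y : 'rV[R]_d) : x = 2^-1 *: (x + y) + 1 *: (2^-1 *: (x - y)).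
Proof. by apply/rowP => i; rewrite !mxE; field. Qed.
Let sub_half (x y : 'rV[R]_d) : y = 2^-1 *: (x + y) - 1 *: (2^-1 *: (x - y)).
Proof. by apply/rowP => i; rewrite !mxE; field. Qed.

Let aE z : alpha z = u z + 1 *: b z. Proof. exact: sum_half. Qed.
Let bE z : beta z = u z - 1 *: b z. Proof. exact: sub_half. Qed.
Let aE' z : alpha z = u z - (-1) *: b z.
Proof. by rewrite {1}aE scaleN1r opprK scale1r. Qed.
Let bE' z : beta z = u z + (-1) *: b z.
Proof. by rewrite {1}bE scaleN1r scale1r. Qed.
Let a0E x : alpha0 x = u0 x + 1 *: b0 x. Proof. exact: sum_half. Qed.
Let b0E x : beta0 x = u0 x + (-1) *: b0 x.
Proof. by rewrite {1}(sub_half (alpha0 x) (beta0 x)) scaleN1r scale1r. Qed.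

Let u_coord i : (fun z => u z 0 i) = fun z => 2^-1 * alpha z 0 i + 2^-1 * beta z 0 i.
Proof. by apply/funext => z; rewrite !mxE mulrDr. Qed.
Let b_coord i : (fun z => b z 0 i) =
  fun z => 2^-1 * alpha z 0 i + (- 2^-1) * beta z 0 i.
Proof. by apply/funext => z; rewrite !mxE; ring. Qed.
Let mhd_flux_coord i j : (fun z => mhd_flux u b z i j) =
  fun z => 2^-1 * tens (alpha z) (beta z) i j + 2^-1 * tens (alpha z) (beta z) j i.
Proof. by apply/funext => z; rewrite mhd_fluxE !tensE !mxE; field. Qed.
Let induction_flux_coord i j : (fun z => induction_flux u b z i j) =
  fun z => 2^-1 * tens (alpha z) (beta z) j i + (- 2^-1) * tens (alpha z) (beta z) i j.
Proof. by apply/funext => z; rewrite induction_fluxE !tensE !mxE; field. Qed.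
Let u0_coord i : (fun x => u0 x 0 i) = fun x => 2^-1 * alpha0 x 0 i + 2^-1 * beta0 x 0 i.
Proof. by apply/funext => x; rewrite !mxE mulrDr. Qed.
Let b0_coord i : (fun x => b0 x 0 i) =
  fun x => 2^-1 * alpha0 x 0 i + (- 2^-1) * beta0 x 0 i.
Proof. by apply/funext => x; rewrite !mxE; ring. Qed.

Let Lu : L1loc_vec (slab T) u.
Proof.
by have [_ La Lb] := elsasser_L1loc sol; move=> i; rewrite u_coord; exact: L1loc_lin.
Qed.
Let Lb : L1loc_vec (slab T) b.
Proof.
by have [_ La Lb] := elsasser_L1loc sol; move=> i; rewrite b_coord; exact: L1loc_lin.
Qed.
Let LF : L1loc_mx (slab T) (mhd_flux u b).
Proof.
have [Lab _] := elsasser_L1loc_products sol.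
by move=> i j; rewrite mhd_flux_coord; exact: L1loc_lin.
Qed.
Let LI : L1loc_mx (slab T) (induction_flux u b).
Proof.
have [Lab _] := elsasser_L1loc_products sol.
by move=> i j; rewrite induction_flux_coord; exact: L1loc_lin.
Qed.
Let Lru : L1loc_vec (slab T) (fun z => rho z *: u z).
Proof.
have [_ Lr] := elsasser_L1loc_products sol; move=> i.
rewrite (_ : (fun z => _) = fun z => 2^-1 * (rho z *: (alpha z + beta z)) 0 i).
  exact: L1locZ.
by apply/funext => z; rewrite !mxE mulrCA.
Qed.
Let Lu0 : L1loc_space_vec u0.
Proof. by move=> i; rewrite u0_coord; exact: L1loc_space_lin. Qed.
Let Lb0 : L1loc_space_vec b0.
Proof. by move=> i; rewrite b0_coord; exact: L1loc_space_lin. Qed.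

Let divb0 : div_free_space b0.
Proof.
rewrite (_ : b0 = fun x => 2^-1 *: alpha0 x + (- 2^-1) *: beta0 x).
  exact: div_free_space_lin.
by apply/funext => x; rewrite /b0 scalerBr scaleNr.
Qed.

Let divu : div_free T u.
Proof.
have [_ La Lb'] := elsasser_L1loc sol; have [da db] := elsasser_div_free sol.
rewrite (_ : u = fun z => 2^-1 *: alpha z + 2^-1 *: beta z); first exact: div_free_lin.
by apply/funext => x; rewrite /u scalerDr.
Qed.

Let divb : div_free T b.
Proof.
have [_ La Lb'] := elsasser_L1loc sol; have [da db] := elsasser_div_free sol.
rewrite (_ : b = fun z => 2^-1 *: alpha z + (- 2^-1) *: beta z); first exact: div_free_lin.
by apply/funext => x; rewrite /b scalerBr scaleNr.
Qed.

(** Half the sum and half the difference of the Elsasser equations. *)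
Let weak_div_free psi : test_fun (past_slab T) psi ->
  (forall z, 0 <= z.1 -> div_x psi z = 0) ->
  mhd_momentum C T rho u b psi + \int[mu]_x dot (u0 x) (psi (0, x)) = 0 /\
  magnetic_form T b (induction_flux u b) b0 psi = 0.
Proof.
move=> tpsi dpsi.
have Ea := etrans (esym (elsasser_weakE C Lu Lb LF LI Lru Lu0 Lb0 (mulr1 1) aE bE a0E tpsi))
  (elsasser_alpha sol tpsi dpsi).
have Eb := etrans (esym (elsasser_weakE C Lu Lb LF LI Lru Lu0 Lb0 e1 bE' aE' b0E tpsi))
  (elsasser_beta sol tpsi dpsi).
move: Ea Eb; move: (mhd_momentum _ _ _ _ _ _ + _) (magnetic_form _ _ _ _ _) => M F.
by move=> ? ?; split; lra.
Qed.

(** The coefficients of the induction equation are linear combinations of the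
    products [alpha^j beta^k] and of the differences [alpha - beta], which decay
    by assumption. *)
Let induction_eq psi : test_fun (past_slab T) psi ->
  magnetic_form T b (induction_flux u b) b0 psi = 0.
Proof.
have [_ La Lb'] := elsasser_L1loc sol; have [Lab _] := elsasser_L1loc_products sol.
have Lsub j : L1loc (slab T) (fun z => alpha z 0 j - beta z 0 j).
  rewrite (_ : (fun z => _) = fun z => 1 * alpha z 0 j + (-1) * beta z 0 j).
    exact: L1loc_lin.
  by apply/funext => z; rewrite mul1r mulN1r.
have Lsub0 j : L1loc_space (fun x => alpha0 x 0 j - beta0 x 0 j).
  rewrite (_ : (fun x => _) = fun x => 1 * alpha0 x 0 j + (-1) * beta0 x 0 j).
    exact: L1loc_space_lin.
  by apply/funext => x; rewrite mul1r mulN1r.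
apply: (induction_rigidity Lb LI Lb0 (induction_flux_antisym u b) divb0 divb _ d0).
- by move=> zeta tz dz; have [] := weak_div_free tz dz.
- move=> j; have D : decaying T nu (slab T) id (fun z => alpha z 0 j - beta z 0 j).
    by move=> phi x; exact: (slab_decay (Lsub j) (Lp j) p1).
  have L := loc_integrable_slab (Lsub j).
  rewrite (_ : (fun z => _) = fun z => 2^-1 * (alpha z 0 j - beta z 0 j) +
    0 * (alpha z 0 j - beta z 0 j)); first exact: (decaying_lin _ _ L L D D).
  by apply/funext => z; rewrite !mxE mul0r addr0.
- have D i j : decaying T nu (slab T) id (fun z => tens (alpha z) (beta z) i j).
    rewrite (_ : (fun z => _) = fun z => alpha z 0 i * beta z 0 j); last first.
      by apply/funext => z; rewrite tensE.
    move=> phi x; apply: (slab_decay _ (Lq i j) q1).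
    rewrite (_ : (fun z => _) = fun z => tens (alpha z) (beta z) i j)//.
    by apply/funext => z; rewrite tensE.
  move=> i j; rewrite induction_flux_coord.
  exact: (decaying_lin _ _ (loc_integrable_slab (Lab j i))
    (loc_integrable_slab (Lab i j)) (D j i) (D i j)).
- move=> j; have N : ('N[mu]_p%:E[EFin \o (fun x => (alpha0 x 0 j - beta0 x 0 j)%R)] < +oo)%E.
    exact: (set_mem (sub_Lfun_finLfun (Lp0 j))).
  have D : decaying T mu setT (fun x => (0, x)) (fun x => alpha0 x 0 j - beta0 x 0 j).
    by move=> phi x; exact: (space_decay (Lsub0 j) N p1).
  have L := loc_integrable_space T (Lsub0 j).
  rewrite (_ : (fun x => _) = fun x => 2^-1 * (alpha0 x 0 j - beta0 x 0 j) +
    0 * (alpha0 x 0 j - beta0 x 0 j)); first exact: (decaying_lin _ _ L L D D).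
  by apply/funext => z; rewrite !mxE mul0r addr0.
Qed.

Lemma mhd_of_elsasser : mhd_weak_solution C T rho0 u0 b0 rho u b.
Proof.
have [tr ta tb] := elsasser_tempered sol; have [Lr La Lb'] := elsasser_L1loc sol.
split => //.
- split => // i; first by rewrite u_coord; exact: tempered_fun_lin.
  by rewrite b_coord; exact: tempered_fun_lin.
- exact: elsasser_transport sol.
- by move=> psi tpsi dpsi; have [] := weak_div_free tpsi dpsi.
Qed.

Lemma mhd_pressure_of_elsasser (pi1 pi2 : functional R d) :
  elsasser_pressures C T rho alpha beta pi1 pi2 ->
  same_grad T (dist_pressure pi1) (dist_pressure pi2) /\
  mhd_pressure C T rho u b
    (add_pressure (dist_pressure pi1) (fun z => - magnetic_pressure b z)).
Proof.
move=> [t1 t2 eq1 eq2].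
have Ea psi (tpsi : test_fun (open_slab T) psi) := elsasser_momentum_open C Lu Lb LF LI
  Lru (mulr1 1) aE bE tpsi (induction_eq (test_fun_past tpsi)).
have Eb psi (tpsi : test_fun (open_slab T) psi) := elsasser_momentum_open C Lu Lb LF LI
  Lru e1 bE' aE' tpsi (induction_eq (test_fun_past tpsi)).
have fun0 : p_fun (add_pressure (add_pressure (dist_pressure pi1)
    (fun z => - magnetic_pressure b z)) (magnetic_pressure b)) = fun=> 0.
  by apply/funext => z /=; rewrite add0r addNr.
split.
  split=> [|i phi tphi]; rewrite /sub_pressure/=.
    by under eq_fun do rewrite subrr; exact: L1loc0.
  rewrite /pairing/= (_ : (fun=> 0 - 0) = fun=> 0); last by apply/funext => z; rewrite subr0.
  rewrite reg_dist0 ?addr0; last exact: measurable_open_slab.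
  have [psi tpsi <-] := div_x_single i tphi.
  have := eq1 psi tpsi; have := eq2 psi tpsi; rewrite Ea// Eb//.
  by move: (mhd_momentum _ _ _ _ _ _) (pi1 _) (pi2 _) => M P1 P2 ? ?; lra.
have pairE phi : pairing T (add_pressure (add_pressure (dist_pressure pi1)
    (fun z => - magnetic_pressure b z)) (magnetic_pressure b)) phi = pi1 phi.
  by rewrite /pairing fun0 reg_dist0 ?addr0//; exact: measurable_open_slab.
split.
  split; first by rewrite fun0; exact: L1loc0.
  rewrite (_ : pairing T _ = pi1)//; exact/funext.
by move=> psi tpsi; rewrite pairE -Ea//; exact: eq1.
Qed.

End to_mhd.
End equivalence.
Theorem theorem4p3 (R : realType) (d : nat) (hd : (2 <= d)%N)
  (C : 'M[R]_d) (T : R) (hT : 0 < T) :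
  (forall (rho0 : 'rV[R]_d -> R) (u0 b0 : 'rV[R]_d -> 'rV[R]_d)
      (rho : R * 'rV[R]_d -> R) (u b : R * 'rV[R]_d -> 'rV[R]_d),
    L1loc_space rho0 -> L1loc_space_vec u0 -> L1loc_space_vec b0 ->
    div_free_space u0 -> div_free_space b0 ->
    mhd_weak_solution C T rho0 u0 b0 rho u b ->
    let alpha0 := fun x => u0 x + b0 x in
    let beta0 := fun x => u0 x - b0 x in
    let alpha := fun z => u z + b z in
    let beta := fun z => u z - b z in
    elsasser_weak_solution C T rho0 alpha0 beta0 rho alpha beta /\
    forall Pi : pressure, mhd_pressure C T rho u b Pi ->
      let pi := add_pressure Pi (magnetic_pressure b) in
      exists pi1 pi2 : functional R d,
        [/\ elsasser_pressures C T rho alpha beta pi1 pi2,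
            same_grad T pi (dist_pressure pi1)
          & same_grad T (dist_pressure pi1) (dist_pressure pi2)])
  /\
  (forall (rho0 : 'rV[R]_d -> R) (alpha0 beta0 : 'rV[R]_d -> 'rV[R]_d)
      (rho : R * 'rV[R]_d -> R) (alpha beta : R * 'rV[R]_d -> 'rV[R]_d)
      (p q : R),
    L1loc_space rho0 -> L1loc_space_vec alpha0 -> L1loc_space_vec beta0 ->
    div_free_space alpha0 -> div_free_space beta0 ->
    elsasser_weak_solution C T rho0 alpha0 beta0 rho alpha beta ->
    1 <= p -> 1 <= q ->
    (forall i, (fun x => alpha0 x 0 i - beta0 x 0 i)
                 \in Lfun (lebesgue_measure_rV d) p%:E) ->
    (forall i, L1loc_Lp T p (fun z => alpha z 0 i - beta z 0 i)) ->
    (forall j k, L1loc_Lp T q (fun z => alpha z 0 j * beta z 0 k)) ->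
    let u0 := fun x => 2^-1 *: (alpha0 x + beta0 x) in
    let b0 := fun x => 2^-1 *: (alpha0 x - beta0 x) in
    let u := fun z => 2^-1 *: (alpha z + beta z) in
    let b := fun z => 2^-1 *: (alpha z - beta z) in
    mhd_weak_solution C T rho0 u0 b0 rho u b /\
    forall pi1 pi2 : functional R d,
      elsasser_pressures C T rho alpha beta pi1 pi2 ->
      same_grad T (dist_pressure pi1) (dist_pressure pi2) /\
      exists Pi : pressure,
        mhd_pressure C T rho u b Pi /\
        same_grad T Pi
          (add_pressure (dist_pressure pi1) (fun z => - magnetic_pressure b z))).

Proof.
split=> [rho0 u0 b0 rho u b _ Lu0 Lb0 _ divb0 sol|].
  split=> [|Pi hPi]; first exact: elsasser_of_mhd sol.
  pose pi := pairing T (add_pressure Pi (magnetic_pressure b)).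
  exists pi, pi; split.
  - exact: (elsasser_pressures_of_mhd sol hPi).
  - by apply: same_grad_pairing; case: hPi.
  - exact: same_grad_refl.
move=> rho0 alpha0 beta0 rho alpha beta p q _ La0 Lb0 da0 db0 sol p1 q1 Lp0 Lp Lq.
have d0 : (0 < d)%N by exact: ltn_trans hd.
split=> [|pi1 pi2 hpi]; first exact: (mhd_of_elsasser d0 La0 Lb0 da0 db0 sol p1 q1 Lp0 Lp Lq).
have [g12 hPi] := mhd_pressure_of_elsasser d0 La0 Lb0 da0 db0 sol p1 q1 Lp0 Lp Lq hpi.
split=> //; eexists; split; first exact: hPi.
exact: same_grad_refl.
Qed.
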